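(* Let $q\in\mathbb{C}^*$ be generic (not a root of unity). Let $A_{\Sigma_{0,4}}$ be the moduli algebra of the four-punctured sphere, with generator matrices $A=(a^i_j)$, $B=(b^i_j)$, $C=(c^i_j)$, and let $\mathscr{A}_{\Sigma_{0,4}}\subset A_{\Sigma_{0,4}}$ be the subalgebra of $\mathcal{U}_q(\mathfrak{sl}_2)$-invariants (all defined in the context). Then $\mathscr{A}_{\Sigma_{0,4}}$ has a presentation with generators $$E:=\mathrm{tr}_q(AB),\ F:=\mathrm{tr}_q(AC),\ G:=\mathrm{tr}_q(BC),\ s:=\mathrm{tr}_q(A),\ t:=\mathrm{tr}_q(B),\ u:=\mathrm{tr}_q(C),\ v:=\mathrm{tr}_q(ABC)$$ and relations: $s,t,u,v$ are central, and $$FE=q^2EF+(q^2-q^{-2})G+(1-q^2)(sv+tu),$$ $$GE=q^{-2}EG-q^{-2}(q^2-q^{-2})F+(1-q^{-2})(su+tv),$$ $$GF=q^2FG+(q^2-q^{-2})E+(1-q^2)(st+uv),$$ $$EFG=-E^2-q^{-4}F^2-G^2-q^{-2}(s^2+t^2+u^2+v^2)+(st+uv)E+q^{-2}(su+tv)F+(sv+tu)G-stuv+q^{-6}(q^2+1)^2 .$$ Furthermore, the monomials $$\{E^mF^nG^l s^at^bu^cv^d : m,n,l,a,b,c,d\in\mathbb{N}_0,\ m=0\text{ or }n=0\text{ or }l=0\}$$ form a $\mathbb{C}$-basis of $\mathscr{A}_{\Sigma_{0,4}}$.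
   Context: All tensor indices range over $\{1,2\}$. The algebra $A_{\Sigma_{0,4}}$ is the $\mathbb{C}$-algebra with twelve generators $a^i_j,b^i_j,c^i_j$, subject to the following relations. (1) For each letter $x\in\{a,b,c\}$ (reflection equation algebra relations): $x^1_2x^1_1=x^1_1x^1_2+(1-q^{-2})x^1_2x^2_2$; $x^2_1x^1_1=x^1_1x^2_1-q^{-2}(1-q^{-2})x^2_1x^2_2$; $x^2_1x^1_2=x^1_2x^2_1+(1-q^{-2})(x^1_1x^2_2-x^2_2x^2_2)$; $x^2_2x^1_1=x^1_1x^2_2$; $x^2_2x^1_2=q^2x^1_2x^2_2$; $x^2_2x^2_1=q^{-2}x^2_1x^2_2$; $x^1_1x^2_2=1+q^2x^1_2x^2_1$. (2) For each pair of letters $x<y$ (with $a<b<c$), the crossing relations $$y^e_f\,x^g_h=\sum_{i,j,k,l,m,n,o,p}\tilde R^{ig}_{fj}R^{ej}_{kl}R^{mn}_{ih}(R^{-1})^{ko}_{pn}\;x^l_o\,y^p_m .$$ The nonzero entries are: $R^{11}_{11}=R^{22}_{22}=q^{1/2}q$, $R^{12}_{12}=R^{21}_{21}=q^{1/2}$, $R^{21}_{12}=q^{1/2}(q-q^{-1})$; $(R^{-1})^{11}_{11}=(R^{-1})^{22}_{22}=q^{-1/2}q^{-1}$, $(R^{-1})^{12}_{12}=(R^{-1})^{21}_{21}=q^{-1/2}$, $(R^{-1})^{21}_{12}=-q^{-1/2}(q-q^{-1})$; $\tilde R^{11}_{11}=\tilde R^{22}_{22}=q^{-1/2}q^{-1}$,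 $\tilde R^{12}_{12}=\tilde R^{21}_{21}=q^{-1/2}$, $\tilde R^{21}_{12}=q^{-1/2}q^{-2}(q^{-1}-q)$. (The powers of $q^{1/2}$ cancel in the crossing relations.) Matrices: $A=\begin{pmatrix} a^1_1 & a^1_2 \\ a^2_1 & a^2_2 \end{pmatrix}$, similarly $B,C$; products such as $AB$ are ordinary matrix products with entries in $A_{\Sigma_{0,4}}$. The quantum trace is $\mathrm{tr}_q(X)=X^1_1+q^{-2}X^2_2$. Action: the quantum group $\mathcal{U}_q(\mathfrak{sl}_2)$ has generators $\mathsf{e},\mathsf{f},\mathsf{k}^{\pm1}$, coproduct $\Delta(\mathsf e)=\mathsf e\otimes1+\mathsf k^{-1}\otimes\mathsf e$, $\Delta(\mathsf f)=\mathsf f\otimes\mathsf k+1\otimes\mathsf f$, $\Delta(\mathsf k)=\mathsf k\otimes\mathsf k$, counit $\epsilon(\mathsf e)=\epsilon(\mathsf f)=0$, $\epsilon(\mathsf k)=1$. It acts on $A_{\Sigma_{0,4}}$ making it a module algebra ($h\cdot(zw)=\sum (h_{(1)}\cdot z)(h_{(2)}\cdot w)$), with, for $x\in\{a,b,c\}$: $\mathsf k\cdot x^1_1=x^1_1$, $\mathsf k\cdot x^1_2=q^2x^1_2$, $\mathsf k\cdot x^2_1=q^{-2}x^2_1$, $\mathsf k\cdot x^2_2=x^2_2$; $\mathsf e\cdot x^1_1=q^{-1}x^1_2$, $\mathsf e\cdot x^1_2=0$, $\mathsf e\cdot x^2_1=q(x^2_2-x^1_1)$, $\mathsf e\cdot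 x^2_2=-qx^1_2$; $\mathsf f\cdot x^1_1=-q^{-2}x^2_1$, $\mathsf f\cdot x^1_2=x^1_1-x^2_2$, $\mathsf f\cdot x^2_1=0$, $\mathsf f\cdot x^2_2=x^2_1$. The invariant subalgebra is $\mathscr{A}_{\Sigma_{0,4}}=\{z: h\cdot z=\epsilon(h)z\ \forall h\}$. *)

(* Defs.v *)
From HB Require Import structures.
From mathcomp Require Import all_boot all_order all_algebra.
From mathcomp Require Import finmap reals complex monalg.

Set Implicit Arguments.
Unset Strict Implicit.
Unset Printing Implicit Defensive.

Import Order.TTheory GRing.Theory Num.Theory.
Local Open Scope ring_scope.

(* The free algebra is the monoid algebra of the free monoid of words over X. *)
Notation freealg C X := {malg C[{fmonom X}]}.

Section Presentations.
Variables (C : fieldType) (X : choiceType).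

Definition freevar (x : X) : freealg C X := << fmu x >>.

Definition freeeval (A : lalgType C) (g : X -> A) (p : freealg C X) : A :=
  \sum_(w <- msupp p) p@_w *: \prod_(x <- (w : seq X)) g x.

Definition in_ideal (rels : freealg C X -> Prop) (p : freealg C X) : Prop :=
  exists2 s : seq (freealg C X * freealg C X * freealg C X),
    (forall t, t \in s -> rels t.1.2) & p = \sum_(t <- s) t.1.1 * t.1.2 * t.2.

(* A family of relations is given as a predicate on the elements "left-hand
   side minus right-hand side", parametric in the algebra so that it can be
   read in the free algebra. S is the (sub)algebra being presented. *)
Definition presented_by (A : algType C) (S : A -> Prop) (g : X -> A)
    (rels : forall B : lalgType C, (X -> B) -> B -> Prop) : Prop :=
  (forall z, S z <-> exists p, z = freeeval g p) /\
  (forall p, freeeval g p = 0 <-> in_ideal (rels (freealg C X) freevar) p).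

End Presentations.

Definition is_basis (C : fieldType) (A : lmodType C) (S : A -> Prop)
    (I : eqType) (P : pred I) (b : I -> A) : Prop :=
  [/\ forall i, P i -> S (b i),
      forall (s : seq I) (c : I -> C), uniq s -> all P s ->
        \sum_(i <- s) c i *: b i = 0 -> forall i, i \in s -> c i = 0
    & forall z, S z -> exists (s : seq I) (c : I -> C),
        all P s /\ z = \sum_(i <- s) c i *: b i].

Inductive uq_gen := uE | uF | uK | uKi.

Definition uq_gen_code (g : uq_gen) : 'I_4 :=
  match g with uE => inord 0 | uF => inord 1 | uK => inord 2 | uKi => inord 3 end.
Definition uq_gen_decode (n : 'I_4) : uq_gen := nth uE [:: uE; uF; uK; uKi] n.
Lemma uq_gen_codeK : cancel uq_gen_code uq_gen_decode.
Proof. by case; rewrite /uq_gen_decode /= inordK. Qed.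
HB.instance Definition _ := Choice.copy uq_gen (can_type uq_gen_codeK).

Section QuantumGroup.
Variables (C : fieldType) (q : C).

Definition uq_rels (B : lalgType C) (g : uq_gen -> B) : B -> Prop :=
  let e := g uE in let f := g uF in let k := g uK in let ki := g uKi in
  fun r => r \in [:: k * ki - 1;
                     ki * k - 1;
                     k * e - q ^+ 2 *: (e * k);
                     k * f - q ^- 2 *: (f * k);
                     e * f - f * e - (q - q^-1)^-1 *: (k - ki)].

Definition is_Uq_sl2 (U : algType C) (ug : uq_gen -> U) : Prop :=
  presented_by (fun _ => True) ug uq_rels.

Definition is_counit (U : algType C) (ug : uq_gen -> U)
    (eps : {lrmorphism U -> C^o}) : Prop :=
  [/\ eps (ug uE) = 0, eps (ug uF) = 0, eps (ug uK) = 1 & eps (ug uKi) = 1].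

(* The list [:: (v1, w1); ...] of pairs of words in the generators stands for
   the tensor v1 (x) w1 + ... : every coefficient occurring in the coproduct
   of a word is a sum of 1's. *)
Definition coprod_gen (g : uq_gen) : seq (seq uq_gen * seq uq_gen) :=
  match g with
  | uE => [:: ([:: uE], [::]); ([:: uKi], [:: uE])]
  | uF => [:: ([:: uF], [:: uK]); ([::], [:: uF])]
  | uK => [:: ([:: uK], [:: uK])]
  | uKi => [:: ([:: uKi], [:: uKi])]
  end.

Fixpoint coprod (w : seq uq_gen) : seq (seq uq_gen * seq uq_gen) :=
  if w is g :: w' then
    [seq (p.1 ++ p'.1, p.2 ++ p'.2) | p <- coprod_gen g, p' <- coprod w']
  else [:: ([::], [::])].

(* Words span U, so stating the compatibility with the product on words gives
   it for all elements of U. *)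
Record module_algebra (U A : algType C) (ug : uq_gen -> U)
    (eps : {lrmorphism U -> C^o}) (act : U -> A -> A) : Prop := ModuleAlgebra {
  act_linearl : forall z, linear (act^~ z);
  act_linearr : forall h, linear (act h);
  act_one : forall z, act 1 z = z;
  act_comp : forall h h' z, act (h * h') z = act h (act h' z);
  act_unit : forall h, act h 1 = eps h *: 1;
  act_mul : forall (w : seq uq_gen) z z',
    act (\prod_(g <- w) ug g) (z * z') =
    \sum_(p <- coprod w) act (\prod_(g <- p.1) ug g) z
                         * act (\prod_(g <- p.2) ug g) z' }.

Definition Uq_invariant (U A : algType C) (eps : {lrmorphism U -> C^o})
    (act : U -> A -> A) (z : A) : Prop :=
  forall h, act h z = eps h *: z.

End QuantumGroup.

(* Tensor indices 1, 2 are 0, 1 : 'I_2, and x^i_j is the matrix entry x i j.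
   The letters a < b < c are 0, 1, 2 : 'I_3. *)
Section FourPuncturedSphere.
Variables (C : numClosedFieldType) (q : C).

(* Rmat i j k l is R^{ij}_{kl}; q^{1/2} is sqrtC q. *)
Definition Rmat (i j k l : 'I_2) : C :=
  sqrtC q * (if (i == k) && (j == l) then if i == j then q else 1
             else if [&& i == 1, j == 0, k == 0 & l == 1] then q - q^-1
             else 0).

Definition Rinv (i j k l : 'I_2) : C :=
  (sqrtC q)^-1 * (if (i == k) && (j == l) then if i == j then q^-1 else 1
                  else if [&& i == 1, j == 0, k == 0 & l == 1] then - (q - q^-1)
                  else 0).

Definition Rtilde (i j k l : 'I_2) : C :=
  (sqrtC q)^-1 * (if (i == k) && (j == l) then if i == j then q^-1 else 1
                  else if [&& i == 1, j == 0, k == 0 & l == 1]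
                       then q ^- 2 * (q^-1 - q)
                  else 0).

Definition reflection_rels (B : lalgType C) (x : 'M[B]_2) : seq B :=
  let x11 := x 0 0 in let x12 := x 0 1 in
  let x21 := x 1 0 in let x22 := x 1 1 in
  [:: x12 * x11 - (x11 * x12 + (1 - q ^- 2) *: (x12 * x22));
      x21 * x11 - (x11 * x21 - (q ^- 2 * (1 - q ^- 2)) *: (x21 * x22));
      x21 * x12 - (x12 * x21 + (1 - q ^- 2) *: (x11 * x22 - x22 * x22));
      x22 * x11 - x11 * x22;
      x22 * x12 - q ^+ 2 *: (x12 * x22);
      x22 * x21 - q ^- 2 *: (x21 * x22);
      x11 * x22 - (1 + q ^+ 2 *: (x12 * x21))].

Definition crossing_rel (B : lalgType C) (x y : 'M[B]_2) (e f g h : 'I_2) : B :=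
  y e f * x g h -
  \sum_(i < 2) \sum_(j < 2) \sum_(k < 2) \sum_(l < 2)
  \sum_(m < 2) \sum_(n < 2) \sum_(o < 2) \sum_(p < 2)
    (Rtilde i g f j * Rmat e j k l * Rmat m n i h * Rinv k o p n)
      *: (x l o * y p m).

Definition sphere_gen : choiceType := ('I_3 * 'I_2 * 'I_2)%type.

Definition sphere_rels (B : lalgType C) (x : sphere_gen -> B) (r : B) : Prop :=
  let M (s : 'I_3) : 'M[B]_2 := \matrix_(i, j) x (s, i, j) in
  (exists s : 'I_3, r \in reflection_rels (M s)) \/
  (exists s t : 'I_3, (s < t)%N /\
     exists e f g h : 'I_2, r = crossing_rel (M s) (M t) e f g h).

Definition is_sphere_algebra (A : algType C) (M : 'I_3 -> 'M[A]_2) : Prop :=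
  presented_by (fun _ => True) (fun v : sphere_gen => M v.1.1 v.1.2 v.2)
    sphere_rels.

Definition acts_on_generators (U A : algType C) (ug : uq_gen -> U)
    (act : U -> A -> A) (M : 'I_3 -> 'M[A]_2) : Prop :=
  forall s : 'I_3,
  let x11 := M s 0 0 in let x12 := M s 0 1 in
  let x21 := M s 1 0 in let x22 := M s 1 1 in
  let e := act (ug uE) in let f := act (ug uF) in let k := act (ug uK) in
  [/\ [/\ k x11 = x11, k x12 = q ^+ 2 *: x12,
          k x21 = q ^- 2 *: x21 & k x22 = x22],
      [/\ e x11 = q^-1 *: x12, e x12 = 0,
          e x21 = q *: (x22 - x11) & e x22 = - (q *: x12)]
    & [/\ f x11 = - (q ^- 2 *: x21), f x12 = x11 - x22,
          f x21 = 0 & f x22 = x21]].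

Definition qtrace (A : lmodType C) (X : 'M[A]_2) : A :=
  X 0 0 + q ^- 2 *: X 1 1.

End FourPuncturedSphere.

Inductive inv_gen := gE | gF | gG | gs | gt | gu | gv.

Definition inv_gen_code (g : inv_gen) : 'I_7 :=
  match g with
  | gE => inord 0 | gF => inord 1 | gG => inord 2
  | gs => inord 3 | gt => inord 4 | gu => inord 5 | gv => inord 6
  end.
Definition inv_gen_decode (n : 'I_7) : inv_gen :=
  nth gE [:: gE; gF; gG; gs; gt; gu; gv] n.
Lemma inv_gen_codeK : cancel inv_gen_code inv_gen_decode.
Proof. by case; rewrite /inv_gen_decode /= inordK. Qed.
HB.instance Definition _ := Choice.copy inv_gen (can_type inv_gen_codeK).

Section InvariantAlgebra.
Variables (C : numClosedFieldType) (q : C).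

Definition inv_elt (A : algType C) (M : 'I_3 -> 'M[A]_2) (g : inv_gen) : A :=
  let A_ := M 0 in let B_ := M 1 in let C_ := M 2 in
  match g with
  | gE => qtrace q (A_ *m B_)
  | gF => qtrace q (A_ *m C_)
  | gG => qtrace q (B_ *m C_)
  | gs => qtrace q A_
  | gt => qtrace q B_
  | gu => qtrace q C_
  | gv => qtrace q (A_ *m B_ *m C_)
  end.

Definition inv_rels (B : lalgType C) (x : inv_gen -> B) (r : B) : Prop :=
  let E := x gE in let F := x gF in let G := x gG in
  let s := x gs in let t := x gt in let u := x gu in let v := x gv in
  (exists z y, z \in [:: gs; gt; gu; gv] /\ r = x z * x y - x y * x z) \/
  r \in
  [:: F * E - (q ^+ 2 *: (E * F) + (q ^+ 2 - q ^- 2) *: G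
               + (1 - q ^+ 2) *: (s * v + t * u));
      G * E - (q ^- 2 *: (E * G) - (q ^- 2 * (q ^+ 2 - q ^- 2)) *: F
               + (1 - q ^- 2) *: (s * u + t * v));
      G * F - (q ^+ 2 *: (F * G) + (q ^+ 2 - q ^- 2) *: E
               + (1 - q ^+ 2) *: (s * t + u * v));
      E * F * G -
        (- E ^+ 2 - q ^- 4 *: F ^+ 2 - G ^+ 2
         - q ^- 2 *: (s ^+ 2 + t ^+ 2 + u ^+ 2 + v ^+ 2)
         + (s * t + u * v) * E + q ^- 2 *: ((s * u + t * v) * F)
         + (s * v + t * u) * G - s * t * u * v
         + (q ^- 6 * (q ^+ 2 + 1) ^+ 2)%:A)].

(* ((m, n, l), (a, b, c, d)) is the exponent of E^m F^n G^l s^a t^b u^c v^d. *)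
Definition inv_exp : eqType :=
  ((nat * nat * nat) * (nat * nat * nat * nat))%type.

Definition inv_exp_ok (i : inv_exp) : bool :=
  let: ((m, n, l), _) := i in [|| m == 0%N, n == 0%N | l == 0%N].

Definition inv_monomial (A : algType C) (x : inv_gen -> A) (i : inv_exp) : A :=
  let: ((m, n, l), (a, b, c, d)) := i in
  x gE ^+ m * x gF ^+ n * x gG ^+ l
  * x gs ^+ a * x gt ^+ b * x gu ^+ c * x gv ^+ d.

End InvariantAlgebra.

(* Main.v *)
(* The q-trace of each matrix is central for its own block; taking it instead of
   X^1_1 as a generator turns the defining relations into a terminating confluent
   rewriting system on twelve letters (confluence, and the equivalence with the
   given relations, are finite computations), so that the irreducible words form
   a basis of the sphere algebra, in which the relations between E, F, G, s, t, u, v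
   are checked by computing normal forms. By these relations the monomials of the
   theorem span the free algebra modulo the relations. They are linearly
   independent because they have distinct leading words.

   It remains to see that they span the invariants. Give the central letters
   degree 0 and the others degree 1. Modulo lower degree, the words of degrees
   (n1, n2, n3) in the three blocks with given exponents of the central letters
   span a tensor product of simple modules V_{2 n1} (x) V_{2 n2} (x) V_{2 n3} of
   U_q(sl_2). As q is not a root of unity, an invariant there is determined by a
   single coordinate and vanishes unless the n_i satisfy the triangle
   inequalities, in which case exactly one of the monomials has this leading
   coordinate and can be subtracted. *)

Require Import Defs.
From HB Require Import structures.
From mathcomp Require Import all_boot all_order all_algebra.
From mathcomp Require Import finmap monalg boolp reals complex.
From mathcomp Require Import ring zify.
Set Implicit Arguments.
Unset Strict Implicit.
Unset Printing Implicit Defensive.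
Import Order.TTheory GRing.Theory Num.Theory.
Local Open Scope ring_scope.

(** * Rewriting of noncommutative polynomials *)

(** All coefficients lie in Z[q, q^-1], so each finite computation is run once on integer terms and
    then evaluated at an arbitrary nonzero q; genericity of q enters through the action of the
    quantum group.

    The algebra is given only by its presentation, in which the independence of the irreducible
    words is not visible. It is obtained by letting the free algebra act on the vector space of
    normal forms and checking that the relations act by zero.

    The degree alone does not provide leading words: the top part of E is already a combination of
    three words, and that of a monomial is an invariant tensor with many coordinates. A second
    weight, [Dweight], singles out in this top part the coordinate that is highest in the first
    factor and lowest in the third. By weight its middle entry is then forced, and this is also the
    coordinate that determines an invariant. Thus one and the same coordinate serves for
    independence and for spanning. *)

Notation word := (seq nat).
(* The term (w, k, c) stands for c q^k w. *)
Notation term := (seq nat * int * int)%type.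
Notation ncpoly := (seq (seq nat * int * int)).

Definition pone : ncpoly := [:: ([::], 0, 1)].
Definition pvar (l : nat) : ncpoly := [:: ([:: l], 0, 1)].
Definition pscale (k c : int) (p : ncpoly) : ncpoly :=
  [seq (t.1.1, k + t.1.2, c * t.2) | t <- p].
Definition pmul (p p' : ncpoly) : ncpoly :=
  [seq (t.1.1 ++ t'.1.1, t.1.2 + t'.1.2, t.2 * t'.2) | t <- p, t' <- p'].
Definition psub (p p' : ncpoly) : ncpoly := p ++ pscale 0 (-1) p'.
Definition psubst (s : nat -> ncpoly) (w : word) : ncpoly :=
  foldr (fun l => pmul (s l)) pone w.
Definition pbind (f : word -> ncpoly) (p : ncpoly) : ncpoly :=
  flatten [seq pscale t.1.2 t.2 (f t.1.1) | t <- p].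

Fixpoint wle (w w' : word) : bool :=
  match w, w' with
  | [::], _ => true
  | _, [::] => false
  | x :: v, y :: v' => (x < y)%N || (x == y) && wle v v'
  end.
Definition tle (t t' : term) : bool :=
  if t.1.1 == t'.1.1 then t.1.2 <= t'.1.2 else wle t.1.1 t'.1.1.
Fixpoint collapse (t : term) (p : ncpoly) : ncpoly :=
  if p is t' :: p' then
    if t.1 == t'.1 then collapse (t.1, t.2 + t'.2) p'
    else if t.2 == 0 then collapse t' p' else t :: collapse t' p'
  else if t.2 == 0 then [::] else [:: t].
Definition pnorm (p : ncpoly) : ncpoly :=
  if sort tle p is t :: p' then collapse t p' else [::].

Section Reduction.
Variable rule : nat -> nat -> option ncpoly.

Fixpoint redex (w : word) : option (word * ncpoly * word) :=
  if w is x :: w' then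
    if w' is y :: v then
      if rule x y is Some r then Some ([::], r, v)
      else if redex w' is Some (u, r, v') then Some (x :: u, r, v') else None
    else None
  else None.

Definition irreducible (w : word) : bool := ~~ isSome (redex w).

Fixpoint nf (n : nat) (w : word) : ncpoly :=
  if n is n'.+1 then
    if redex w is Some (u, r, v) then pbind (fun x => nf n' (u ++ x ++ v)) r
    else [:: (w, 0, 1)]
  else [:: (w, 0, 1)].

Definition pnf (n : nat) (p : ncpoly) : ncpoly := pnorm (pbind (nf n) p).

Variant redex_spec w : option (word * ncpoly * word) -> Prop :=
  | RedexSome u x y r v of w = u ++ [:: x, y & v] & rule x y = Some r
      & irreducible (rcons u x) : redex_spec w (Some (u, r, v))
  | RedexNone of irreducible w : redex_spec w None.

Lemma redex_cons2 x y v :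
  redex [:: x, y & v] =
  if rule x y is Some r then Some ([::], r, v)
  else if redex (y :: v) is Some (u, r, v') then Some (x :: u, r, v') else None.
Proof. by []. Qed.

Lemma irreducible_cons2 x y v :
  irreducible [:: x, y & v] = ~~ isSome (rule x y) && irreducible (y :: v).
Proof.
rewrite /irreducible redex_cons2; case: (rule x y) => [//|].
by case: (redex (y :: v)) => [[[]]|].
Qed.

Lemma redexP w : redex_spec w (redex w).
Proof.
elim: w => [|x [|y v] IH]; try by constructor.
rewrite redex_cons2; case Er: (rule x y) => [r|].
  by apply: (@RedexSome _ [::] x y).
case: IH => [u x' y' r v' Ew Er' Iu|I].
  rewrite Ew; apply: (@RedexSome _ (x :: u) x' y') => //.
  case: u Ew Iu => [[<- _]|z u [<- _]] Iu; rewrite rcons_cons irreducible_cons2 Er //.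
by constructor; rewrite irreducible_cons2 Er.
Qed.

Lemma redex_cat u x y v r : rule x y = Some r -> irreducible (rcons u x) ->
  redex (u ++ [:: x, y & v]) = Some (u, r, v).
Proof.
move=> Er; elim: u => [|z [|z' u] IH]; first by rewrite /= Er.
  by rewrite /= Er; case: (rule z x) (irreducible_cons2 z x [::]) => //= ? ->.
rewrite !rcons_cons irreducible_cons2 -rcons_cons => /andP[Nz /IH E].
by rewrite !cat_cons redex_cons2 -cat_cons E; case: (rule z z') Nz.
Qed.

End Reduction.

(** * Evaluation of polynomials in modules and algebras *)

Section Evaluation.
Variables (C : fieldType) (q : C).
Hypothesis q_neq0 : q != 0.

Definition peval (W : lmodType C) (phi : word -> W) (p : ncpoly) : W :=
  \sum_(t <- p) (t.2%:~R * q ^ t.1.2) *: phi t.1.1.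

Section Lmod.
Variables (W : lmodType C).
Implicit Types (phi psi : word -> W) (p : ncpoly).

Lemma peval_nil phi : peval phi [::] = 0.
Proof. exact: big_nil. Qed.

Lemma peval_cons phi t p :
  peval phi (t :: p) = (t.2%:~R * q ^ t.1.2) *: phi t.1.1 + peval phi p.
Proof. exact: big_cons. Qed.

Lemma peval_cat phi p p' : peval phi (p ++ p') = peval phi p + peval phi p'.
Proof. exact: big_cat. Qed.

Lemma peval1 phi w : peval phi [:: (w, 0, 1)] = phi w.
Proof. by rewrite peval_cons peval_nil addr0 mul1r expr0z scale1r. Qed.

Lemma peval_flatten phi (s : seq ncpoly) :
  peval phi (flatten s) = \sum_(p <- s) peval phi p.
Proof.
by elim: s => [|p s IH] /=; rewrite ?big_nil ?big_cons ?peval_cat ?IH // peval_nil.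
Qed.

Lemma peval_scale phi k c p :
  peval phi (pscale k c p) = (c%:~R * q ^ k) *: peval phi p.
Proof.
rewrite /peval big_map scaler_sumr; apply: eq_bigr => t _ /=.
by rewrite scalerA expfzDr // intrM mulrACA.
Qed.

Lemma peval_sub phi p p' : peval phi (psub p p') = peval phi p - peval phi p'.
Proof.
by rewrite peval_cat peval_scale expr0z mulr1 rmorphN1 scaleN1r.
Qed.

Lemma peval_bind phi f p :
  peval phi (pbind f p) = peval (fun w => peval phi (f w)) p.
Proof.
by rewrite peval_flatten big_map; apply: eq_bigr => t _; rewrite peval_scale.
Qed.

Lemma eq_peval phi psi p : {in p, forall t, phi t.1.1 = psi t.1.1} ->
  peval phi p = peval psi p.
Proof. by move=> E; apply: eq_big_seq => t /E ->. Qed.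

(** This lets two reductions at disjoint places of a word be carried out in either order. *)
Lemma peval_exchange (phi : word -> word -> W) p p' :
  peval (fun w => peval (phi w) p') p =
  peval (fun w' => peval (phi^~ w') p) p'.
Proof.
rewrite /peval.
under eq_bigr do rewrite scaler_sumr.
rewrite exchange_big; apply: eq_bigr => t' _; rewrite scaler_sumr.
by apply: eq_bigr => t _; rewrite !scalerA mulrC.
Qed.

Lemma peval_perm phi p p' : perm_eq p p' -> peval phi p = peval phi p'.
Proof. exact: perm_big. Qed.

Lemma peval_collapse phi t p : peval phi (collapse t p) = peval phi (t :: p).
Proof.
elim: p t => [|t' p IH] t /=.
  by case: eqP => // E; rewrite peval_cons E mul0r scale0r add0r.
case: eqP => [E|_].
  by rewrite IH !peval_cons /= E addrA -scalerDl -mulrDl rmorphD.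
case: eqP => [E|_]; rewrite ?peval_cons ?IH ?peval_cons //.
by rewrite E mul0r scale0r add0r.
Qed.

Lemma peval_norm phi p : peval phi (pnorm p) = peval phi p.
Proof.
have <- : peval phi (sort tle p) = peval phi p.
  by apply: peval_perm; rewrite perm_sort.
rewrite /pnorm.
by case: (sort tle p) => // t p'; rewrite peval_collapse.
Qed.

Lemma peval_mul phi p p' :
  peval phi (pmul p p') = peval (fun w => peval (fun w' => phi (w ++ w')) p') p.
Proof.
rewrite /pmul peval_flatten big_map; apply: eq_bigr => t _.
rewrite /peval big_map scaler_sumr; apply: eq_bigr => t' _ /=.
by rewrite scalerA expfzDr // intrM mulrACA.
Qed.

(** The bridge from computation to algebra: one evaluation with integers proves the identity in
    every module and for every nonzero q. *)
Lemma peval_eq phi p p' : pnorm (psub p p') = [::] -> peval phi p = peval phi p'.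
Proof.
move=> E; apply/eqP; rewrite -subr_eq0 -peval_sub -peval_norm E.
by rewrite peval_nil.
Qed.

End Lmod.

Lemma peval_linear (W W' : lmodType C) (f : {linear W -> W'}) phi p :
  f (peval phi p) = peval (fun w => f (phi w)) p.
Proof. by rewrite linear_sum; apply: eq_bigr => t _; rewrite linearZ. Qed.

(* [P] bounds the words on which [phi] is known to be compatible with the
   rules: everywhere for an algebra, below the current word in the proof of
   confluence. *)
Lemma peval_nf (W : lmodType C) rule (P : word -> Prop) (phi : word -> W) n w :
  (forall u x y v r, rule x y = Some r -> P (u ++ [:: x, y & v]) ->
     phi (u ++ [:: x, y & v]) = peval (fun z => phi (u ++ z ++ v)) r /\
     {in r, forall t, P (u ++ t.1.1 ++ v)}) ->
  P w -> peval phi (nf rule n w) = phi w.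
Proof.
move=> H; elim: n w => [|n IH] w Pw /=; first by rewrite peval1.
case: redexP Pw => [u x y r v -> Er _ Pw|_ _]; last by rewrite peval1.
have [-> Pr] := H _ _ _ _ _ Er Pw.
rewrite peval_bind; apply: eq_peval => t /Pr; exact: IH.
Qed.

Lemma peval_pnf (W : lmodType C) rule (P : word -> Prop) (phi : word -> W) n p :
  (forall u x y v r, rule x y = Some r -> P (u ++ [:: x, y & v]) ->
     phi (u ++ [:: x, y & v]) = peval (fun z => phi (u ++ z ++ v)) r /\
     {in r, forall t, P (u ++ t.1.1 ++ v)}) ->
  {in p, forall t, P t.1.1} -> peval phi (pnf rule n p) = peval phi p.
Proof.
move=> H Pp; rewrite peval_norm peval_bind; apply: eq_peval => t /Pp.
exact: peval_nf.
Qed.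

Definition wprod (A : lalgType C) (g : nat -> A) (w : word) : A := \prod_(l <- w) g l.

Section Algebra.
Variable A : algType C.
Implicit Types g : nat -> A.

Lemma wprod_nil g : wprod g [::] = 1. Proof. exact: big_nil. Qed.
Lemma wprod_cons g x w : wprod g (x :: w) = g x * wprod g w.
Proof. exact: big_cons. Qed.
Lemma wprod_cat g w w' : wprod g (w ++ w') = wprod g w * wprod g w'.
Proof. exact: big_cat. Qed.
Lemma wprod1 g x : wprod g [:: x] = g x.
Proof. exact: big_seq1. Qed.

Lemma peval_wprod_mul g p p' :
  peval (wprod g) (pmul p p') = peval (wprod g) p * peval (wprod g) p'.
Proof.
rewrite peval_mul /peval mulr_suml; apply: eq_bigr => t _.
rewrite -scalerAl mulr_sumr; congr (_ *: _); apply: eq_bigr => t' _.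
by rewrite wprod_cat scalerAr.
Qed.

Lemma peval_subst g s w :
  peval (wprod g) (psubst s w) = wprod (fun l => peval (wprod g) (s l)) w.
Proof.
elim: w => [|x w IH] /=; first by rewrite peval1 !wprod_nil.
by rewrite peval_wprod_mul IH wprod_cons.
Qed.

Definition satisfies g (rule : nat -> nat -> option ncpoly) : Prop :=
  forall x y r, rule x y = Some r -> g x * g y = peval (wprod g) r.

Lemma satisfies_wprod g rule u x y v r : satisfies g rule ->
  rule x y = Some r ->
  wprod g (u ++ [:: x, y & v]) = peval (fun z => wprod g (u ++ z ++ v)) r.
Proof.
move=> sat /sat E; rewrite wprod_cat !wprod_cons !mulrA -[_ * g x * g y]mulrA E.
rewrite /peval mulr_sumr mulr_suml; apply: eq_bigr => t _.
by rewrite !wprod_cat mulrA -scalerAr -scalerAl.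
Qed.

Lemma wprod_nf g rule n w : satisfies g rule ->
  peval (wprod g) (nf rule n w) = wprod g w.
Proof.
move=> sat; apply: (@peval_nf _ rule (fun=> True)) => // u x y v r Er _.
by split=> //; apply: satisfies_wprod Er.
Qed.

Lemma wprod_pnf g rule n p : satisfies g rule ->
  peval (wprod g) (pnf rule n p) = peval (wprod g) p.
Proof.
by move=> sat; rewrite peval_norm peval_bind; apply: eq_peval => t _; rewrite wprod_nf.
Qed.

End Algebra.

End Evaluation.

(* The words over [0..11] read as numerals in base 13 with non-zero digits;
   this orders them by length, then lexicographically. *)
Definition wval (w : word) : nat := foldl (fun n l => (n * 13 + l.+1)%N) 0%N w.

Lemma wval_cat u w : wval (u ++ w) = (wval u * 13 ^ size w + wval w)%N.
Proof.
rewrite /wval foldl_cat; move: (foldl _ _ u) => n.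
elim/last_ind: w => [|w x IH]; first by rewrite muln1 addn0.
by rewrite !foldl_rcons IH size_rcons expnS mulnDl -addnA mulnA mulnAC -[(n * 13 * _)%N]mulnA mulnA.
Qed.

Lemma ltn_wval_ctx u v w w' : (size w <= size w')%N -> (wval w < wval w')%N ->
  (wval (u ++ w ++ v) < wval (u ++ w' ++ v))%N.
Proof.
move=> le_s lt_w.
have lt_wv : (wval (w ++ v) < wval (w' ++ v))%N.
  by rewrite !wval_cat ltn_add2r ltn_pmul2r ?expn_gt0.
rewrite !(wval_cat u) -addnS leq_add // leq_mul // leq_pexp2l //.
by rewrite !size_cat leq_add2r.
Qed.

Lemma mem_pbind t f p : t \in pbind f p ->
  exists2 t1, t1 \in p & exists2 t2, t2 \in f t1.1.1 & t.1.1 = t2.1.1.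
Proof.
case/flattenP=> s /mapP[t1 t1p ->] /mapP[t2 t2f ->].
by exists t1 => //; exists t2.
Qed.

Lemma nf_closed rule (Q : word -> Prop) n w :
  (forall u x y v r, rule x y = Some r -> Q (u ++ [:: x, y & v]) ->
     {in r, forall t, Q (u ++ t.1.1 ++ v)}) ->
  Q w -> {in nf rule n w, forall t, Q t.1.1}.
Proof.
move=> H; elim: n w => [|n IH] w Qw t /=; first by rewrite inE => /eqP->.
case: redexP Qw => [u x y r v -> Er _ Qw|_ Qw]; last by rewrite inE => /eqP->.
by case/mem_pbind=> t1 t1r [t2 t2n ->]; apply: IH t2n; apply: H Er Qw _ t1r.
Qed.

(** * Normal forms and confluence *)

Section Confluence.
Variable rule : nat -> nat -> option ncpoly.

(** The bound on the length lets the decrease pass to larger words: a numeral that is smaller and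
    not longer stays smaller inside any context. *)
Definition decreasing : Prop := forall x y r, rule x y = Some r ->
  {in r, forall t, (size t.1.1 <= 2)%N /\ (wval t.1.1 < wval [:: x; y])%N}.

(** Here [n] is mere fuel: [nf] preserves values however far it gets, so equal results after [n]
    steps resolve the overlap. *)
Definition confluent (n : nat) : Prop := forall x y z r s,
  rule x y = Some r -> rule y z = Some s ->
  pnorm (psub (pbind (fun w => nf rule n (rcons w z)) r)
              (pbind (fun w => nf rule n (x :: w)) s)) = [::].

Hypothesis rule_decr : decreasing.

Lemma wval_rule u x y v r : rule x y = Some r ->
  {in r, forall t, (wval (u ++ t.1.1 ++ v) < wval (u ++ [:: x, y & v]))%N}.
Proof.
move=> Er t /(rule_decr Er)[s2 lt].
exact: (@ltn_wval_ctx u v _ [:: x; y]).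
Qed.

(** Each step lowers [wval], which therefore bounds the number of steps; any fuel above it completes
    the reduction. *)
Lemma nf_fuel n m w : (wval w < n)%N -> (wval w < m)%N -> nf rule n w = nf rule m w.
Proof.
elim: n m w => [|n IH] [|m] w //= ltn ltm.
case: redexP ltn ltm => // u x y r v -> Er _ ltn ltm.
rewrite /pbind; congr flatten; apply/eq_in_map => t /(wval_rule u v Er) lt.
by congr pscale; apply: IH; apply: (leq_trans lt).
Qed.

Lemma nf_irreducible n w : (wval w < n)%N ->
  {in nf rule n w, forall t, irreducible rule t.1.1}.
Proof.
elim: n w => [|n IH] w //= ltn t.
case: redexP ltn => [u x y r v -> Er _ ltn|I _]; last by rewrite inE => /eqP->.
case/mem_pbind=> t1 /(wval_rule u v Er) lt [t2 t2n ->].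
by apply: IH t2n; apply: (leq_trans lt).
Qed.

Variables (C : fieldType) (q : C).
Hypothesis q_neq0 : q != 0.

(** This fuel is always sufficient but enormous, so it serves for reasoning only; the computations
    run [nf] with fuel 10 or 20. *)
Definition normal_form (w : word) : {malg C[word]} :=
  peval q (fun z => << z >>) (nf rule (wval w).+1 w).
Local Notation NF := normal_form.

Lemma normal_form_irreducible w : irreducible rule w -> NF w = << w >>.
Proof.
by move=> I; rewrite /NF /=; move: I; rewrite /irreducible; case: (redex _ _) => //; rewrite peval1.
Qed.

Lemma normal_form_redex w u r v : redex rule w = Some (u, r, v) ->
  NF w = peval q (fun z => NF (u ++ z ++ v)) r.
Proof.
move=> E; rewrite {1}/normal_form [nf _ _ _]/= E peval_bind //.
case: redexP E => // u' x y r' v' Ew Er _ [<- <- <-].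
apply: eq_peval => t /(wval_rule u' v' Er) lt; rewrite -Ew in lt.
rewrite /normal_form; congr peval; apply: nf_fuel => //; exact: leqnn.
Qed.

(* Bergman's diamond lemma: [confluent] resolves the overlaps x y z, and the
   other pairs of redexes are disjoint. *)
Lemma normal_form_rule n u x y v r : confluent n -> rule x y = Some r ->
  NF (u ++ [:: x, y & v]) = peval q (fun z => NF (u ++ z ++ v)) r.
Proof.
move=> conf Er.
have [k] := ubnP (wval (u ++ [:: x, y & v])).
elim: k => // k IH in u x y v r Er *; rewrite ltnS => lek.
(* If [rcons u x] is irreducible, the given redex is the one that [redex] finds. Otherwise the
   leftmost redex lies in [rcons u x]; it overlaps the given one when it ends in this x, and is
   disjoint from it when it does not. *)
case: (redexP rule (rcons u x)) => [u' x' y' r' v' Eu Er' Iu'|Iu]; last first.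
  exact/normal_form_redex/redex_cat.
elim/last_ind: v' Eu => [|v' z _] Eu.
- have {Eu} [Eu Ey'] : (u, x) = (rcons u' x', y').
    by apply: rcons_inj; rewrite Eu -!cats1 -catA.
  subst u y'.
  rewrite cat_rcons in lek *.
  rewrite (normal_form_redex (redex_cat _ Er' Iu')).
  pose phi z := NF (u' ++ z ++ v).
  (* Below the overlap the induction hypothesis makes [phi] compatible with the rules, so that
     [peval_nf] applies to both sides of the confluence check. *)
  pose P z := (wval (u' ++ z ++ v) < wval (u' ++ [:: x', x, y & v]))%N.
  have phiP a x1 y1 b r1 : rule x1 y1 = Some r1 -> P (a ++ [:: x1, y1 & b]) ->
     phi (a ++ [:: x1, y1 & b]) = peval q (fun z => phi (a ++ z ++ b)) r1 /\
     {in r1, forall t, P (a ++ t.1.1 ++ b)}.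
    rewrite /P /phi => Er1 Pab; split=> [|t tr].
      have := IH (u' ++ a) x1 y1 (b ++ v) r1 Er1.
      rewrite -!catA /= in Pab * => -> //; last exact: leq_trans Pab lek.
      by apply: eq_peval => t _; rewrite -!catA.
    have := wval_rule (u' ++ a) (b ++ v) Er1 tr.
    by rewrite -!catA /= in Pab * => lt; apply: ltn_trans lt Pab.
  transitivity (peval q (fun w => phi (rcons w y)) r').
    by apply: eq_peval => t _; rewrite /phi cat_rcons.
  transitivity (peval q (fun w => phi (x' :: w)) r); last first.
    by apply: eq_peval => t _; rewrite /phi cat_rcons.
  have PL : {in r', forall t, P (rcons t.1.1 y)}.
    by move=> t /(wval_rule u' (y :: v) Er'); rewrite /P cat_rcons.
  have PR : {in r, forall t, P (x' :: t.1.1)}.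
    by move=> t /(wval_rule (rcons u' x') v Er); rewrite /P !cat_rcons.
  clearbody phi P.
  transitivity (peval q phi (pbind (fun w => nf rule n (rcons w y)) r')).
    rewrite peval_bind //; apply: eq_peval => t /PL Pt.
    by rewrite (peval_nf (P := P) q_neq0 _ phiP Pt).
  rewrite (peval_eq q_neq0 _ (conf _ _ _ _ _ Er' Er)) peval_bind //.
  by apply: eq_peval => t /PR Pt; rewrite (peval_nf (P := P) q_neq0 _ phiP Pt).
- have {z Eu} [Eu _] : (u, x) = (u' ++ [:: x', y' & v'], z).
    by apply: rcons_inj; rewrite Eu -!cats1 -catA.
  subst u; rewrite -!catA /= in lek *.
  rewrite (normal_form_redex (redex_cat _ Er' Iu')).
  (* Disjoint redexes: reducing both, in either order, gives the same double sum. *)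
  transitivity (peval q (fun z' => peval q (fun z => NF (u' ++ z' ++ v' ++ z ++ v)) r) r').
    apply: eq_peval => t tr.
    have := IH (u' ++ t.1.1 ++ v') x y v r Er; rewrite -!catA => -> //.
      by apply: eq_peval => t' _; rewrite -!catA.
    exact: leq_trans (wval_rule u' (v' ++ [:: x, y & v]) Er' tr) lek.
  rewrite peval_exchange; apply: eq_peval => t tr.
  rewrite -!catA /= (IH u' x' y' (v' ++ t.1.1 ++ v) r' Er') //.
  have := wval_rule (u' ++ [:: x', y' & v']) v Er tr; rewrite -!catA /= => lt.
  exact: leq_trans lt lek.
Qed.

End Confluence.

(** * The rewriting system of the sphere algebra *)

(* Letter [4 * b + k] belongs to the matrix X of block [b]; for k = 0, 1, 2, 3
   it stands for the central element tr_q X and for X^2_2, X^1_2, X^2_1. *)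
Definition pterm (w : word) (k c : int) : term := (w, k, c).
Definition xterm (i j : nat) (k c : int) : nat * nat * int * int := (i, j, k, c).
Arguments pterm w (k c)%_Z.
Arguments xterm (i j)%_N (k c)%_Z.

(** Call the four letters s, d, p, m. With X^1_1 = s - q^-2 d, the relation X^1_1 X^2_2 = 1 + q^2
    X^1_2 X^2_1 becomes the rule for p m. Since m p is reducible as well, no normal word contains
    both p and m of the same block. *)
Definition block_rule (b ky kx : nat) : option ncpoly :=
  match ky, kx with
  | 1, 0 => Some [:: pterm [:: b; b.+1] 0 1]
  | 2, 0 => Some [:: pterm [:: b; b.+2] 0 1]
  | 2, 1 => Some [:: pterm [:: b.+1; b.+2] (-2) 1]
  | 2, 3 => Some [:: pterm [:: b; b.+1] (-2) 1; pterm [:: b.+1; b.+1] (-4) (-1);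
      pterm [::] (-2) (-1)]
  | 3, 0 => Some [:: pterm [:: b; b.+3] 0 1]
  | 3, 1 => Some [:: pterm [:: b.+1; b.+3] 2 1]
  | 3, 2 => Some [:: pterm [:: b; b.+1] 0 1; pterm [:: b.+1; b.+1] 0 (-1);
      pterm [::] (-2) (-1)]
  | _, _ => None
  end%N.

(* The crossing relations: the entry [(i, j, k, c)] stands for c q^k x y with x the
   letter i of the lower block and y the letter j of the higher block. *)
Definition cross_table (ky kx : nat) : seq (nat * nat * int * int) :=
  match ky, kx with
  | 1, 1 => [:: xterm 1 1 0 1; xterm 3 2 0 1; xterm 3 2 2 (-1)]
  | 1, 2 => [:: xterm 0 2 0 1; xterm 0 2 2 (-1); xterm 1 2 (-2) (-1); xterm 1 2 2 1;
      xterm 2 1 0 1]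
  | 2, 2 => [:: xterm 2 2 2 1]
  | 2, 3 => [:: xterm 3 2 (-2) 1]
  | 3, 1 => [:: xterm 1 3 0 1; xterm 3 0 0 1; xterm 3 0 2 (-1); xterm 3 1 (-2) (-1);
      xterm 3 1 2 1]
  | 3, 2 => [:: xterm 0 0 (-2) 1; xterm 0 0 0 (-1); xterm 0 1 (-4) (-1); xterm 0 1 0 1;
      xterm 1 0 (-4) (-1); xterm 1 0 0 1; xterm 1 1 (-6) 1; xterm 1 1 (-4) 1;
      xterm 1 1 (-2) (-1); xterm 1 1 0 (-1); xterm 2 3 (-2) 1; xterm 3 2 (-4) 1;
      xterm 3 2 (-2) (-1); xterm 3 2 0 (-1); xterm 3 2 2 1]
  | 3, 3 => [:: xterm 3 3 2 1]
  | _, _ => [:: xterm kx ky 0 1]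
  end%N.

Definition pbw_rule (y x : nat) : option ncpoly :=
  if (x < 12)%N && (y < 12)%N then
    let: (bx, kx) := edivn x 4 in let: (b_y, ky) := edivn y 4 in
    if bx == b_y then block_rule (4 * bx) ky kx
    else if (bx < b_y)%N then
      Some [seq ([:: (4 * bx + t.1.1.1)%N; (4 * b_y + t.1.1.2)%N], t.1.2, t.2)
           | t <- cross_table ky kx]
    else None
  else None.

Definition letters : seq nat := iota 0 12.

Lemma mem_letters x : (x \in letters) = (x < 12)%N.
Proof. by rewrite mem_iota. Qed.

Lemma pbw_rule_letters x y r : pbw_rule x y = Some r ->
  (x \in letters) && (y \in letters).
Proof. by rewrite /pbw_rule !mem_letters andbC; case: ifP. Qed.

Definition over_rules (P : nat -> nat -> ncpoly -> bool) : bool :=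
  all (fun x => all (fun y => if pbw_rule x y is Some r then P x y r else true)
                    letters) letters.

Lemma over_rulesP P x y r : over_rules P -> pbw_rule x y = Some r -> P x y r.
Proof.
move=> H E; have /andP[xl yl] := pbw_rule_letters E.
by have := allP (allP H _ xl) _ yl; rewrite E.
Qed.

Lemma pbw_decreasing : decreasing pbw_rule.
Proof.
pose P x y (r : ncpoly) := all (fun t : term =>
  (size t.1.1 <= 2)%N && (wval t.1.1 < wval [:: x; y])%N) r.
have H : over_rules P by vm_compute.
by move=> x y r /(over_rulesP H)/allP Hr t /Hr/andP[].
Qed.

(** A check of all overlaps of the twelve letters; the two reductions agree as polynomials in q and
    q^-1 with integer coefficients. *)
Lemma pbw_confluent : confluent pbw_rule 20.
Proof.
pose P x y (r : ncpoly) := all (fun z =>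
  if pbw_rule y z is Some s then
    nilp (pnorm (psub (pbind (fun w => nf pbw_rule 20 (rcons w z)) r)
                (pbind (fun w => nf pbw_rule 20 (x :: w)) s)))
  else true) letters.
have H : over_rules P by vm_compute.
move=> x y z r s Er Es; have /andP[_ zl] := pbw_rule_letters Es.
by have := allP (over_rulesP H Er) _ zl; rewrite Es => /nilP.
Qed.

(* The original generators X^1_1, X^2_2, X^1_2, X^2_1 of block [b] have the
   codes [4 * b + k] for k = 0, 1, 2, 3; [entry b i j] is the code of x^i_j,
   with indices starting at 0. *)
Definition entry (b i j : nat) : nat :=
  (4 * b + if i == 0 then (if j == 0 then 0 else 2) else (if j == 0 then 3 else 1))%N.
Definition gen_code (v : sphere_gen) : nat := entry v.1.1 v.1.2 v.2.
Definition gen_decode (l : nat) : sphere_gen :=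
  let: (b, k) := edivn l 4 in
  (inord b, inord ((k == 1) || (k == 3)), inord ((k == 1) || (k == 2))).

Lemma gen_codeK : cancel gen_code gen_decode.
Proof.
case=> [[[s ls] [i li]] [j lj]].
have E : gen_decode (entry s i j) = (inord s, inord i, inord j).
  by case: s ls => [|[|[|]]] //; case: i li => [|[|]] //; case: j lj => [|[|]].
rewrite /gen_code E; by congr (_, _, _); apply: val_inj; rewrite /= inordK.
Qed.

(** The reflection equation relations read from left to right, on the original generators. They
    serve to rewrite soundly in an algebra that satisfies them; normal forms are taken with
    [pbw_rule]. *)
Definition sphere_block_rule (b ky kx : nat) : option ncpoly :=
  match ky, kx with
  | 2, 0 => Some [:: pterm [:: b; b.+2] 0 1; pterm [:: b.+2; b.+1] 0 1;
                     pterm [:: b.+2; b.+1] (-2) (-1)]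
  | 3, 0 => Some [:: pterm [:: b; b.+3] 0 1; pterm [:: b.+3; b.+1] (-2) (-1);
                     pterm [:: b.+3; b.+1] (-4) 1]
  | 3, 2 => Some [:: pterm [:: b.+2; b.+3] 0 1; pterm [:: b; b.+1] 0 1;
                     pterm [:: b.+1; b.+1] 0 (-1); pterm [:: b; b.+1] (-2) (-1);
                     pterm [:: b.+1; b.+1] (-2) 1]
  | 1, 0 => Some [:: pterm [:: b; b.+1] 0 1]
  | 1, 2 => Some [:: pterm [:: b.+2; b.+1] 2 1]
  | 1, 3 => Some [:: pterm [:: b.+3; b.+1] (-2) 1]
  | 0, 1 => Some [:: pterm [::] 0 1; pterm [:: b.+2; b.+3] 2 1]
  | _, _ => None
  end%N.

(* The entries of the three R-matrices without their factor q^(1/2) or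
   q^(-1/2), as lists of pairs (exponent, coefficient). *)
Definition laurent_entry (d : int) (o : seq (int * int)) (i j k l : nat) :
    seq (int * int) :=
  if (i == k) && (j == l) then [:: (if i == j then d else 0, 1)]
  else if [&& i == 1, j == 0, k == 0 & l == 1]%N then o else [::].
Definition laurent_mul (p p' : seq (int * int)) : seq (int * int) :=
  [seq (t.1 + t'.1, t.2 * t'.2) | t <- p, t' <- p'].
Definition laurent_R := laurent_entry 1 [:: (1, 1); (-1, -1)].
Definition laurent_Rinv := laurent_entry (-1) [:: (1, -1); (-1, 1)].
Definition laurent_Rtilde := laurent_entry (-1) [:: (-3, 1); (-1, -1)].

Definition sum2 (T : Type) (f : nat -> seq T) : seq T := f 0%N ++ f 1%N.

Definition sphere_cross_rule (x y e f g h : nat) : ncpoly :=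
  sum2 (fun i => sum2 (fun j => sum2 (fun k => sum2 (fun l =>
  sum2 (fun m => sum2 (fun n => sum2 (fun o => sum2 (fun p =>
    [seq ([:: entry x l o; entry y p m], t.1, t.2)
    | t <- laurent_mul (laurent_mul (laurent_mul (laurent_Rtilde i g f j)
             (laurent_R e j k l)) (laurent_R m n i h)) (laurent_Rinv k o p n)])))))))).

Definition row_of (k : nat) : nat := ((k == 1) || (k == 3))%N.
Definition col_of (k : nat) : nat := ((k == 1) || (k == 2))%N.

Definition sphere_rule (y x : nat) : option ncpoly :=
  if (x < 12)%N && (y < 12)%N then
    let: (bx, kx) := edivn x 4 in let: (b_y, ky) := edivn y 4 in
    if bx == b_y then sphere_block_rule (4 * bx) ky kx
    else if (bx < b_y)%N then
      Some (sphere_cross_rule bx b_y (row_of ky) (col_of ky) (row_of kx) (col_of kx))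
    else None
  else None.

Lemma ltn_letter b k : (b < 3)%N -> (k < 4)%N -> (4 * b + k < 12)%N.
Proof. lia. Qed.

Lemma letter_block b k : (b * 4 + k < 12)%N -> (b < 3)%N.
Proof. lia. Qed.

Section SphereRules.
Variables (C : numClosedFieldType) (q : C).
Hypothesis q_neq0 : q != 0.

Definition laurent_eval (p : seq (int * int)) : C :=
  \sum_(t <- p) t.2%:~R * q ^ t.1.

Lemma laurent_eval_mul p p' :
  laurent_eval (laurent_mul p p') = laurent_eval p * laurent_eval p'.
Proof.
rewrite /laurent_eval /laurent_mul big_allpairs_dep mulr_suml; apply: eq_bigr => t _.
rewrite mulr_sumr; apply: eq_bigr => t' _ /=.
by rewrite expfzDr // intrM mulrACA.
Qed.

Lemma laurent_eval_entry d o (i j k l : 'I_2) :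
  laurent_eval (laurent_entry d o i j k l) =
  if (i == k) && (j == l) then if i == j then q ^ d else 1
  else if [&& i == 1, j == 0, k == 0 & l == 1] then laurent_eval o else 0.
Proof.
rewrite /laurent_entry -!val_eqE /=.
case: ifP => _; first by rewrite /laurent_eval big_seq1 mul1r; case: ifP.
by case: ifP => // _; rewrite /laurent_eval big_nil.
Qed.

Lemma RmatE i j k l : Rmat q i j k l = sqrtC q * laurent_eval (laurent_R i j k l).
Proof.
rewrite laurent_eval_entry /Rmat /laurent_eval !big_cons big_nil /= expr1z.
by rewrite mul1r addr0 mulN1r.
Qed.

Lemma RinvE i j k l :
  Rinv q i j k l = (sqrtC q)^-1 * laurent_eval (laurent_Rinv i j k l).
Proof.
rewrite laurent_eval_entry /Rinv /laurent_eval !big_cons big_nil /= expr1z.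
by rewrite mul1r addr0 mulN1r opprB addrC.
Qed.

Lemma RtildeE i j k l :
  Rtilde q i j k l = (sqrtC q)^-1 * laurent_eval (laurent_Rtilde i j k l).
Proof.
rewrite laurent_eval_entry /Rtilde /laurent_eval !big_cons big_nil /=.
rewrite mul1r addr0 mulN1r mulrBr.
have -> : q ^- 2 * q^-1 = q ^ (-3) by rewrite -invfM -exprSr.
have -> : q ^- 2 * q = q ^ (-1) by rewrite -[q ^ (-1)]/(q^-1); field.
by [].
Qed.

Section Relations.
Variables (B : lalgType C) (x : sphere_gen -> B).

Definition on_codes (l : nat) : B := x (gen_decode l).
Local Notation ev := (wprod on_codes).

Lemma wprod_codes1 (s : 'I_3) (i j : 'I_2) : on_codes (entry s i j) = x (s, i, j).
Proof. by rewrite /on_codes -[entry s i j]/(gen_code (s, i, j)) gen_codeK. Qed.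

Lemma wprod_codes2 v w : ev [:: gen_code v; gen_code w] = x v * x w.
Proof. by rewrite /wprod !big_cons big_nil mulr1 /on_codes !gen_codeK. Qed.

Lemma peval_sum2 f : peval q ev (sum2 f) = \sum_(i < 2) peval q ev (f i).
Proof. by rewrite peval_cat !big_ord_recl big_ord0 addr0. Qed.

Lemma sphere_cross_ruleE (s t : 'I_3) (e f g h : 'I_2) :
  crossing_rel q (\matrix_(i, j) x (s, i, j)) (\matrix_(i, j) x (t, i, j)) e f g h =
  ev [:: entry t e f; entry s g h] - peval q ev (sphere_cross_rule s t e f g h).
Proof.
rewrite (wprod_codes2 (t, e, f) (s, g, h)) /crossing_rel !mxE; congr (_ - _).
do 8![rewrite peval_sum2; apply: eq_bigr => ? _].
rewrite !mxE -!(wprod_codes2 (_, _, _)) /peval big_map /= -scaler_suml.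
congr (_ *: _); rewrite -/(laurent_eval _) !laurent_eval_mul RtildeE !RmatE RinvE.
(* The square roots cancel: the two factors from [Rmat] against one inverse each from [Rtilde] and
   [Rinv]. *)
by have := q_neq0; rewrite -sqrtC_eq0 => s_neq0; field.
Qed.

Lemma matrix_codes (s : 'I_3) : let M := \matrix_(i, j) x (s, i, j) in
  [/\ M 0 0 = on_codes (4 * s), M 1 1 = on_codes (4 * s).+1,
      M 0 1 = on_codes (4 * s).+2 & M 1 0 = on_codes (4 * s).+3].
Proof.
by split; rewrite !mxE -wprod_codes1 /entry /= ?(addn0, addn1, addn2, addn3).
Qed.

(** Left-hand sides in the order of [reflection_rels], so that the two lists can be compared entry
    by entry. *)
Definition block_pairs : seq (nat * nat) :=
  [:: (2, 0); (3, 0); (3, 2); (1, 0); (1, 2); (1, 3); (0, 1)]%N.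

Lemma sphere_block_ruleE (s : 'I_3) :
  reflection_rels q (\matrix_(i, j) x (s, i, j)) =
  [seq ev [:: (4 * s + kl.1)%N; (4 * s + kl.2)%N] -
       peval q ev (odflt [::] (sphere_block_rule (4 * s) kl.1 kl.2))
  | kl <- block_pairs].
Proof.
have [E00 E11 E01 E10] := matrix_codes s.
rewrite /reflection_rels E00 E11 E01 E10; set b := (4 * s)%N.
have e2 l l' : ev [:: l; l'] = on_codes l * on_codes l'.
  by rewrite /wprod !big_cons big_nil mulr1.
have e0 : ev [::] = 1 by rewrite /wprod big_nil.
have bE := (addn0 b, addn1 b, addn2 b, addn3 b).
have simp := (e0, e2, big_cons, big_nil, expr0z, mul1r, mulN1r, scale1r, scaleN1r,
              addr0, bE).
have m2 : q ^ (-2) = q ^- 2 by [].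
have m4 : q ^ (-4) = q ^- 2 * q ^- 2 by rewrite -invfM -exprD.
rewrite /= /peval !simp m2 m4 /=; congr [:: _ - _; _ - _; _ - _; _; _; _; _].
- by rewrite scalerBl scale1r scaleNr.
- rewrite mulrBr mulr1 scalerBl !scaleNr opprB.
  by rewrite !addrA addrAC.
- by rewrite scalerBl scale1r scalerBr scaleNr opprB !addrA addrAC.
Qed.

Lemma row_entry (i j : 'I_2) : row_of (entry 0 i j) = i.
Proof. by case: i => [[|[|i]] li] //; case: j => [[|[|j]] lj]. Qed.

Lemma col_entry (i j : 'I_2) : col_of (entry 0 i j) = j.
Proof. by case: i => [[|[|i]] li] //; case: j => [[|[|j]] lj]. Qed.

Lemma entry_row_col k : (k < 4)%N -> entry 0 (row_of k) (col_of k) = k.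
Proof. by case: k => [|[|[|[|]]]]. Qed.

(** The dictionary between the relations of the presentation and rules on letter codes; it turns
    statements about all relations into finite enumerations. *)
Lemma sphere_relsP r : sphere_rels q x r <->
  exists l l' p, sphere_rule l l' = Some p /\ r = ev [:: l; l'] - peval q ev p.
Proof.
have ed b k : (k < 4)%N -> edivn (4 * b + k) 4 = (b, k).
  by move=> ?; rewrite mulnC edivn_eq.
have ltE i j : (entry 0 i j < 4)%N by rewrite /entry; do 2!case: ifP.
have entryE b i j : entry b i j = (4 * b + entry 0 i j)%N by [].
split.
- case=> [[s]|[s [t [lt_st [e [f [g [h ->]]]]]]]].
    rewrite sphere_block_ruleE => /mapP[[k l] kl ->] /=.
    exists (4 * s + k)%N, (4 * s + l)%N, (odflt [::] (sphere_block_rule (4 * s) k l)).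
    split=> //; have [lk ll Hp] : [/\ k < 4, l < 4 & isSome (sphere_block_rule (4 * s) k l)]%N.
      by move: kl; rewrite !inE => /or4P[|||/or4P[]] /eqP[-> ->].
    rewrite /sphere_rule !ltn_letter // !ed // eqxx; by case: (sphere_block_rule _ _ _) Hp.
  rewrite sphere_cross_ruleE; do 3!eexists; split; last by [].
  rewrite /sphere_rule [entry t e f]entryE [entry s g h]entryE !ltn_letter // !ed //.
  by rewrite ltn_eqF // lt_st !row_entry !col_entry.
- case=> l [l' [p []]]; rewrite /sphere_rule; case: ifP => // /andP[l'12 l12].
  case: edivnP l'12 => b' k' -> /= k'4 l'12; case: edivnP l12 => b k -> /= k4 l12.
  have b3 := letter_block l12; have b'3 := letter_block l'12.
  rewrite ![(_ * 4)%N]mulnC.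
  case: eqP => [->|_]; last case: ifP => // lt_b [<-] ->.
    move=> E ->; left; exists (Ordinal b3); rewrite sphere_block_ruleE.
    apply/mapP; exists (k, k'); last by rewrite /= E.
    by case: k k' k4 k'4 E {l12 l'12} => [|[|[|[|?]]]] [|[|[|[|?]]]].
  right; exists (Ordinal b'3), (Ordinal b3); split=> //.
  exists (inord (row_of k)), (inord (col_of k)), (inord (row_of k')), (inord (col_of k')).
  rewrite sphere_cross_ruleE !inordK; try by rewrite /row_of /col_of ltnS leq_b1.
  by congr (ev [:: _; _] - _); rewrite entryE entry_row_col.
Qed.

End Relations.
End SphereRules.

(** * Free algebras and ideals *)

Section LinearExtension.
Variables (C : fieldType) (K : choiceType) (W : lmodType C).

Definition mlin (phi : K -> W) (p : {malg C[K]}) : W :=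
  \sum_(k <- msupp p) p@_k *: phi k.

Lemma mlinEw (phi : K -> W) (d : {fset K}) p : (msupp p `<=` d)%fset ->
  mlin phi p = \sum_(k <- d) p@_k *: phi k.
Proof.
move=> le_d; rewrite /mlin (big_fset_incl _ le_d) // => k _ /mcoeff_outdom ->.
by rewrite scale0r.
Qed.

Lemma mlin_is_linear phi : linear (mlin phi).
Proof.
move=> c p p'; pose d := (msupp (c *: p + p') `|` (msupp p `|` msupp p'))%fset.
have d1 : (msupp (c *: p + p') `<=` d)%fset by exact: fsubsetUl.
have d2 : (msupp p `<=` d)%fset by apply/fsubsetP=> k kp; rewrite !inE kp orbT.
have d3 : (msupp p' `<=` d)%fset by apply/fsubsetP=> k kp; rewrite !inE kp !orbT.
rewrite (mlinEw _ d1) (mlinEw _ d2) (mlinEw _ d3) scaler_sumr -big_split.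
by apply: eq_bigr => k _ /=; rewrite scalerA -scalerDl mcoeffD mcoeffZ.
Qed.

HB.instance Definition _ phi :=
  GRing.isLinear.Build C {malg C[K]} W _ (mlin phi) (mlin_is_linear phi).

Lemma mlinU phi k : mlin phi << k >> = phi k.
Proof.
rewrite (@mlinEw phi [fset k]%fset) ?msuppU_le // big_seq_fset1.
by rewrite mcoeffUU scale1r.
Qed.

Lemma malg_sum (p : {malg C[K]}) : p = \sum_(k <- msupp p) p@_k *: << k >>.
Proof.
rewrite {1}(monalgE p); apply: eq_bigr => k _.
by apply/malgP => k'; rewrite mcoeffZ !mcoeffU mulrnAr mulr1.
Qed.

Lemma eq_mlin phi psi p : {in msupp p, phi =1 psi} -> mlin phi p = mlin psi p.
Proof. by move=> E; apply: eq_big_seq => k /E ->. Qed.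

End LinearExtension.

Lemma mlin_comp (C : fieldType) (K : choiceType) (W W' : lmodType C)
  (f : {linear W -> W'}) (phi : K -> W) p :
  f (mlin phi p) = mlin (f \o phi) p.
Proof. by rewrite linear_sum; apply: eq_bigr => k _; rewrite linearZ. Qed.

Section FreeAlgebra.
Variables (C : fieldType) (X : choiceType).

Lemma malgUM (K : monomType) (k k' : K) :
  << k >> * << k' >> = << (mmul k k') >> :> {malg C[K]}.
Proof. by rewrite malgM_def fgmulUU mulr1. Qed.

Lemma malg_scalerAr (K : monomType) (c : C) (p p' : {malg C[K]}) :
  p * (c *: p') = c *: (p * p').
Proof.
have scaleU a b k : a *: << b *g k >> = << a * b *g k >> :> {malg C[K]}.
  by apply/malgP => k'; rewrite mcoeffZ !mcoeffU mulrnAr.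
rewrite (malg_sum p) !mulr_suml scaler_sumr; apply: eq_bigr => k _.
rewrite -!scalerAl !scalerA mulrC -scalerA; congr (_ *: _).
rewrite (malg_sum p') scaler_sumr !mulr_sumr scaler_sumr; apply: eq_bigr => k' _.
by rewrite !scaleU !malgM_def !fgmulUU scaleU !mul1r.
Qed.

Lemma mlinM (K : monomType) (W : lmodType C) (phi : K -> W) p p' :
  mlin phi (p * p') = mlin (fun k => mlin (fun k' => phi (mmul k k')) p') p.
Proof.
rewrite {1}(malg_sum p) mulr_suml linear_sum; apply: eq_bigr => k _.
rewrite -scalerAl linearZ /=; congr (_ *: _).
rewrite {1}(malg_sum p') mulr_sumr linear_sum; apply: eq_bigr => k' _.
by rewrite malg_scalerAr linearZ /= malgUM mlinU.
Qed.

Lemma malg_word (w : {fmonom X}) :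
  << w >> = \prod_(x <- (w : seq X)) freevar C x.
Proof.
case: w => w; rewrite /=; elim: w => [|x w IH].
  by rewrite big_nil -fmoneE.
rewrite big_cons -IH /freevar malgUM; congr << _ >>.
by apply/eqP; rewrite fmP fmM fmU.
Qed.

Section Eval.
Variables (A : algType C) (g : X -> A).

Lemma freeevalE p : freeeval g p = mlin (fun w : {fmonom X} => \prod_(x <- (w : seq X)) g x) p.
Proof. by []. Qed.

HB.instance Definition _ :=
  GRing.isLinear.Build C (freealg C X) A _ (freeeval g) (mlin_is_linear _).

Lemma freeevalM p p' : freeeval g (p * p') = freeeval g p * freeeval g p'.
Proof.
rewrite !freeevalE mlinM mulr_suml; apply: eq_bigr => w _.
rewrite -scalerAl; congr (_ *: _); rewrite mulr_sumr; apply: eq_bigr => w' _.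
by rewrite -scalerAr -big_cat -fmM.
Qed.

Lemma freeeval_var x : freeeval g (freevar C x) = g x.
Proof. by rewrite freeevalE mlinU fmU big_seq1. Qed.

Lemma freeeval1 : freeeval g 1 = 1.
Proof. by rewrite freeevalE -mpolyC1E mlinU fm1 big_nil. Qed.

Lemma freeeval_prod (s : seq X) :
  freeeval g (\prod_(x <- s) freevar C x) = \prod_(x <- s) g x.
Proof.
elim: s => [|x s IH]; first by rewrite !big_nil freeeval1.
by rewrite !big_cons freeevalM freeeval_var IH.
Qed.

Lemma freeeval_ideal (rels : freealg C X -> Prop) p :
  (forall r, rels r -> freeeval g r = 0) -> in_ideal rels p -> freeeval g p = 0.
Proof.
move=> H [s sr ->]; rewrite linear_sum big_seq big1 // => t /sr /H E.
by rewrite /= !freeevalM E mulr0 mul0r.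
Qed.

End Eval.

Section Ideal.
Variable rels : freealg C X -> Prop.
Implicit Types p : freealg C X.

Lemma in_ideal0 : in_ideal rels 0.
Proof. by exists [::]; rewrite ?big_nil. Qed.

Lemma in_idealD p p' : in_ideal rels p -> in_ideal rels p' -> in_ideal rels (p + p').
Proof.
move=> [s sr ->] [s' sr' ->]; exists (s ++ s'); last by rewrite big_cat.
by move=> t; rewrite mem_cat => /orP[/sr|/sr'].
Qed.

Lemma in_idealMl p p' : in_ideal rels p -> in_ideal rels (p' * p).
Proof.
move=> [s sr ->]; exists [seq (p' * t.1.1, t.1.2, t.2) | t <- s].
  by move=> t /mapP[t' /sr ? ->].
by rewrite big_map mulr_sumr; apply: eq_bigr => t _; rewrite !mulrA.
Qed.

Lemma in_idealMr p p' : in_ideal rels p -> in_ideal rels (p * p').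
Proof.
move=> [s sr ->]; exists [seq (t.1.1, t.1.2, t.2 * p') | t <- s].
  by move=> t /mapP[t' /sr ? ->].
by rewrite big_map mulr_suml; apply: eq_bigr => t _; apply/esym/mulrA.
Qed.

Lemma in_idealZ c p : in_ideal rels p -> in_ideal rels (c *: p).
Proof. by move=> /(in_idealMl c%:A); rewrite mulr_algl. Qed.

Lemma in_ideal_rel p : rels p -> in_ideal rels p.
Proof.
move=> rp; exists [:: (1, p, 1)]; first by move=> t; rewrite inE => /eqP ->.
by rewrite big_seq1 mul1r mulr1.
Qed.

End Ideal.
End FreeAlgebra.

(** * Coordinates in the basis of irreducible words *)

(* The letters of [pbw_rule] in terms of the original generators and conversely:
   tr_q X = X^1_1 + q^-2 X^2_2. *)
Definition to_sphere (l : nat) : ncpoly :=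
  if (4 %| l)%N then [:: pterm [:: l] 0 1; pterm [:: l.+1] (-2) 1]
  else pvar l.
Definition of_sphere (l : nat) : ncpoly :=
  if (4 %| l)%N then [:: pterm [:: l] 0 1; pterm [:: l.+1] (-2) (-1)]
  else pvar l.

(** One half of the equivalence of the two systems: the rules follow from the defining relations, so
    they hold in the sphere algebra. *)
Lemma pbw_rule_sphere x y r : pbw_rule x y = Some r ->
  pnf sphere_rule 10 (psub (psubst to_sphere [:: x; y]) (pbind (psubst to_sphere) r))
  = [::].
Proof.
pose P x y r := nilp (pnf sphere_rule 10
  (psub (psubst to_sphere [:: x; y]) (pbind (psubst to_sphere) r))).
have H : over_rules P by vm_compute.
by move/(over_rulesP H)/nilP.
Qed.

Lemma sphere_rule_letters x y r : sphere_rule x y = Some r ->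
  (x \in letters) && (y \in letters).
Proof. by rewrite /sphere_rule !mem_letters andbC; case: ifP. Qed.

Lemma over_sphere_rules (P : nat -> nat -> ncpoly -> bool) x y r :
  all (fun x => all (fun y => if sphere_rule x y is Some r then P x y r else true)
                    letters) letters ->
  sphere_rule x y = Some r -> P x y r.
Proof.
move=> H E; have /andP[xl yl] := sphere_rule_letters E.
by have := allP (allP H _ xl) _ yl; rewrite E.
Qed.

(** The other half: the defining relations reduce to zero by [pbw_rule], so they will act by zero on
    normal forms. The clause on letters makes the coding of generators invertible on the words that
    occur. *)
Lemma sphere_rule_pbw x y r : sphere_rule x y = Some r ->
  pnf pbw_rule 10 (psub (psubst of_sphere [:: x; y]) (pbind (psubst of_sphere) r))
  = [::] /\ {in r, forall t : term, {subset t.1.1 <= letters}}.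
Proof.
pose P x y r := nilp (pnf pbw_rule 10
  (psub (psubst of_sphere [:: x; y]) (pbind (psubst of_sphere) r))) &&
  all (fun t : term => all (mem letters) t.1.1) r.
move/(@over_sphere_rules P)=> H; have /andP[/nilP ? /allP Hr] := H ltac:(by vm_compute).
by split=> // t /Hr /allP.
Qed.

Lemma letters_ctx u x y v r : pbw_rule x y = Some r ->
  {subset u ++ [:: x, y & v] <= letters} ->
  {in r, forall t, {subset u ++ t.1.1 ++ v <= letters}}.
Proof.
pose P (x y : nat) (r : ncpoly) := all (fun t : term => all (mem letters) t.1.1) r.
have H : over_rules P by vm_compute.
move=> /(over_rulesP H)/allP Hr sub t /Hr/allP sub_t z.
rewrite !mem_cat => /or3P[zu|/sub_t //|zv]; apply: sub.
  by rewrite mem_cat zu.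
by rewrite mem_cat !inE zv !orbT.
Qed.

Lemma gen_decodeK l : l \in letters -> gen_code (gen_decode l) = l.
Proof.
rewrite mem_letters.
by case: l => [|[|[|[|[|[|[|[|[|[|[|[|]]]]]]]]]]]] // _;
  rewrite /gen_code /entry /gen_decode /= !inordK.
Qed.

Section Coordinates.
Variables (C : numClosedFieldType) (q : C).
Hypothesis q_neq0 : q != 0.
Local Notation W := {malg C[word]}.
Local Notation NF := (normal_form pbw_rule q).

Lemma pbw_normal_form_rule u x y v r : pbw_rule x y = Some r ->
  NF (u ++ [:: x, y & v]) = peval q (fun z => NF (u ++ z ++ v)) r.
Proof. exact: (@normal_form_rule _ pbw_decreasing _ _ q_neq0 20 _ _ _ _ _ pbw_confluent). Qed.

(** Left multiplication by a letter followed by reduction: the regular representation, built before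
    one knows that normal words are independent in the algebra. *)
Definition lact (l : nat) : W -> W := mlin (fun w => NF (l :: w)).
HB.instance Definition _ l := GRing.Linear.on (lact l).

Lemma lact_normal_form l w : lact l (NF w) = NF (l :: w).
Proof.
rewrite {1}/normal_form peval_linear.
transitivity (peval q (fun z => NF (l :: z)) (nf pbw_rule (wval w).+1 w)).
  by apply: eq_peval => t _; rewrite /= /lact mlinU.
apply: (@peval_nf _ _ q_neq0 _ pbw_rule (fun=> True) (fun z => NF (l :: z))) => //.
move=> u x y v r Er _; split=> //.
exact: (pbw_normal_form_rule (l :: u)).
Qed.

(** Here [l] codes an original generator; if 4 divides it, this is X^1_1 = tr_q X - q^-2 X^2_2. *)
Definition sact (l : nat) (v : W) : W :=
  if (4 %| l)%N then lact l v - q ^- 2 *: lact l.+1 v else lact l v.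

Lemma sact_is_linear l : linear (sact l).
Proof.
move=> c v v'; rewrite /sact; case: ifP => _; rewrite !(linearP (lact _)) //=.
by rewrite !scalerDr opprD !scalerN !scalerA mulrC addrACA.
Qed.

HB.instance Definition _ l := GRing.isLinear.Build C W W _ (sact l) (sact_is_linear l).

Lemma sact_normal_form l w :
  sact l (NF w) = peval q (fun z => NF (z ++ w)) (of_sphere l).
Proof.
rewrite /sact /of_sphere; case: ifP => _; last by rewrite lact_normal_form peval1.
rewrite !lact_normal_form !peval_cons peval_nil addr0 /= expr0z mul1r scale1r.
by rewrite mulN1r scaleNr.
Qed.

Definition swact (w : word) (v : W) : W := foldr sact v w.

Lemma swact_is_linear w : linear (swact w).
Proof. by move=> c v v'; elim: w => //= l w ->; rewrite linearP. Qed.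

HB.instance Definition _ w := GRing.isLinear.Build C W W _ (swact w) (swact_is_linear w).

Lemma swact_normal_form w w' :
  swact w (NF w') = peval q (fun z => NF (z ++ w')) (psubst of_sphere w).
Proof.
elim: w => [|l w IH] /=; first by rewrite peval1.
rewrite IH (peval_linear q (sact l)).
rewrite [RHS](peval_mul q_neq0).
rewrite (peval_exchange q (fun z z' => NF ((z ++ z') ++ w'))).
by apply: eq_peval => t _ /=; rewrite sact_normal_form; apply: eq_peval => t' _; rewrite catA.
Qed.

Lemma swact_rule x y r w : sphere_rule x y = Some r ->
  swact [:: x; y] (NF w) = peval q (fun z => swact z (NF w)) r.
Proof.
move=> /sphere_rule_pbw[E _]; rewrite swact_normal_form.
transitivity (peval q (fun z => NF (z ++ w)) (pbind (psubst of_sphere) r)); last first.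
  by rewrite peval_bind //; apply: eq_peval => t _; rewrite swact_normal_form.
apply/eqP; rewrite -subr_eq0 -peval_sub //.
rewrite -(@peval_pnf _ _ q_neq0 _ pbw_rule (fun=> True) _ 10) //.
  by rewrite E peval_nil.
move=> u x' y' v r' Er' _; split=> //; rewrite -catA /= (pbw_normal_form_rule _ _ Er').
by apply: eq_peval => t _; rewrite -!catA.
Qed.

Definition gact (p : freealg C sphere_gen) (v : W) : W :=
  mlin (fun w : {fmonom sphere_gen} => swact [seq gen_code x | x <- (w : seq _)] v) p.

Lemma gactM p p' v : gact (p * p') v = gact p (gact p' v).
Proof.
rewrite /gact mlinM; apply: eq_mlin => w _.
rewrite (mlin_comp (swact _)); apply: eq_mlin => w' _ /=.
by rewrite fmM map_cat /swact foldr_cat.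
Qed.

Lemma gact_lin p c v v' : gact p (c *: v + v') = c *: gact p v + gact p v'.
Proof.
rewrite /gact /mlin scaler_sumr -big_split; apply: eq_bigr => w _ /=.
by rewrite linearP scalerDr !scalerA mulrC.
Qed.

Lemma gact_peval v w p : {in p, forall t : term, {subset t.1.1 <= letters}} ->
  {subset w <= letters} ->
  gact (wprod (on_codes (@freevar C sphere_gen)) w -
        peval q (wprod (on_codes (@freevar C sphere_gen))) p) v
  = swact w v - peval q (fun z => swact z v) p.
Proof.
have gw z : {subset z <= letters} ->
    gact (wprod (on_codes (@freevar C sphere_gen)) z) v = swact z v.
  move=> zl.
  have -> : wprod (on_codes (@freevar C sphere_gen)) z = << FMonom (map gen_decode z) >>.
    by rewrite malg_word /= big_map.
  rewrite /gact mlinU /= -map_comp; congr swact.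
  rewrite -[RHS]map_id; apply/eq_in_map => l /zl; exact: gen_decodeK.
move=> pl wl.
rewrite /gact linearB /= -!/(gact _ _) gw //; congr (_ - _).
by rewrite /gact peval_linear; apply: eq_peval => t /pl; apply: gw.
Qed.

Lemma gact_rel r w : sphere_rels q (@freevar C sphere_gen) r -> gact r (NF w) = 0.
Proof.
case/(sphere_relsP q_neq0) => x [y [p [Er ->]]].
have [_ pl] := sphere_rule_pbw Er.
have /andP[xl yl] := sphere_rule_letters Er.
rewrite gact_peval // ?(swact_rule _ Er) ?subrr // => z.
by rewrite in_cons mem_seq1 => /orP[] /eqP->.
Qed.

Definition normal_vec (v : W) : Prop :=
  forall w, v@_w != 0 -> irreducible pbw_rule w /\ {subset w <= letters}.

Lemma normal_vec0 : normal_vec 0.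
Proof. by move=> w; rewrite mcoeff0 eqxx. Qed.

Lemma normal_vec_lin c v v' : normal_vec v -> normal_vec v' -> normal_vec (c *: v + v').
Proof.
move=> nv nv' w; rewrite mcoeffD mcoeffZ.
have [->|/nv //] := eqVneq v@_w 0; rewrite mulr0 add0r; exact: nv'.
Qed.

Lemma normal_form_supp w z : (NF w)@_z != 0 ->
  exists2 t, t \in nf pbw_rule (wval w).+1 w & z = t.1.1.
Proof.
rewrite /normal_form /peval raddf_sum /= => nz.
have [/hasP[t tn Et]|/hasPn no] :=
  boolP (has (fun t : term => t.1.1 == z) (nf pbw_rule (wval w).+1 w)).
  by exists t => //; rewrite (eqP Et).
move: nz; rewrite big_seq big1 ?eqxx // => t /no /negPf tz.
by rewrite mcoeffZ mcoeffU tz mulr0.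
Qed.

Lemma normal_vec_NF w : {subset w <= letters} -> normal_vec (NF w).
Proof.
move=> wl z /normal_form_supp[t tn ->]; split.
  exact: (nf_irreducible pbw_decreasing (ltnSn _)) tn.
apply: (nf_closed (Q := fun w => {subset w <= letters})) tn => //.
by move=> u x y v r; apply: letters_ctx.
Qed.

Lemma normal_vec_lact l v : l \in letters -> normal_vec v -> normal_vec (lact l v).
Proof.
move=> ll nv; rewrite /lact /mlin big_seq; elim/big_rec: _ => [|w v' wv nv'].
  exact: normal_vec0.
apply: normal_vec_lin => //; apply: normal_vec_NF => z.
rewrite in_cons => /orP[/eqP->//|]; apply: (nv w _).2.
by rewrite mcoeff_neq0.
Qed.

Lemma normal_vec_sact l v : l \in letters -> normal_vec v -> normal_vec (sact l v).
Proof.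
move=> ll nv; rewrite /sact; case: ifP => l4; last exact: normal_vec_lact.
rewrite addrC -scaleNr; apply: normal_vec_lin; apply: normal_vec_lact => //.
have H : all (fun l => (4 %| l)%N ==> (l.+1 \in letters)) letters by vm_compute.
by have := allP H l ll; rewrite l4.
Qed.

Lemma gact_ideal p : in_ideal (sphere_rels q (@freevar C sphere_gen)) p ->
  gact p (NF [::]) = 0.
Proof.
case=> s sr ->; rewrite /gact linear_sum big_seq big1 // => -[[a r] b] /sr /= rr.
rewrite -/(gact _ _) !gactM.
have gl c : gact c 0 = 0 by rewrite /gact /mlin big1 // => w _; rewrite linear0 scaler0.
suff -> : gact r (gact b (NF [::])) = 0 by [].
rewrite {2}/gact /mlin.
have -> : gact r (\sum_(w <- msupp b) b@_w *:
    swact [seq gen_code x | x <- (w : seq _)] (NF [::])) =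
  \sum_(w <- msupp b) b@_w *:
    gact r (swact [seq gen_code x | x <- (w : seq _)] (NF [::])).
  elim/big_rec2: _ => [|w v v' _ IH]; first exact: gl.
  by rewrite gact_lin IH.
rewrite big1 // => w _.
(* The relations are known to kill vectors of the form [NF z]; what the right factor produces from
   the empty word is a combination of such vectors. *)
rewrite swact_normal_form.
suff gp p' : gact r (peval q (fun z => NF (z ++ [::])) p') = 0 by rewrite gp scaler0.
elim: p' => [|t p' IH]; first by rewrite peval_nil gl.
by rewrite peval_cons gact_lin IH gact_rel // scaler0 addr0.
Qed.

End Coordinates.

(** * The basis of irreducible words in the sphere algebra *)

Section SphereAlgebra.
Variables (C : numClosedFieldType) (q : C).
Hypothesis q_neq0 : q != 0.
Variables (A : algType C) (M : 'I_3 -> 'M[A]_2).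
Hypothesis A_presented : is_sphere_algebra q M.
Local Notation W := {malg C[word]}.
Local Notation NF := (normal_form pbw_rule q).

Definition sphere_elt (v : sphere_gen) : A := M v.1.1 v.1.2 v.2.
Local Notation sg := (on_codes sphere_elt).
Definition letter_elt (l : nat) : A := peval q (wprod sg) (to_sphere l).
Local Notation pg := letter_elt.

Lemma sphere_elt_satisfies : satisfies q sg sphere_rule.
Proof.
move=> x y r Er; apply/eqP; rewrite -subr_eq0; apply/eqP.
have ev w : freeeval sphere_elt (wprod (on_codes (@freevar C sphere_gen)) w) = wprod sg w.
  by rewrite /wprod -(big_map gen_decode predT) freeeval_prod big_map.
have := A_presented.2 (wprod (on_codes (@freevar C sphere_gen)) [:: x; y] -
                       peval q (wprod (on_codes (@freevar C sphere_gen))) r).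
rewrite linearB /= !ev wprod_cons wprod1 => H.
transitivity (sg x * sg y -
    freeeval sphere_elt (peval q (wprod (on_codes (@freevar C sphere_gen))) r)).
  congr (_ - _); rewrite (peval_linear q (freeeval sphere_elt)).
  by apply: eq_peval => t _ /=; rewrite ev.
apply/H/in_ideal_rel/(sphere_relsP q_neq0).
by exists x, y, r.
Qed.

Lemma letter_elt_satisfies : satisfies q pg pbw_rule.
Proof.
move=> x y r /pbw_rule_sphere E.
transitivity (peval q (wprod sg) (psubst to_sphere [:: x; y])).
  by rewrite peval_subst // wprod_cons wprod1.
transitivity (peval q (wprod sg) (pbind (psubst to_sphere) r)); last first.
  by rewrite peval_bind //; apply: eq_peval => t _; rewrite peval_subst.
apply/eqP; rewrite -subr_eq0 -peval_sub //.
by rewrite -(wprod_pnf q_neq0 10 _ sphere_elt_satisfies) E peval_nil.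
Qed.

Lemma wprod_NF w : mlin (wprod pg) (NF w) = wprod pg w.
Proof.
rewrite /normal_form (peval_linear q (mlin (wprod pg))).
rewrite -[RHS](wprod_nf q_neq0 (wval w).+1 w letter_elt_satisfies).
by apply: eq_peval => t _ /=; rewrite mlinU.
Qed.

Lemma freeeval_surj z : exists p, z = freeeval sphere_elt p.
Proof. exact: (A_presented.1 z).1. Qed.

(* The algebra acts on the span of the normal words by left multiplication
   followed by reduction; the coordinates of z are the image of the empty word. *)
Definition wcoord (z : A) : W := gact q (projT1 (cid (freeeval_surj z))) (NF [::]).

Lemma gactB p p' v : gact q (p - p') v = gact q p v - gact q p' v.
Proof. by rewrite /gact linearB. Qed.

(** Two preimages of an element differ by a member of the ideal, which kills the empty word; so the
    choice in [wcoord] is harmless. *)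
Lemma wcoordE p : wcoord (freeeval sphere_elt p) = gact q p (NF [::]).
Proof.
rewrite /wcoord; case: cid => p' /= E; apply/eqP; rewrite -subr_eq0 -gactB.
by apply/eqP/(gact_ideal q_neq0)/A_presented.2; rewrite linearB /= E subrr.
Qed.

Lemma wcoord_is_linear : linear wcoord.
Proof.
move=> c z z'; have [p ->] := freeeval_surj z; have [p' ->] := freeeval_surj z'.
by rewrite -linearP /= !wcoordE /gact linearP.
Qed.

HB.instance Definition _ := GRing.isLinear.Build C A W _ wcoord wcoord_is_linear.

Lemma wcoord_sphere l z : l \in letters -> wcoord (sg l * z) = sact q l (wcoord z).
Proof.
move=> ll; have [p ->] := freeeval_surj z.
rewrite -[sg l](freeeval_var sphere_elt) -freeevalM !wcoordE gactM.
by rewrite /gact [X in _ = X]/= /freevar mlinU fmU /= gen_decodeK.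
Qed.

Lemma wcoord_letter l z : l \in letters -> wcoord (pg l * z) = lact q l (wcoord z).
Proof.
move=> ll; rewrite /letter_elt /to_sphere; case: ifP => l4; last first.
  by rewrite peval1 wprod1 wcoord_sphere // /sact l4.
have l1 : (l.+1 \in letters) && ~~ (4 %| l.+1)%N.
  have H : all (fun l => (4 %| l)%N ==> (l.+1 \in letters) && ~~ (4 %| l.+1)%N) letters.
    by vm_compute.
  by have := allP H l ll; rewrite l4.
have [l1l /negPf l14] := andP l1.
rewrite !peval_cons peval_nil addr0 /= !wprod1 expr0z mul1r scale1r mul1r.
rewrite mulrDl -scalerAl linearD linearZ /= !wcoord_sphere //.
by rewrite /sact l4 l14 subrK.
Qed.

Lemma wcoord1 : wcoord 1 = NF [::].
Proof.
rewrite -(freeeval1 sphere_elt) wcoordE /gact -mpolyC1E mlinU /=.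
by rewrite fm1.
Qed.

Lemma wcoord_wprod w : {subset w <= letters} -> wcoord (wprod pg w) = NF w.
Proof.
elim: w => [|l w IH] wl; first by rewrite wprod_nil wcoord1.
rewrite wprod_cons wcoord_letter; last by apply: wl; rewrite mem_head.
by rewrite IH ?lact_normal_form // => z zw; apply: wl; rewrite in_cons zw orbT.
Qed.

Lemma sphere_ind (P : A -> Prop) :
  (forall c z z', P z -> P z' -> P (c *: z + z')) -> P 0 -> P 1 ->
  (forall l z, l \in letters -> P z -> P (sg l * z)) -> forall z, P z.
Proof.
move=> Plin P0 P1 Pmul z; have [p ->] := freeeval_surj z.
rewrite freeevalE /mlin; elim/big_rec: _ => [//|w z' _ Pz'].
apply: Plin => //; case: w => w /=; elim: w => [|x w IH]; rewrite ?big_nil ?big_cons //.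
have -> : sphere_elt x = sg (gen_code x) by rewrite /on_codes gen_codeK.
apply: Pmul => //; case: x => [[[s ls] [i li]] [j lj]].
rewrite mem_letters /gen_code /entry /=.
by case: s ls => [|[|[|]]] //; case: i li => [|[|]] //; case: j lj => [|[|]].
Qed.

(** Coordinates determine the element. Since by [wcoord_wprod] an irreducible word is its own
    coordinate vector, the irreducible words form a basis. *)
Lemma wcoord_sum z : z = mlin (wprod pg) (wcoord z).
Proof.
move: z; apply: sphere_ind => [c z z' E E'||| l z ll E].
- by rewrite linearP /= linearP /= -E -E'.
- by rewrite linear0 /= linear0.
- by rewrite wcoord1 wprod_NF wprod_nil.
have lactE k v : mlin (wprod pg) (lact q k v) = pg k * mlin (wprod pg) v.
  rewrite /lact (mlin_comp (mlin (wprod pg))) /mlin mulr_sumr.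
  by apply: eq_bigr => w _ /=; rewrite -/(mlin _ _) wprod_NF wprod_cons scalerAr.
have pgE k : ~~ (4 %| k)%N -> pg k = sg k.
  by move=> /negPf k4; rewrite /letter_elt /to_sphere k4 peval1 wprod1.
rewrite wcoord_sphere // /sact; case: ifP => l4; last by rewrite lactE -E pgE ?l4.
rewrite linearB linearZ /= !lactE -E [pg l.+1]pgE; last first.
  by rewrite -(addn1 l) dvdn_addr.
rewrite /letter_elt /to_sphere l4 !peval_cons peval_nil addr0 /= !wprod1 expr0z.
by rewrite mul1r scale1r mul1r mulrDl -scalerAl addrK.
Qed.

Lemma wcoord_normal z : normal_vec (wcoord z).
Proof.
move: z; apply: sphere_ind => [c z z' E E'||| l z ll E].
- by rewrite linearP /=; apply: normal_vec_lin.
- by rewrite linear0; apply: normal_vec0.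
- by rewrite wcoord1; apply: normal_vec_NF.
- by rewrite wcoord_sphere //; apply: normal_vec_sact.
Qed.

Lemma wcoord0 : wcoord 0 = 0.
Proof. exact: linear0. Qed.

Lemma wcoordZ c z : wcoord (c *: z) = c *: wcoord z.
Proof. exact: linearZ. Qed.

Lemma wcoordD z z' : wcoord (z + z') = wcoord z + wcoord z'.
Proof. exact: linearD. Qed.

End SphereAlgebra.

(** * Relations between the invariants *)

Definition entry_poly (b i j : nat) : ncpoly := of_sphere (entry b i j).
Definition trace_poly (f : nat -> nat -> ncpoly) : ncpoly :=
  f 0%N 0%N ++ pscale (-2) 1 (f 1%N 1%N).
Definition mul_poly (f g : nat -> nat -> ncpoly) (i j : nat) : ncpoly :=
  sum2 (fun k => pmul (f i k) (g k j)).

Definition inv_poly (g : inv_gen) : ncpoly :=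
  match g with
  | gE => trace_poly (mul_poly (entry_poly 0) (entry_poly 1))
  | gF => trace_poly (mul_poly (entry_poly 0) (entry_poly 2))
  | gG => trace_poly (mul_poly (entry_poly 1) (entry_poly 2))
  | gs => trace_poly (entry_poly 0)
  | gt => trace_poly (entry_poly 1)
  | gu => trace_poly (entry_poly 2)
  | gv => trace_poly (mul_poly (mul_poly (entry_poly 0) (entry_poly 1)) (entry_poly 2))
  end.

Definition inv_normal (g : inv_gen) : ncpoly := pnf pbw_rule 20 (inv_poly g).

Section Relations.
Variables (C : numClosedFieldType) (q : C).
Hypothesis q_neq0 : q != 0.

Section General.
Variables (A : algType C) (x : nat -> A).
Hypothesis x_rule : satisfies q x pbw_rule.
Local Notation ev := (peval q (wprod x)).
Variable P : inv_gen -> ncpoly.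
Local Notation "g '%x'" := (ev (P g)) (at level 2, format "g '%x'").

Lemma pnf_eq0 p : pnf pbw_rule 20 p = [::] -> ev p = 0.
Proof. by move=> E; rewrite -(wprod_pnf q_neq0 20 _ x_rule) E peval_nil. Qed.

Local Notation "p '**' p'" := (pmul p p') (at level 40).

(** In this and the next three definitions the scalars of the relations are expanded into powers of
    q. The generators are arbitrary polynomials [P], to be replaced by the already reduced
    [inv_normal]. *)
Definition FE_poly := psub (P gF ** P gE)
  (pscale 2 1 (P gE ** P gF) ++ (pscale 2 1 (P gG) ++ pscale (-2) (-1) (P gG)) ++
   (P gs ** P gv ++ P gt ** P gu) ++ pscale 2 (-1) (P gs ** P gv ++ P gt ** P gu)).
Definition GE_poly := psub (P gG ** P gE)
  (pscale (-2) 1 (P gE ** P gG) ++ (pscale 0 (-1) (P gF) ++ pscale (-4) 1 (P gF)) ++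
   (P gs ** P gu ++ P gt ** P gv) ++ pscale (-2) (-1) (P gs ** P gu ++ P gt ** P gv)).
Definition GF_poly := psub (P gG ** P gF)
  (pscale 2 1 (P gF ** P gG) ++ (pscale 2 1 (P gE) ++ pscale (-2) (-1) (P gE)) ++
   (P gs ** P gt ++ P gu ** P gv) ++ pscale 2 (-1) (P gs ** P gt ++ P gu ** P gv)).
(** The final list is the expansion of q^-6 (q^2 + 1)^2. *)
Definition EFG_poly := psub (P gE ** P gF ** P gG)
  (pscale 0 (-1) (P gE ** P gE) ++ pscale (-4) (-1) (P gF ** P gF) ++
   pscale 0 (-1) (P gG ** P gG) ++
   pscale (-2) (-1) (P gs ** P gs ++ P gt ** P gt ++ P gu ** P gu ++ P gv ** P gv) ++
   (P gs ** P gt ++ P gu ** P gv) ** P gE ++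
   pscale (-2) 1 ((P gs ** P gu ++ P gt ** P gv) ** P gF) ++
   (P gs ** P gv ++ P gt ** P gu) ** P gG ++
   pscale 0 (-1) (P gs ** P gt ** P gu ** P gv) ++
   [:: pterm [::] (-2) 1; pterm [::] (-4) 2; pterm [::] (-6) 1]).

Let simp := (peval_sub q_neq0, peval_cat, peval_scale q_neq0, peval_wprod_mul q_neq0).
Let coefs := (mul1r, mulN1r, expr0z, scale1r, scaleNr).

Let exprz2 : q ^ 2 = q ^+ 2. Proof. by []. Qed.
Let exprzN2 : q ^ (-2) = q ^- 2. Proof. by []. Qed.
Let exprzN4 : q ^ (-4) = q ^- 4. Proof. by []. Qed.
Let exprzN6 : q ^ (-6) = q ^- 6. Proof. by []. Qed.
Let exprz_lit := (exprz2, exprzN2, exprzN4, exprzN6).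

Lemma FE_polyE : ev FE_poly = gF%x * gE%x -
  (q ^+ 2 *: (gE%x * gF%x) + (q ^+ 2 - q ^- 2) *: gG%x
   + (1 - q ^+ 2) *: (gs%x * gv%x + gt%x * gu%x)).
Proof.
rewrite /FE_poly !simp !coefs !exprz_lit !scalerBl scale1r.
by rewrite !addrA.
Qed.

Lemma GE_polyE : ev GE_poly = gG%x * gE%x -
  (q ^- 2 *: (gE%x * gG%x) - (q ^- 2 * (q ^+ 2 - q ^- 2)) *: gF%x
   + (1 - q ^- 2) *: (gs%x * gu%x + gt%x * gv%x)).
Proof.
rewrite /GE_poly !simp !coefs !exprz_lit !scalerBl scale1r.
have -> : q ^- 2 * (q ^+ 2 - q ^- 2) = 1 - q ^- 4 by field.
by rewrite scalerBl scale1r opprB [_ - gF%x]addrC !addrA.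
Qed.

Lemma GF_polyE : ev GF_poly = gG%x * gF%x -
  (q ^+ 2 *: (gF%x * gG%x) + (q ^+ 2 - q ^- 2) *: gE%x
   + (1 - q ^+ 2) *: (gs%x * gt%x + gu%x * gv%x)).
Proof.
rewrite /GF_poly !simp !coefs !exprz_lit !scalerBl scale1r.
by rewrite !addrA.
Qed.

Lemma EFG_polyE : ev EFG_poly = gE%x * gF%x * gG%x -
  (- gE%x ^+ 2 - q ^- 4 *: gF%x ^+ 2 - gG%x ^+ 2
   - q ^- 2 *: (gs%x ^+ 2 + gt%x ^+ 2 + gu%x ^+ 2 + gv%x ^+ 2)
   + (gs%x * gt%x + gu%x * gv%x) * gE%x + q ^- 2 *: ((gs%x * gu%x + gt%x * gv%x) * gF%x)
   + (gs%x * gv%x + gt%x * gu%x) * gG%x - gs%x * gt%x * gu%x * gv%x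
   + (q ^- 6 * (q ^+ 2 + 1) ^+ 2)%:A).
Proof.
rewrite /EFG_poly !simp !coefs !exprz_lit.
have -> : ev [:: pterm [::] (-2) 1; pterm [::] (-4) 2; pterm [::] (-6) 1] =
    (q ^- 6 * (q ^+ 2 + 1) ^+ 2)%:A.
  rewrite !peval_cons peval_nil addr0 /= !exprz_lit !wprod_nil -!scalerDl.
  by congr (_ *: _); field.
by rewrite !expr2 !addrA.
Qed.

End General.

Variables (A : algType C) (M : 'I_3 -> 'M[A]_2).
Hypothesis A_presented : is_sphere_algebra q M.
Local Notation pg := (letter_elt q M).
Local Notation ev := (peval q (wprod pg)).
Let pg_rule := letter_elt_satisfies q_neq0 A_presented.

Lemma entry_polyE (b : 'I_3) (i j : 'I_2) : ev (entry_poly b i j) = M b i j.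
Proof.
have E v : M v.1.1 v.1.2 v.2 = on_codes (sphere_elt M) (gen_code v).
  by rewrite /on_codes gen_codeK.
rewrite (E (b, i, j)) -[entry_poly b i j]/(of_sphere (gen_code (b, i, j))).
set l := gen_code _; rewrite /of_sphere; case: ifP => l4; last first.
  by rewrite peval1 wprod1 /letter_elt /to_sphere l4 peval1 wprod1.
rewrite !peval_cons peval_nil addr0 /= !wprod1 expr0z mul1r scale1r mulN1r scaleNr.
have l14 : (4 %| l.+1)%N = false by rewrite -(addn1 l) dvdn_addr.
rewrite [pg l.+1]/letter_elt /to_sphere l14 peval1 wprod1.
rewrite /letter_elt /to_sphere l4 !peval_cons peval_nil addr0 /= !wprod1.
by rewrite expr0z mul1r scale1r mul1r addrK.
Qed.

Lemma mul_polyE (f g : nat -> nat -> ncpoly) (X Y : 'M[A]_2) :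
  (forall i j : 'I_2, ev (f i j) = X i j) -> (forall i j : 'I_2, ev (g i j) = Y i j) ->
  forall i j : 'I_2, ev (mul_poly f g i j) = (X *m Y) i j.
Proof.
move=> fX gY i j; rewrite mxE !big_ord_recl big_ord0 addr0 /mul_poly /sum2 peval_cat.
by rewrite !peval_wprod_mul // -!fX -!gY.
Qed.

Lemma trace_polyE (f : nat -> nat -> ncpoly) (X : 'M[A]_2) :
  (forall i j : 'I_2, ev (f i j) = X i j) -> ev (trace_poly f) = qtrace q X.
Proof.
move=> fX; rewrite peval_cat peval_scale // mul1r /qtrace.
by rewrite -!fX.
Qed.

Lemma inv_polyE g : ev (inv_poly g) = inv_elt q M g.
Proof.
by case: g; apply: trace_polyE;
  do ?[exact: (entry_polyE 0) | exact: (entry_polyE 1) | exact: (entry_polyE 2)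
      | apply: mul_polyE].
Qed.

Lemma inv_normalE g : ev (inv_normal g) = inv_elt q M g.
Proof. by rewrite /inv_normal (wprod_pnf q_neq0 20 _ pg_rule) inv_polyE. Qed.

Lemma inv_elt_rels r : inv_rels q (inv_elt q M) r -> r = 0.
Proof.
have sound p : pnf pbw_rule 20 p = [::] -> ev p = 0 by exact: pnf_eq0 pg_rule _.
case=> [[z [y [zc ->]]]|].
  rewrite -!inv_normalE -!peval_wprod_mul // -peval_sub //; apply: sound.
  move: zc; rewrite !inE.
  by case/or4P=> /eqP-> {z}; case: y; vm_compute.
rewrite -!inv_normalE !inE => /or4P[] /eqP->.
- rewrite -FE_polyE; apply: sound; by vm_compute.
- rewrite -GE_polyE; apply: sound; by vm_compute.
- rewrite -GF_polyE; apply: sound; by vm_compute.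
- rewrite -EFG_polyE; apply: sound; by vm_compute.
Qed.

End Relations.

(** * Spanning of the free algebra modulo the relations *)

Definition inv_rank (g : inv_gen) : nat :=
  match g with gE => 0 | gF => 1 | gG => 2 | gs => 3 | gt => 4 | gu => 5 | gv => 6 end.
Definition is_central (g : inv_gen) : bool := (2 < inv_rank g)%N.

Lemma inv_gen_eqE (g g' : inv_gen) : (g == g') = (inv_rank g == inv_rank g').
Proof. by apply/eqP/eqP => [->//|]; case: g; case: g'. Qed.

Lemma central_mem g : is_central g -> g \in [:: gs; gt; gu; gv].
Proof. by case: g => // _; rewrite !inE !inv_gen_eqE. Qed.

Definition inv_word (i : inv_exp) : seq inv_gen :=
  let: ((m, n, l), (a, b, c, d)) := i in
  nseq m gE ++ nseq n gF ++ nseq l gG ++ nseq a gs ++ nseq b gt ++ nseq c gu ++ nseq d gv.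

Definition word_exp (w : seq inv_gen) : inv_exp :=
  ((count_mem gE w, count_mem gF w, count_mem gG w),
   (count_mem gs w, count_mem gt w, count_mem gu w, count_mem gv w)).

Lemma perm_word_exp w : perm_eq w (inv_word (word_exp w)).
Proof.
apply/allP => g _ /=; rewrite !count_cat !count_nseq /= !inv_gen_eqE.
by case: g; rewrite /= !(mul0n, mul1n, add0n, addn0).
Qed.

Lemma prod_nseq (R : pzSemiRingType) (X : Type) (f : X -> R) n x :
  \prod_(y <- nseq n x) f y = f x ^+ n.
Proof. by elim: n => [|n IH]; rewrite ?big_nil ?big_cons ?exprS ?IH // expr0. Qed.

Section Spanning.
Variables (C : numClosedFieldType) (q : C).
Hypothesis q_neq0 : q != 0.
Local Notation FA := (freealg C inv_gen).
Local Notation J := (in_ideal (inv_rels q (@freevar C inv_gen))).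

Definition free_word (w : seq inv_gen) : FA := \prod_(x <- w) freevar C x.
Local Notation fw := free_word.

Definition ok_span (p : FA) : Prop := exists2 l : seq (C * inv_exp),
  all (fun t => inv_exp_ok t.2) l & J (p - \sum_(t <- l) t.1 *: fw (inv_word t.2)).

Lemma ok_span_ideal p : J p -> ok_span p.
Proof. by exists [::]; rewrite // big_nil subr0. Qed.

Lemma ok_spanD p p' : ok_span p -> ok_span p' -> ok_span (p + p').
Proof.
move=> [l lok Jl] [l' lok' Jl']; exists (l ++ l'); first by rewrite all_cat lok.
by rewrite big_cat opprD addrACA; apply: in_idealD.
Qed.

Lemma ok_spanZ c p : ok_span p -> ok_span (c *: p).
Proof.
move=> [l lok Jl]; exists [seq (c * t.1, t.2) | t <- l]; first by rewrite all_map.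
rewrite big_map /= (eq_bigr (fun t => c *: (t.1 *: fw (inv_word t.2)))).
  by rewrite -scaler_sumr -scalerBr; apply: in_idealZ.
by move=> t _; rewrite scalerA.
Qed.

Lemma ok_spanN p : ok_span p -> ok_span (- p).
Proof. by move/(ok_spanZ (-1)); rewrite scaleN1r. Qed.

Lemma ok_spanB p p' : ok_span p -> ok_span p' -> ok_span (p - p').
Proof. by move=> sp /ok_spanN; apply: ok_spanD. Qed.

Lemma ok_span_exchange p p' : ok_span (p - p') -> ok_span p <-> ok_span p'.
Proof.
move=> s; split=> [sp|sp']; last by rewrite -(subrK p' p); apply: ok_spanD.
by rewrite -(subKr p p'); apply: ok_spanB.
Qed.

Lemma ok_spanZ_iff c p : c != 0 -> ok_span (c *: p) <-> ok_span p.
Proof.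
move=> c0; split; last exact: ok_spanZ.
by move/(ok_spanZ c^-1); rewrite scalerA mulVf // scale1r.
Qed.

Lemma free_word_cat u v : fw (u ++ v) = fw u * fw v.
Proof. exact: big_cat. Qed.

Lemma free_word1 x : fw [:: x] = freevar C x.
Proof. exact: big_seq1. Qed.

Definition ctx u v (p : FA) : FA := fw u * p * fw v.

Lemma ctxD u v p p' : ctx u v (p + p') = ctx u v p + ctx u v p'.
Proof. by rewrite /ctx mulrDr mulrDl. Qed.
Lemma ctxZ u v c p : ctx u v (c *: p) = c *: ctx u v p.
Proof. by rewrite /ctx malg_scalerAr -scalerAl. Qed.
Lemma ctxN u v p : ctx u v (- p) = - ctx u v p.
Proof. by rewrite -scaleN1r ctxZ scaleN1r. Qed.
Lemma ctx_word u v w : ctx u v (fw w) = fw (u ++ w ++ v).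
Proof. by rewrite /ctx !free_word_cat mulrA. Qed.

Lemma ctx_rel u v r : inv_rels q (@freevar C inv_gen) r -> ok_span (ctx u v r).
Proof.
move=> rr; apply/ok_span_ideal/in_idealMr/in_idealMl; exact: in_ideal_rel.
Qed.

(** The number of letters E, F, G. It is the induction parameter: every correction term in the
    relations has fewer of them than the product it corrects. *)
Definition ncentral (w : seq inv_gen) : nat := count (predC is_central) w.

Lemma word2 x y : freevar C x * freevar C y = fw [:: x; y].
Proof. by rewrite /fw !big_cons big_nil mulr1. Qed.

Lemma word3 x y z : freevar C x * freevar C y * freevar C z = fw [:: x; y; z].
Proof. by rewrite word2 -free_word1 -free_word_cat. Qed.

Lemma word4 x y z t :
  freevar C x * freevar C y * freevar C z * freevar C t = fw [:: x; y; z; t].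
Proof. by rewrite -[[:: x; y; z; t]]/([:: x; y; z] ++ [:: t]) free_word_cat free_word1 -word3. Qed.

Local Notation fv := (@freevar C inv_gen).

Lemma sub_scale1 (V : lmodType C) (a b : V) : a - (1 *: b + 0) = a - b.
Proof. by rewrite scale1r addr0. Qed.

Section Step.
Variable k : nat.
Hypothesis IH : forall w, (ncentral w < k)%N -> ok_span (fw w).

Lemma ctx_low u v w : (ncentral (u ++ w ++ v) < k)%N -> ok_span (ctx u v (fw w)).
Proof. by rewrite ctx_word; apply: IH. Qed.

Lemma ok_span_swap_rel u v x y c p :
  inv_rels q (@freevar C inv_gen)
    (freevar C x * freevar C y - (c *: (freevar C y * freevar C x) + p)) ->
  c != 0 -> ok_span (ctx u v p) ->
  ok_span (fw (u ++ [:: x; y] ++ v)) <-> ok_span (fw (u ++ [:: y; x] ++ v)).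
Proof.
move=> rr c0 sp; rewrite -(ok_spanZ_iff (fw (u ++ [:: y; x] ++ v)) c0).
apply: ok_span_exchange; have := ctx_rel u v rr.
rewrite !word2 ctxD ctxN ctxD ctxZ !ctx_word opprD addrA => s.
by rewrite -[X in ok_span X](subrK (ctx u v p)); apply: ok_spanD.
Qed.

(** Neighbouring letters commute up to a scalar and terms with fewer letters E, F, G. The scalar is
    invertible, so each relation can be used in both directions. *)
Lemma ok_span_swap u v x y : (ncentral (u ++ [:: x; y] ++ v) <= k)%N ->
  ok_span (fw (u ++ [:: x; y] ++ v)) -> ok_span (fw (u ++ [:: y; x] ++ v)).
Proof.
move=> lek.
have q2 : q ^+ 2 != 0 by rewrite expf_neq0.
have q2' : q ^- 2 != 0 by rewrite invr_neq0.
have low w : (ncentral w).+1 = ncentral [:: x; y] \/ (ncentral w).+2 = ncentral [:: x; y] ->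
    ok_span (ctx u v (fw w)).
  move=> E; apply: ctx_low; move: lek; rewrite /ncentral !count_cat -!/(ncentral _).
  by case: E => <-; rewrite ?(addnS, addSn) => // /ltnW.
pose lp p := ok_span (ctx u v p).
have lpD p p' : lp p -> lp p' -> lp (p + p') by rewrite /lp ctxD; apply: ok_spanD.
have lpN p : lp p -> lp (- p) by rewrite /lp ctxN; apply: ok_spanN.
have lpZ e p : lp p -> lp (e *: p) by rewrite /lp ctxZ; apply: ok_spanZ.
have low1 z : (ncentral [:: z]).+1 = ncentral [:: x; y] -> lp (fv z).
  by rewrite /lp -free_word1 => E; apply: low; left.
have low2 z t : (ncentral [:: z; t]).+2 = ncentral [:: x; y] -> lp (fv z * fv t).
  by rewrite /lp word2 => E; apply: low; right.
have FE : (x, y) = (gF, gE) \/ (y, x) = (gF, gE) ->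
  ok_span (fw (u ++ [:: gF; gE] ++ v)) <-> ok_span (fw (u ++ [:: gE; gF] ++ v)).
  move=> xy; apply: (ok_span_swap_rel (c := q ^+ 2) (p := (q ^+ 2 - q ^- 2) *: fv gG +
    (1 - q ^+ 2) *: (fv gs * fv gv + fv gt * fv gu))) => //.
    by rewrite addrA; right; rewrite in_cons eqxx.
  by apply: (lpD); apply: lpZ; [apply: low1 | apply: (lpD); apply: low2];
    case: xy => -[-> ->].
have GE : (x, y) = (gG, gE) \/ (y, x) = (gG, gE) ->
  ok_span (fw (u ++ [:: gG; gE] ++ v)) <-> ok_span (fw (u ++ [:: gE; gG] ++ v)).
  move=> xy; apply: (ok_span_swap_rel (c := q ^- 2)
    (p := - ((q ^- 2 * (q ^+ 2 - q ^- 2)) *: fv gF) +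
    (1 - q ^- 2) *: (fv gs * fv gu + fv gt * fv gv))) => //.
    rewrite addrA; right; rewrite in_cons; apply/orP; right; rewrite in_cons.
    by apply/orP; left; apply: eqxx.
  by apply: (lpD); [apply: lpN; apply: lpZ; apply: low1 | apply: lpZ; apply: (lpD); apply: low2];
    case: xy => -[-> ->].
have GF : (x, y) = (gG, gF) \/ (y, x) = (gG, gF) ->
  ok_span (fw (u ++ [:: gG; gF] ++ v)) <-> ok_span (fw (u ++ [:: gF; gG] ++ v)).
  move=> xy; apply: (ok_span_swap_rel (c := q ^+ 2) (p := (q ^+ 2 - q ^- 2) *: fv gE +
    (1 - q ^+ 2) *: (fv gs * fv gt + fv gu * fv gv))) => //.
    rewrite addrA; right; rewrite in_cons; apply/orP; right; rewrite in_cons.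
    by apply/orP; right; rewrite in_cons; apply/orP; left; apply: eqxx.
  by apply: (lpD); apply: lpZ; [apply: low1 | apply: (lpD); apply: low2];
    case: xy => -[-> ->].
have central z t : is_central z ->
  ok_span (fw (u ++ [:: z; t] ++ v)) <-> ok_span (fw (u ++ [:: t; z] ++ v)).
  move=> cz; apply: (ok_span_swap_rel (c := 1) (p := 0)); rewrite ?oner_eq0 //.
    left; exists z, t; split; first exact: central_mem.
    exact: sub_scale1.
  by rewrite /ctx mulr0 mul0r; apply/ok_span_ideal/in_ideal0.
case cx: (is_central x); first by move/(central _ _ cx).
case cy: (is_central y); first by move/(central _ _ cy).
move: cx cy FE GE GF {lek low low1 low2}.
case: x => // _; case: y => // _ FE GE GF //.
- by move/FE => H; apply: H; right.
- by move/GE => H; apply: H; right.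
- by move=> s; apply/FE => //; left.
- by move/GF => H; apply: H; right.
- by move=> s; apply/GE => //; left.
- by move=> s; apply/GF => //; left.
Qed.

Lemma ok_span_perm w w' u : perm_eq w w' -> (ncentral (u ++ w) <= k)%N ->
  ok_span (fw (u ++ w)) -> ok_span (fw (u ++ w')).
Proof.
elim: w' w u => [|x w' IHw] w u; first by move=> /perm_nilP ->.
move=> pw; have xw : x \in w by rewrite (perm_mem pw) mem_head.
case/splitPr: xw pw => a b pw lek sw.
have pab : perm_eq (a ++ b) w' by
    rewrite -(perm_cons x); apply: perm_trans pw; rewrite -cat1s perm_catCA.
rewrite -cat_rcons; apply: (IHw (a ++ b)) => //.
  rewrite cat_rcons; apply: leq_trans lek; rewrite /ncentral !count_cat /= count_cat.
  by rewrite (addnCA (count _ a)).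
rewrite cat_rcons {pw pab}; elim/last_ind: a b lek sw => [//|a y IHa] b lek sw.
have E : u ++ rcons a y ++ x :: b = (u ++ a) ++ [:: y; x] ++ b.
  by rewrite -!catA cat_rcons.
rewrite cat_rcons; apply: IHa.
  by apply: leq_trans lek; rewrite E /ncentral !count_cat /=; lia.
have := ok_span_swap (u := u ++ a) (v := b) (x := y) (y := x).
by rewrite -E => H; have := H lek sw; rewrite -!catA.
Qed.

End Step.

(** The order of the letters matters only up to terms covered by induction. A word containing all of
    E, F, G can thus be made to begin with E F G, and the last relation replaces this prefix by
    terms with at most two such letters. *)
Lemma ok_span_word w : ok_span (fw w).
Proof.
have [k] := ubnP (ncentral w); elim: k w => // k IHk w; rewrite ltnS => lek.
have IH w' : (ncentral w' < ncentral w)%N -> ok_span (fw w').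
  by move=> lt; apply: IHk; apply: leq_trans lt lek.
have perm w' : perm_eq w' w -> ok_span (fw w') -> ok_span (fw w).
  move=> pw; apply: (ok_span_perm IH (u := [::])) => //=.
  by rewrite /ncentral (permP pw).
have pw := perm_word_exp w; case Ei: (word_exp w) pw => [[[m n] l] [[[a b] c] d]] pw.
rewrite perm_sym in pw.
case ok: (inv_exp_ok ((m, n, l), (a, b, c, d))).
  apply: (perm _ pw); exists [:: (1, ((m, n, l), (a, b, c, d)))]; first by rewrite all_seq1.
  by rewrite big_seq1 scale1r subrr; apply: in_ideal0.
case: m n l ok pw {Ei} => [|m] [|n] [|l] //= _ pw.
pose w' := inv_word ((m, n, l), (a, b, c, d)).
have pw' : perm_eq ([:: gE; gF; gG] ++ w') w.
  rewrite -(permPr pw) /w'; apply/permP => P /=.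
  by do 3!rewrite ?count_cat /=; lia.
apply: (perm _ pw').
have nw z : (ncentral z < 3)%N -> ok_span (fw (z ++ w')).
  move=> lt; apply: IH; rewrite /ncentral -(permP pw' (predC is_central)).
  by rewrite !count_cat ltn_add2r.
pose lp p := ok_span (ctx [::] w' p).
have lpD p p' : lp p -> lp p' -> lp (p + p') by rewrite /lp ctxD; apply: ok_spanD.
have lpN p : lp p -> lp (- p) by rewrite /lp ctxN; apply: ok_spanN.
have lpZ e p : lp p -> lp (e *: p) by rewrite /lp ctxZ; apply: ok_spanZ.
have lpw z : (ncentral z < 3)%N -> lp (fw z) by rewrite /lp ctx_word; apply: nw.
have lp1 : lp 1 by rewrite -[1](big_nil 1 *%R xpredT fv); apply: (lpw [::]).
have lp2 x y : lp (fv x * fv y).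
  rewrite word2; apply: lpw; rewrite /ncentral /=.
  by case: (is_central x) (is_central y) => -[].
have lpX x : lp (fv x ^+ 2) by rewrite expr2; apply: lp2.
have lp3 x y z t e : is_central x -> is_central y -> is_central z -> is_central t ->
    lp ((fv x * fv y + fv z * fv t) * fv e).
  move=> cx cy cz ct; rewrite mulrDl; apply: lpD; rewrite word3; apply: lpw;
  by rewrite /ncentral /= ?cx ?cy ?cz ?ct /=; case: (is_central e).
have lp4 x y z t : is_central x -> is_central y -> is_central z -> is_central t ->
    lp (fv x * fv y * fv z * fv t).
  move=> cx cy cz ct; have := lpw [:: x; y; z; t].
  by rewrite -word4; apply; rewrite /ncentral /= cx cy cz ct.
(* The witness is the right-hand side of the relation for E F G, found by unification; the following
   steps peel off its summands from the last to the first. *)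
have [p rr lpp] : exists2 p, inv_rels q fv (fv gE * fv gF * fv gG - p) & lp p.
  eexists; first (right; do 3!(rewrite in_cons; apply/orP; right); rewrite mem_seq1; exact: eqxx).
  apply: (lpD); last by apply: lpZ; exact: lp1.
  apply: (lpD); last by apply: lpN; exact: lp4.
  apply: (lpD); last exact: lp3.
  apply: (lpD); last by apply: lpZ; exact: lp3.
  apply: (lpD); last exact: lp3.
  apply: (lpD); last by apply: lpN; apply: lpZ;
    apply: (lpD); [apply: (lpD); [apply: (lpD)|]|]; exact: lpX.
  apply: (lpD); last by apply: lpN; exact: lpX.
  apply: (lpD); first by apply: lpN; exact: lpX.
  by apply: lpN; apply: lpZ; exact: lpX.
have := ok_spanD (ctx_rel [::] w' rr) lpp.
by rewrite -ctxD subrK (word3 gE gF gG) ctx_word.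
Qed.

Lemma ok_span_all p : ok_span p.
Proof.
rewrite (malg_sum p); elim/big_rec: _ => [|w p' _ sp'].
  exact/ok_span_ideal/in_ideal0.
apply: ok_spanD => //; apply: ok_spanZ; rewrite malg_word; exact: ok_span_word.
Qed.

End Spanning.

(** * Filtrations and leading words *)

Definition wsum (f : nat -> nat) (w : word) : nat := sumn (map f w).

Lemma wsum_cat f u v : wsum f (u ++ v) = (wsum f u + wsum f v)%N.
Proof. by rewrite /wsum map_cat sumn_cat. Qed.

Lemma wsum_nseq f n l : wsum f (nseq n l) = (f l * n)%N.
Proof. by rewrite /wsum map_nseq sumn_nseq. Qed.

Definition compatible (f : nat -> nat) : bool :=
  over_rules (fun x y r => all (fun t : term => wsum f t.1.1 <= f x + f y)%N r).

Lemma compatibleP f x y r : compatible f -> pbw_rule x y = Some r ->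
  {in r, forall t : term, (wsum f t.1.1 <= f x + f y)%N}.
Proof. by rewrite /compatible => H Er; apply/allP; apply: (over_rulesP H Er). Qed.

(* [(i, n, a)]: the block s^i d^j p^k or s^i d^j m^k with n = j + k and
   a = j + 2 k, resp. a = j, so that the weight of the block is 2 (a - n). *)
Notation bparams := (nat * nat * nat)%type.
Notation params := (bparams * bparams * bparams)%type.

Definition block_word (b : nat) (p : bparams) : word :=
  let: (i, n, a) := p in
  nseq i (4 * b)%N ++ nseq (minn a (2 * n - a)) (4 * b + 1)%N ++
  nseq (a - n) (4 * b + 2)%N ++ nseq (n - a) (4 * b + 3)%N.
Definition nword (p : params) : word :=
  block_word 0 p.1.1 ++ block_word 1 p.1.2 ++ block_word 2 p.2.

Definition s_weight (b l : nat) : nat := (l == 4 * b)%N.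
Definition n_weight (b l : nat) : nat := ((4 * b < l) && (l < 4 * b + 4))%N.
Definition a_weight (b l : nat) : nat :=
  if l == (4 * b + 1)%N then 1 else if l == (4 * b + 2)%N then 2 else 0.
Definition bparams_of (b : nat) (w : word) : bparams :=
  (wsum (s_weight b) w, wsum (n_weight b) w, wsum (a_weight b) w).
Definition params_of (w : word) : params :=
  (bparams_of 0 w, bparams_of 1 w, bparams_of 2 w).

Definition bvalid (p : bparams) : bool := (p.2 <= 2 * p.1.2)%N.
Definition valid (p : params) : bool := [&& bvalid p.1.1, bvalid p.1.2 & bvalid p.2].

Lemma wsum_count f w : {subset w <= letters} ->
  wsum f w = (\sum_(l <- letters) f l * count_mem l w)%N.
Proof.
elim: w => [|x w IH] wl; first by rewrite big1 // => l _; rewrite muln0.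
have xl : x \in letters by apply: wl; rewrite mem_head.
rewrite /wsum /= -/(wsum f w) IH; last by move=> z zw; apply: wl; rewrite in_cons zw orbT.
under [RHS]eq_bigr do rewrite mulnDr.
rewrite big_split /=; congr (_ + _)%N.
rewrite (bigD1_seq x) ?iota_uniq //= eqxx muln1 big1 ?addn0 // => l /negPf.
by rewrite eq_sym => ->; rewrite muln0.
Qed.

(* x y is not reducible: the pairs excluded besides the inversions are p m. *)
Definition normal_rel (x y : nat) : bool :=
  (x <= y)%N && ~~ ((x, y) \in [:: (2, 3); (6, 7); (10, 11)]%N).

Lemma normal_relP x y : x \in letters -> y \in letters ->
  (pbw_rule x y == None) = normal_rel x y.
Proof.
have H : all (fun x => all (fun y => (pbw_rule x y == None) == normal_rel x y)
                           letters) letters by vm_compute.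
by move=> xl yl; have := allP (allP H _ xl) _ yl => /eqP.
Qed.

Lemma irreducible_sorted w : {subset w <= letters} ->
  irreducible pbw_rule w = sorted normal_rel w.
Proof.
elim: w => // x [//|y w] IH wl.
have xl : x \in letters by apply: wl; rewrite mem_head.
have yl : y \in letters by apply: wl; rewrite !in_cons eqxx orbT.
rewrite irreducible_cons2 IH /=; last by move=> z zw; apply: wl; rewrite in_cons zw orbT.
by rewrite -normal_relP //; case: (pbw_rule x y).
Qed.

Lemma sorted_nseq_cat (e : rel nat) n x s : e x x -> (n == 0)%N || all (e x) s ->
  sorted e s -> sorted e (nseq n x ++ s).
Proof.
move=> exx; elim: n => [//|n IH] /= xs ss.
case: n IH => [|n] IH /=; last by rewrite exx; apply: IH => //; rewrite xs.
by case: s xs ss {IH} => //= y s /andP[-> _].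
Qed.

Lemma all_nseqP (P : pred nat) n x s :
  (n == 0)%N || P x -> all P s -> all P (nseq n x ++ s).
Proof. by rewrite all_cat all_nseq => -> ->. Qed.

Lemma nword_letters p : {subset nword p <= letters}.
Proof.
apply/allP; case: p => [[[[i1 n1] a1] [[i2 n2] a2]] [[i3 n3] a3]].
rewrite /nword /block_word -!catA; do !(apply: all_nseqP; first by rewrite orbT).
by rewrite all_nseq orbT.
Qed.

Lemma nword_irreducible p : irreducible pbw_rule (nword p).
Proof.
rewrite irreducible_sorted; last exact: nword_letters.
case: p => [[[[i1 n1] a1] [[i2 n2] a2]] [[i3 n3] a3]].
have tri n a : (a - n == 0)%N || (n - a == 0)%N by lia.
rewrite /nword /block_word -!catA -[nseq (n3 - a3) _]cats0.
case/orP: (tri n1 a1) => E1; case/orP: (tri n2 a2) => E2; case/orP: (tri n3 a3) => E3;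
  do 12 (apply: sorted_nseq_cat; [by [] | first [ by rewrite E1 | by rewrite E2
    | by rewrite E3 | by apply/orP; right; do ?(apply: all_nseqP; [
        first [by rewrite orbT | by rewrite E1 | by rewrite E2 | by rewrite E3] | ]) ] | ]);
  by [].
Qed.

Lemma params_of_nword p : valid p -> params_of (nword p) = p.
Proof.
case: p => [[[[i1 n1] a1] [[i2 n2] a2]] [[i3 n3] a3]] /and3P[/= v1 v2 v3].
rewrite /bvalid /= in v1 v2 v3.
rewrite /params_of /bparams_of /nword /block_word !wsum_cat !wsum_nseq.
do ![let v := fresh in set v := s_weight _ _; vm_compute in v; subst v].
do ![let v := fresh in set v := n_weight _ _; vm_compute in v; subst v].
do ![let v := fresh in set v := a_weight _ _; vm_compute in v; subst v].
congr (_, _, _, (_, _, _), (_, _, _)); lia.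
Qed.

Lemma count_mem_nseq n (x y : nat) : count_mem x (nseq n y) = ((y == x) * n)%N.
Proof. by rewrite count_nseq. Qed.

(** Both words are sorted for the order of the letters, so it is enough to compare multiplicities.
    These are recovered from the three weights of a block because p and m do not both occur in
    it. *)
Lemma irreducible_nword w : {subset w <= letters} -> irreducible pbw_rule w ->
  w = nword (params_of w).
Proof.
move=> wl; rewrite irreducible_sorted // => sw.
have tr : transitive normal_rel.
  move=> y x z; rewrite /normal_rel => /andP[xy nxy] /andP[yz nyz].
  rewrite (leq_trans xy yz) /=; apply: contra nxy; rewrite !inE => nxz.
  move: nyz; rewrite !inE !xpair_eqE; move: nxz; rewrite !xpair_eqE; lia.
have pw := sw; rewrite sorted_pairwise // in pw.
have no b : (b < 3)%N -> (count_mem (4 * b + 2) w == 0)%N || (count_mem (4 * b + 3) w == 0)%N.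
  move=> b3; rewrite -![(_ == 0)%N]leqn0 ![(_ <= 0)%N]leqNgt -!has_count !has_pred1.
  rewrite -negb_and; apply/negP => /andP[w2 w3].
  have nr : normal_rel (4 * b + 2) (4 * b + 3) = false.
    by case: b b3 {w2 w3} => [|[|[|]]].
  case/splitPr: w2 sw w3 {wl pw} => u v sw.
  have := sw; rewrite sorted_pairwise // pairwise_cat /= => /and4P[/allrelP auv _ xv _].
  rewrite mem_cat in_cons => /or3P[w3|/eqP|w3]; last by move/allP: xv => /(_ _ w3); rewrite nr.
    have := auv _ _ w3 (mem_head _ _); rewrite /normal_rel; lia.
  lia.
apply: (sorted_eq leq_trans anti_leq).
- by apply: sub_sorted sw => x y /andP[].
- have := nword_irreducible (params_of w); rewrite irreducible_sorted; last exact: nword_letters.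
  by apply: sub_sorted => x y /andP[].
apply/allP => l; rewrite mem_cat => lw; apply/eqP.
have {lw}ll : l \in letters by case/orP: lw => [/wl|/nword_letters].
have mul01 := (mul0n, mul1n, add0n, addn0).
have Ew b : (b < 3)%N -> block_word b (bparams_of b w) =
    nseq (count_mem (4 * b)%N w) (4 * b)%N ++
    nseq (count_mem (4 * b + 1)%N w) (4 * b + 1)%N ++
    nseq (count_mem (4 * b + 2)%N w) (4 * b + 2)%N ++
    nseq (count_mem (4 * b + 3)%N w) (4 * b + 3)%N.
  move=> b3; have noc := no b b3.
  have -> : bparams_of b w = (count_mem (4 * b)%N w,
      count_mem (4 * b + 1)%N w + (count_mem (4 * b + 2)%N w + count_mem (4 * b + 3)%N w),
      count_mem (4 * b + 1)%N w + 2 * count_mem (4 * b + 2)%N w)%N.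
    rewrite /bparams_of !wsum_count // /letters /= !big_cons !big_nil {noc}.
    case: b b3 => [|[|[|]]] // _;
    do ![let v := fresh in set v := s_weight _ _; vm_compute in v; subst v];
    do ![let v := fresh in set v := n_weight _ _; vm_compute in v; subst v];
    do ![let v := fresh in set v := a_weight _ _; vm_compute in v; subst v];
    by rewrite !mul01.
  by rewrite /block_word; congr (_ ++ nseq _ _ ++ nseq _ _ ++ nseq _ _); lia.
rewrite /nword !Ew // !count_cat !count_mem_nseq.
move: ll; rewrite mem_letters.
case: l => [|[|[|[|[|[|[|[|[|[|[|[|]]]]]]]]]]]] // _;
  do ![let v := fresh in set v := (_ == _ :> nat); vm_compute in v; subst v];
  by rewrite !mul01.
Qed.

(* [Dweight] is a filtration of the algebra for which the three matrices
   q-commute in the associated graded algebra: in A it favours p, in C it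
   favours m, and it does not distinguish the letters d, p, m of B. *)
Definition Nweight (l : nat) : nat := ~~ (4 %| l)%N.
Definition Dweight (l : nat) : nat := nth 0%N [:: 0; 1; 2; 0; 0; 2; 2; 2; 0; 1; 0; 2]%N l.

Lemma Nweight_compatible : compatible Nweight. Proof. by vm_compute. Qed.
Lemma Dweight_compatible : compatible Dweight. Proof. by vm_compute. Qed.

(* Words over these letters, which exclude d, m in A and d, p in C, have a
   unique leading normal word. *)
Definition lead_letters : seq nat := [:: 0; 2; 4; 5; 6; 7; 8; 11]%N.

Definition lead_term (x y : nat) (t : term) : bool :=
  wsum Dweight t.1.1 == (Dweight x + Dweight y)%N.

(** At the top weight a rule has a single term, with an invertible coefficient, and it preserves the
    block parameters; for instance p m in the middle block leads to d d. *)
Lemma lead_rule x y r : pbw_rule x y = Some r -> x \in lead_letters -> y \in lead_letters ->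
  exists t, [/\ filter (lead_term x y) r = [:: t], t.2 = 1 \/ t.2 = -1,
    {subset t.1.1 <= lead_letters} & params_of t.1.1 = params_of [:: x; y]].
Proof.
pose P x y (r : ncpoly) := (x \in lead_letters) && (y \in lead_letters) ==>
  if filter (lead_term x y) r is [:: t] then
    [&& (t.2 == 1) || (t.2 == -1), all (mem lead_letters) t.1.1 &
        params_of t.1.1 == params_of [:: x; y]]
  else false.
have H : over_rules P by vm_compute.
move=> /(over_rulesP H); rewrite /P => + xl yl; rewrite xl yl /=.
case: (filter _ _) => [|t [|]] // /and3P[t2 /allP tl /eqP tp].
by exists t; split=> //; case/orP: t2 => /eqP->; [left | right].
Qed.

(** * Filtrations of the sphere algebra *)

Section Filtration.
Variables (C : numClosedFieldType) (q : C).
Hypothesis q_neq0 : q != 0.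
Variables (A : algType C) (M : 'I_3 -> 'M[A]_2).
Hypothesis A_presented : is_sphere_algebra q M.
Local Notation W := {malg C[word]}.
Local Notation NF := (normal_form pbw_rule q).
Local Notation pg := (letter_elt q M).
Local Notation pw := (wprod pg).
Local Notation wcoord := (wcoord A_presented).

Lemma wcoord_word w : {subset w <= letters} -> wcoord (pw w) = NF w.
Proof. exact: (wcoord_wprod q_neq0). Qed.

(** The inequality is strict: weight at most d is [fil f d.+1], and [fil f 0] contains only 0, which
    is where inductions on the filtration start. *)
Variant fil (f : nat -> nat) (d : nat) (z : A) : Prop :=
  Fil of forall w, (wcoord z)@_w != 0 -> (wsum f w < d)%N.

Lemma fil_lt f d z w : fil f d z -> (wcoord z)@_w != 0 -> (wsum f w < d)%N.
Proof. by case=> fz /fz. Qed.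

Section Weight.
Variable f : nat -> nat.
Hypothesis f_compat : compatible f.

Lemma wsum_nf n w : {in nf pbw_rule n w, forall t : term, (wsum f t.1.1 <= wsum f w)%N}.
Proof.
apply: (nf_closed (Q := fun z => (wsum f z <= wsum f w)%N)) => // u x y v r Er le t tr.
have le_t := compatibleP f_compat Er tr.
apply: leq_trans le; rewrite !wsum_cat leq_add2l.
by rewrite [wsum f [:: x, y & v]]/wsum /= addnA leq_add2r.
Qed.

Lemma fil_word w d : {subset w <= letters} -> (wsum f w < d)%N -> fil f d (pw w).
Proof.
move=> wl lt; split=> z; rewrite wcoord_word // => /normal_form_supp[t tn ->].
exact: leq_ltn_trans (wsum_nf tn) lt.
Qed.

Lemma fil0 d : fil f d 0.
Proof. by split=> w; rewrite wcoord0 // mcoeff0 eqxx. Qed.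

Lemma fil_lin d c z z' : fil f d z -> fil f d z' -> fil f d (c *: z + z').
Proof.
move=> [fz] [fz']; split=> w; rewrite wcoord_is_linear // mcoeffD mcoeffZ.
have [->|/fz //] := eqVneq (wcoord z)@_w 0; rewrite mulr0 add0r; exact: fz'.
Qed.

Lemma filZ d c z : fil f d z -> fil f d (c *: z).
Proof. by move=> fz; rewrite -[_ *: _]addr0; apply: fil_lin (fil0 d). Qed.

Lemma filD d z z' : fil f d z -> fil f d z' -> fil f d (z + z').
Proof. by rewrite -{2}[z]scale1r; apply: fil_lin. Qed.

Lemma filB d z z' : fil f d z -> fil f d z' -> fil f d (z - z').
Proof. by move=> fz fz'; rewrite -scaleN1r addrC; apply: fil_lin. Qed.

Lemma fil_sum d (I : eqType) (s : seq I) (c : I -> C) (g : I -> A) :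
  {in s, forall i, fil f d (g i)} -> fil f d (\sum_(i <- s) c i *: g i).
Proof.
move=> fg; rewrite big_seq; elim/big_rec: _ => [|i z /fg fi fz]; first exact: fil0.
exact: fil_lin.
Qed.

Lemma fil_le d d' z : (d <= d')%N -> fil f d z -> fil f d' z.
Proof. by move=> le [fz]; split=> w /fz lt; apply: leq_trans lt le. Qed.

(** The predecessor reflects the strict bounds: weights at most d - 1 and d' - 1 add up to at most d
    + d' - 2. *)
Lemma filMgen d d' z z' : fil f d z -> fil f d' z' -> fil f (d + d').-1 (z * z').
Proof.
move=> fz fz'.
have Ez := wcoord_sum q_neq0 A_presented z; have Ez' := wcoord_sum q_neq0 A_presented z'.
rewrite Ez Ez' /mlin mulr_suml.
under eq_bigr do rewrite -scalerAl.
apply: fil_sum => w wz; rewrite mulr_sumr.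
under eq_bigr do rewrite -scalerAr -wprod_cat.
apply: fil_sum => w' wz'.
have wd : (wsum f w < d)%N by apply: (fil_lt fz); rewrite mcoeff_neq0.
have wd' : (wsum f w' < d')%N by apply: (fil_lt fz'); rewrite mcoeff_neq0.
apply: fil_word; last by rewrite wsum_cat; lia.
rewrite -mcoeff_neq0 in wz; rewrite -mcoeff_neq0 in wz' => l.
rewrite mem_cat => /orP[].
  exact: (wcoord_normal q_neq0 wz).2.
exact: (wcoord_normal q_neq0 wz').2.
Qed.

End Weight.

Definition lead (z : A) (w : word) : Prop :=
  exists2 c : C, c != 0 & fil Dweight (wsum Dweight w) (z - c *: pw w).

Lemma lead_fil z w : {subset w <= letters} -> lead z w ->
  fil Dweight (wsum Dweight w).+1 z.
Proof.
move=> wl [c _ fz]; rewrite -(subrK (c *: pw w) z).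
apply: filD; first by apply: fil_le fz.
by apply: filZ; apply: fil_word => //; apply: Dweight_compatible.
Qed.

Lemma leadM z z' w w' : {subset w <= letters} -> {subset w' <= letters} ->
  lead z w -> lead z' w' -> lead (z * z') (w ++ w').
Proof.
move=> wl wl' lz lz'; have fz := lead_fil wl lz.
case: lz lz' => c c0 Fz [c' c'0 Fz'].
exists (c * c'); first exact: mulf_neq0.
rewrite wprod_cat wsum_cat.
have -> : z * z' - (c * c') *: (pw w * pw w') =
  z * (z' - c' *: pw w') + (z - c *: pw w) * (c' *: pw w').
  by rewrite mulrBr mulrBl addrA subrK -!scalerAl -!scalerAr !scalerA.
apply: filD.
  by have := filMgen Dweight_compatible fz Fz'; rewrite addSn.
have Fw' : fil Dweight (wsum Dweight w').+1 (c' *: pw w').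
  by apply: filZ; apply: fil_word => //; apply: Dweight_compatible.
by have := filMgen Dweight_compatible Fz Fw'; rewrite addnS.
Qed.

Lemma lead_trans z w w' : wsum Dweight w = wsum Dweight w' ->
  lead z w -> lead (pw w) w' -> lead z w'.
Proof.
move=> E [c c0 Fz] [c' c'0 Fw]; exists (c * c'); first exact: mulf_neq0.
have -> : z - (c * c') *: pw w' = c *: (pw w - c' *: pw w') + (z - c *: pw w).
  by rewrite scalerBr scalerA [RHS]addrC addrA subrK.
by rewrite -E in Fw *; apply: fil_lin.
Qed.

Lemma lead_refl w : lead (pw w) w.
Proof. by exists 1; rewrite ?oner_neq0 // scale1r subrr; apply: fil0. Qed.

Lemma lead_letters_sub (w : word) : {subset w <= lead_letters} -> {subset w <= letters}.
Proof.
move=> wl l /wl; have /allP : all (fun l => l \in letters) lead_letters by vm_compute.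
exact.
Qed.

(** At the top weight reduction never branches, and each step keeps the block parameters. So the
    leading normal word can be read off from the letters of [w]. *)
Lemma lead_normal (w : word) : {subset w <= lead_letters} ->
  lead (pw w) (nword (params_of w)) /\ wsum Dweight w = wsum Dweight (nword (params_of w)).
Proof.
have [n] := ubnP (wval w); elim: n w => // n IH w; rewrite ltnS => len wl.
case: (redexP pbw_rule w) => [u x y r v Ew Er _|I]; last first.
  rewrite -(irreducible_nword (lead_letters_sub wl) I); split=> //; exact: lead_refl.
subst w.
have xl : x \in lead_letters by apply: wl; rewrite mem_cat mem_head orbT.
have yl : y \in lead_letters by apply: wl; rewrite mem_cat !in_cons eqxx !orbT.
have [t [Ef tc tl tp]] := lead_rule Er xl yl.
have : t \in filter (lead_term x y) r by rewrite Ef mem_head.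
rewrite mem_filter => /andP[/eqP tD tr].
have Eu f : wsum f (u ++ [:: x, y & v]) = (wsum f u + (wsum f [:: x; y] + wsum f v))%N.
  by rewrite wsum_cat -[[:: x, y & v]]/([:: x; y] ++ v) wsum_cat.
have wl' : {subset u ++ t.1.1 ++ v <= lead_letters}.
  move=> l; rewrite !mem_cat => /or3P[lu|/tl //|lv]; apply: wl.
    by rewrite mem_cat lu.
  by rewrite mem_cat !in_cons lv !orbT.
have Ep : params_of (u ++ t.1.1 ++ v) = params_of (u ++ [:: x, y & v]).
  move: tp; rewrite /params_of /bparams_of !Eu !wsum_cat => -[-> -> -> -> -> -> -> -> ->].
  by [].
have ED : wsum Dweight (u ++ t.1.1 ++ v) = wsum Dweight (u ++ [:: x, y & v]).
  by rewrite Eu !wsum_cat tD /wsum /= addn0.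
have [] := IH (u ++ t.1.1 ++ v) _ wl'.
  exact: leq_trans (wval_rule pbw_decreasing u v Er tr) len.
rewrite Ep ED => lt Ew; split; last exact: Ew.
apply: (lead_trans _ _ lt); first by rewrite ED.
exists (t.2%:~R * q ^ t.1.2).
  rewrite mulf_neq0 ?expfz_neq0 //.
  by case: tc => ->; rewrite ?oner_neq0 // rmorphN1 oppr_eq0 oner_neq0.
rewrite (satisfies_wprod _ _ (letter_elt_satisfies q_neq0 A_presented) Er).
rewrite /peval (bigID (lead_term x y)) /= -big_filter Ef big_seq1 addrAC subrr add0r ED.
rewrite -big_filter; apply: fil_sum => t'; rewrite mem_filter => /andP[nt' t'r].
apply: fil_word.
- exact: Dweight_compatible.
- exact: letters_ctx Er (lead_letters_sub wl) _ t'r.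
have Exy : wsum Dweight [:: x; y] = (Dweight x + Dweight y)%N.
  by rewrite /wsum /= addn0.
rewrite wsum_cat wsum_cat Eu ltn_add2l ltn_add2r ltn_neqAle Exy.
by rewrite -/(lead_term x y t') nt' (compatibleP Dweight_compatible Er t'r).
Qed.

End Filtration.

(** * Leading words of the monomials in the invariants *)

Definition inv_lead (g : inv_gen) : word :=
  match g with
  | gE => [:: 2; 7] | gF => [:: 2; 11] | gG => [:: 6; 11]
  | gs => [:: 0] | gt => [:: 4] | gu => [:: 8] | gv => [:: 2; 5; 11]
  end%N.

Definition rep (n : nat) (w : word) : word := flatten (nseq n w).

Lemma wsum_rep f n w : wsum f (rep n w) = (n * wsum f w)%N.
Proof. by elim: n => //= n IH; rewrite /rep /= wsum_cat IH mulSn. Qed.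

Definition inv_lead_word (i : inv_exp) : word :=
  let: ((m, n, l), (a, b, c, d)) := i in
  rep m (inv_lead gE) ++ rep n (inv_lead gF) ++ rep l (inv_lead gG) ++
  rep a (inv_lead gs) ++ rep b (inv_lead gt) ++ rep c (inv_lead gu) ++
  rep d (inv_lead gv).

(* The leading normal word of E^m F^n G^l s^a t^b u^c v^d. Its top component is
   V_{2 n1} (x) V_{2 n2} (x) V_{2 n3} with n1 = m + n + d, n2 = m + l + d,
   n3 = n + l + d, and every triple satisfying the triangle inequalities arises
   from exactly one exponent with m = 0, n = 0 or l = 0. *)
Definition inv_params (i : inv_exp) : params :=
  let: ((m, n, l), (a, b, c, d)) := i in
  ((a, m + n + d, 2 * (m + n + d)), (b, m + l + d, 2 * l + d), (c, n + l + d, 0))%N.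

Definition pdeg (p : params) : nat := (p.1.1.1.2 + p.1.2.1.2 + p.2.1.2)%N.

Lemma inv_params_valid i : valid (inv_params i).
Proof.
case: i => [[[m n] l] [[[a b] c] d]]; rewrite /valid /bvalid /=; lia.
Qed.

(** The parameters are unchanged when (m, n, l, d) becomes (m - 1, n - 1, l - 1, d + 2): E F G and
    v^2 have the same leading word. All coincidences arise in this way, and the condition on m, n, l
    rules them out. *)
Lemma inv_params_inj : {in inv_exp_ok &, injective inv_params}.
Proof.
move=> [[[m n] l] [[[a b] c] d]] [[[m' n'] l'] [[[a' b'] c'] d']].
rewrite !unfold_in /= => ok ok' [-> E1 _ -> E2 _ -> E3].
have [-> [-> [-> ->]]] : m = m' /\ n = n' /\ l = l' /\ d = d' by lia.
by [].
Qed.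

Lemma params_inv_lead i : params_of (inv_lead_word i) = inv_params i.
Proof.
case: i => [[[m n] l] [[[a b] c] d]].
rewrite /params_of /bparams_of /inv_lead_word !wsum_cat !wsum_rep /inv_lead.
do ![let v := fresh in set v := wsum _ _; vm_compute in v; subst v].
congr (_, _, _, (_, _, _), (_, _, _)); lia.
Qed.

(** The noncentral letters here are p of A, letters of B and m of C, all of the maximal weight 2. So
    monomials of equal degree have leading words of equal [Dweight]. *)
Lemma Dweight_inv_lead i : wsum Dweight (inv_lead_word i) = (2 * pdeg (inv_params i))%N.
Proof.
case: i => [[[m n] l] [[[a b] c] d]].
rewrite /inv_lead_word !wsum_cat !wsum_rep /inv_lead /pdeg /=.
do ![let v := fresh in set v := wsum _ _; vm_compute in v; subst v].
lia.
Qed.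

Lemma inv_lead_letters i : {subset inv_lead_word i <= lead_letters}.
Proof.
have rl n g : {subset rep n (inv_lead g) <= lead_letters}.
  have gl : {subset inv_lead g <= lead_letters} by apply/allP; case: g.
  by move=> l /flattenP[w /nseqP[-> _] /gl].
case: i => [[[m n] l] [[[a b] c] d]] z; rewrite /inv_lead_word !mem_cat.
by do ![case/orP]; apply: rl.
Qed.

Lemma Nweight_nword p : valid p -> wsum Nweight (nword p) = pdeg p.
Proof.
case: p => [[[[i1 n1] a1] [[i2 n2] a2]] [[i3 n3] a3]] /and3P[/= v1 v2 v3].
rewrite /bvalid /= in v1 v2 v3; rewrite /pdeg /nword /block_word !wsum_cat !wsum_nseq.
do ![let v := fresh in set v := Nweight _; vm_compute in v; subst v].
rewrite /=; lia.
Qed.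

Lemma normal_params (w : word) : {subset w <= letters} -> irreducible pbw_rule w ->
  valid (params_of w) /\ pdeg (params_of w) = wsum Nweight w.
Proof.
move=> wl I; have v : valid (params_of w).
  have le b : (wsum (a_weight b) w <= 2 * wsum (n_weight b) w)%N.
    elim: (w) => // l u IH; rewrite /wsum /= mulnDr leq_add //.
    by rewrite /a_weight /n_weight; case: eqP => [->|_]; last case: eqP => [->|_] //; lia.
  by rewrite /valid /bvalid /= !le.
by split=> //; rewrite -(Nweight_nword v) -irreducible_nword.
Qed.

Section Leading.
Variables (C : numClosedFieldType) (q : C).
Hypothesis q_neq0 : q != 0.
Variables (A : algType C) (M : 'I_3 -> 'M[A]_2).
Hypothesis A_presented : is_sphere_algebra q M.
Local Notation pg := (letter_elt q M).
Local Notation pw := (wprod pg).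
Local Notation wcoord := (wcoord A_presented).
Local Notation fil := (fil A_presented).
Local Notation lead := (lead A_presented).
Local Notation x := (inv_elt q M).

Lemma lead_peval p t : all (fun t => all (fun l => l \in letters) t.1.1) p ->
  filter (fun t' => wsum Dweight t.1.1 <= wsum Dweight t'.1.1)%N p = [:: t] ->
  t.2 = 1 -> lead (peval q pw p) t.1.1.
Proof.
move=> pl Ef t2; exists (t.2%:~R * q ^ t.1.2).
  by rewrite mulf_neq0 ?expfz_neq0 // t2 oner_neq0.
rewrite /peval (bigID (fun t' => wsum Dweight t.1.1 <= wsum Dweight t'.1.1)%N) /=.
rewrite -big_filter Ef big_seq1 addrAC subrr add0r -big_filter.
apply: fil_sum => // t'; rewrite mem_filter -ltnNge => /andP[lt t'p].
apply: (fil_word q_neq0 A_presented Dweight_compatible) => //.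
exact/allP/(allP pl).
Qed.

Lemma inv_elt_lead g : lead (x g) (inv_lead g).
Proof.
rewrite -(inv_normalE q_neq0 A_presented).
pose top t := (wsum Dweight (inv_lead g) <= wsum Dweight t.1.1)%N.
have [/= t [Et Ef t2 pl]] : exists t : term, [/\ t.1.1 = inv_lead g,
    filter (fun t' => wsum Dweight (inv_lead g) <= wsum Dweight t'.1.1)%N (inv_normal g) = [:: t],
    t.2 = 1 & all (fun t => all (fun l => l \in letters) t.1.1) (inv_normal g)].
  exists (head (([::], 0), 0)
    [seq t' <- inv_normal g | (wsum Dweight (inv_lead g) <= wsum Dweight t'.1.1)%N]).
  by case: g {top}; split; vm_compute.
by rewrite -Et; apply: lead_peval => //; rewrite Et.
Qed.

Lemma inv_elt_fil g : fil Nweight (wsum Nweight (inv_lead g)).+1 (x g).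
Proof.
rewrite -(inv_normalE q_neq0 A_presented).
have pl : all (fun t : term => all (fun l => l \in letters) t.1.1 &&
    (wsum Nweight t.1.1 <= wsum Nweight (inv_lead g))%N) (inv_normal g).
  by case: g; vm_compute.
apply: fil_sum => // t /(allP pl)/andP[/allP tl le].
by exact: (fil_word q_neq0 A_presented Nweight_compatible).
Qed.

Lemma lead_pow z w n : {subset w <= letters} -> lead z w -> lead (z ^+ n) (rep n w).
Proof.
move=> wl lz; elim: n => [|n IH].
  by rewrite expr0 -(wprod_nil pg); apply: lead_refl.
rewrite exprS; apply: leadM => // l /flattenP[w' /nseqP[-> _]]; exact: wl.
Qed.

Lemma fil_pow z d n : fil Nweight d.+1 z -> fil Nweight (n * d).+1 (z ^+ n).
Proof.
move=> fz; elim: n => [|n IH].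
  by rewrite expr0 -(wprod_nil pg); exact: (fil_word q_neq0 A_presented Nweight_compatible).
rewrite exprS mulSn; have := filMgen q_neq0 Nweight_compatible fz IH.
by rewrite addSn addnS.
Qed.

Lemma inv_monomial_lead i : lead (inv_monomial x i) (nword (inv_params i)) /\
  wsum Dweight (nword (inv_params i)) = (2 * pdeg (inv_params i))%N.
Proof.
have gl g : {subset inv_lead g <= letters} by apply/allP; case: g.
have rl n g : {subset rep n (inv_lead g) <= letters}.
  by move=> l /flattenP[w /nseqP[-> _] /gl].
have arl n g : all (fun l => l \in letters) (rep n (inv_lead g)) by apply/allP/rl.
have xl n g : lead (x g ^+ n) (rep n (inv_lead g)).
  by apply: lead_pow => //; apply: inv_elt_lead.
have [lN ED] := lead_normal q_neq0 A_presented (@inv_lead_letters i).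
rewrite params_inv_lead in lN ED.
split; last by rewrite -ED Dweight_inv_lead.
apply: (lead_trans q_neq0 ED _ lN).
case: i {ED lN} => [[[m n] l] [[[a b] c] d]]; rewrite /inv_monomial /inv_lead_word -!mulrA.
do 6 (apply: (leadM q_neq0);
  [exact: rl | by apply/allP; rewrite ?all_cat !arl | exact: xl | ]).
exact: xl.
Qed.

Lemma inv_monomial_fil i : fil Nweight (pdeg (inv_params i)).+1 (inv_monomial x i).
Proof.
have xf n g : fil Nweight (n * wsum Nweight (inv_lead g)).+1 (x g ^+ n).
  by apply: fil_pow; apply: inv_elt_fil.
have mf d d' z z' : fil Nweight d.+1 z -> fil Nweight d'.+1 z' -> fil Nweight (d + d').+1 (z * z').
  by move=> fz fz'; have := filMgen q_neq0 Nweight_compatible fz fz'; rewrite addSn addnS.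
case: i => [[[m n] l] [[[a b] c] d]]; rewrite /inv_monomial /pdeg /=.
apply: (@fil_le _ _ _ _ _ _ (m * 2 + n * 2 + l * 2 + a * 0 + b * 0 + c * 0 + d * 3).+1); first lia.
apply: (mf); last exact: (xf _ gv).
apply: (mf); last exact: (xf _ gu).
apply: (mf); last exact: (xf _ gt).
apply: (mf); last exact: (xf _ gs).
apply: (mf); last exact: (xf _ gG).
by apply: (mf); [exact: (xf _ gE) | exact: (xf _ gF)].
Qed.

Lemma wcoord_nword p : wcoord (pw (nword p)) = << nword p >>.
Proof.
rewrite wcoord_word //; last exact: nword_letters.
by rewrite normal_form_irreducible // nword_irreducible.
Qed.

(** If the degree of i is smaller, the degree filtration makes the coordinate vanish. If the degrees
    agree, both leading words have the same [Dweight], so only the leading term of the monomial can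
    contribute. *)
Lemma inv_monomial_coef i j :
  (pdeg (inv_params i) <= pdeg (inv_params j))%N ->
  inv_exp_ok i -> inv_exp_ok j ->
  ((wcoord (inv_monomial x i))@_(nword (inv_params j)) != 0) = (i == j).
Proof.
move=> le oki okj.
have vi := inv_params_valid i; have vj := inv_params_valid j.
have [[c c0 Fc] Di] := inv_monomial_lead i; have [_ Dj] := inv_monomial_lead j.
case: ltngtP le => // [lt|E] _.
  have -> : (i == j) = false by apply/eqP => ij; rewrite ij ltnn in lt.
  apply/negbTE/negP => nz; have := fil_lt (inv_monomial_fil i) nz.
  by rewrite Nweight_nword // ltnS leqNgt lt.
have : (wcoord (inv_monomial x i - c *: pw (nword (inv_params i))))@_(nword (inv_params j)) = 0.
  apply/eqP/negPn/negP => /(fil_lt Fc); by rewrite Di Dj E ltnn.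
rewrite -scaleNr wcoordD // wcoordZ // wcoord_nword mcoeffD mcoeffZ mcoeffU.
case: eqP => [ij|nij] /eqP; rewrite ?mulr0n ?mulr1n ?mulr0 ?addr0 ?mulr1 => /eqP H.
  have {}ij : i = j.
    by apply: inv_params_inj => //; rewrite -(params_of_nword vi) ij params_of_nword.
  by rewrite ij eqxx; move/eqP: H; rewrite addr_eq0 opprK -ij => /eqP->.
rewrite H eqxx; apply/esym/negbTE/eqP => ij; by rewrite ij in nij.
Qed.

End Leading.

(** * The action of the quantum group *)

(* [f] is an invariant of V_{2 n1} (x) V_{2 n2} (x) V_{2 n3}, given by its coordinates
   in products of weight vectors numbered from the lowest weight: it has weight 0
   and is killed by the raising and the lowering operator. The raising operator
   determines it from its values at a1 = 2 n1, the lowering operator then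
   determines these from the value at a3 = 0. *)
Lemma invariant_array (C : fieldType) (n1 n2 n3 : nat) (f : nat -> nat -> nat -> C) :
  (forall a1 a2 a3, f a1 a2 a3 != 0 -> (a1 + a2 + a3 = n1 + n2 + n3)%N) ->
  (forall a1 a2 a3, (a1 <= 2 * n1)%N -> (a2 <= 2 * n2)%N -> (a3 <= 2 * n3)%N ->
    exists x y z, ((0 < a1)%N -> x != 0) /\
    (if (0 < a1)%N then x * f a1.-1 a2 a3 else 0) +
    (if (0 < a2)%N then y * f a1 a2.-1 a3 else 0) +
    (if (0 < a3)%N then z * f a1 a2 a3.-1 else 0) = 0) ->
  (forall a1 a2 a3, (a1 <= 2 * n1)%N -> (a2 <= 2 * n2)%N -> (a3 <= 2 * n3)%N ->
    exists x y z, [/\ (a2 < 2 * n2)%N -> y != 0, (a3 < 2 * n3)%N -> z != 0 &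
    (if (a1 < 2 * n1)%N then x * f a1.+1 a2 a3 else 0) +
    (if (a2 < 2 * n2)%N then y * f a1 a2.+1 a3 else 0) +
    (if (a3 < 2 * n3)%N then z * f a1 a2 a3.+1 else 0) = 0]) ->
  forall a1 a2 a3, (a1 <= 2 * n1)%N -> (a2 <= 2 * n2)%N -> (a3 <= 2 * n3)%N ->
    f a1 a2 a3 != 0 ->
  [/\ f (2 * n1)%N (n2 + n3 - n1)%N 0%N != 0,
      (n1 <= n2 + n3)%N, (n2 <= n1 + n3)%N & (n3 <= n1 + n2)%N].
Proof.
move=> Hw He Hf b1 b2 b3 lb1 lb2 lb3 nzb.
have [a2 la2 nza] : exists2 a2, (a2 <= 2 * n2)%N & f (2 * n1)%N a2 0%N != 0.
  pose P (a2 : 'I_(2 * n2).+1) := f (2 * n1)%N a2 0%N != 0.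
  have [/existsP[a2 nza]|/existsPn none] := boolP [exists a2, P a2].
    by exists (nat_of_ord a2) => //; rewrite -ltnS.
  have step0 a2 : (a2 <= 2 * n2)%N -> f (2 * n1)%N a2 0%N = 0.
    rewrite -ltnS => la2; have := none (Ordinal la2).
    by rewrite /P negbK => /eqP.
  have step1 a3 a2 : (a3 <= 2 * n3)%N -> (a2 <= 2 * n2)%N -> f (2 * n1)%N a2 a3 = 0.
    elim: a3 a2 => [|a3 IH] a2 la3 la2; first exact: step0.
    have [x [y [z [_ nz]]]] := Hf (2 * n1)%N a2 a3 (leqnn _) la2 (ltnW la3).
    rewrite ltnn la3 add0r; case: ifP => [lt2|_].
      by rewrite IH ?(ltnW la3) // mulr0 add0r => /eqP; rewrite mulf_eq0 (negPf (nz la3)) => /eqP.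
    by rewrite add0r => /eqP; rewrite mulf_eq0 (negPf (nz la3)) => /eqP.
  have step2 j : forall a2 a3, (j <= 2 * n1)%N -> (a2 <= 2 * n2)%N -> (a3 <= 2 * n3)%N ->
      f (2 * n1 - j)%N a2 a3 = 0.
    elim: j => [|j IH] a2 a3 lj la2 la3; first by rewrite subn0 step1.
    have lj' : (0 < 2 * n1 - j)%N by rewrite subn_gt0.
    have [x [y [z [nx]]]] := He (2 * n1 - j)%N a2 a3 (leq_subr _ _) la2 la3.
    rewrite lj' -subnS !IH ?(ltnW lj) //; try by apply: leq_trans (leq_pred _) _.
    rewrite !mulr0 !if_same !addr0 => /eqP; rewrite mulf_eq0 (negPf (nx lj')).
    by move/eqP.
  by move: nzb; rewrite -(subKn lb1) step2 ?eqxx // leq_subr.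
have Ea := Hw _ _ _ nza.
have E2 : a2 = (n2 + n3 - n1)%N by lia.
(* The two inequalities settled here are 0 <= a2 and a2 <= 2 n2. *)
split; [by rewrite -E2| by lia| | by lia].
(* If n2 > n1 + n3, then a2 > 2 n3. The lowering relations carry the nonzero value along the points
   (2 n1, a2 - t, t) up to t = 2 n3, where the next relation has a single term and forces it to
   vanish. *)
rewrite leqNgt; apply/negP => lt.
have chain t : (t <= 2 * n3)%N -> f (2 * n1)%N (a2 - t)%N t != 0.
  elim: t => [|t IH] lt3; first by rewrite subn0.
  have l1 : (a2 - t.+1 <= 2 * n2)%N by lia.
  have [x [y [z [ny _]]]] := Hf (2 * n1)%N (a2 - t.+1)%N t (leqnn _) l1 (ltnW lt3).
  have lt2 : (a2 - t.+1 < 2 * n2)%N by lia.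
  rewrite ltnn lt2 lt3 add0r.
  have -> : (a2 - t.+1).+1 = (a2 - t)%N by lia.
  move/eqP => E; apply/eqP => f0.
  by move: E; rewrite f0 mulr0 addr0 mulf_eq0 (negPf (ny lt2)) (negPf (IH (ltnW lt3))).
have l1 : (a2 - (2 * n3).+1 <= 2 * n2)%N by lia.
have [x [y [z [ny _]]]] := Hf (2 * n1)%N (a2 - (2 * n3).+1)%N (2 * n3)%N (leqnn _) l1 (leqnn _).
have lt2 : (a2 - (2 * n3).+1 < 2 * n2)%N by lia.
rewrite !ltnn lt2 add0r addr0.
have -> : (a2 - (2 * n3).+1).+1 = (a2 - 2 * n3)%N by lia.
move/eqP; by rewrite mulf_eq0 (negPf (ny lt2)) (negPf (chain _ (leqnn _))).
Qed.

Section Action.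
Variables (C : numClosedFieldType) (q : C).
Hypothesis q_neq0 : q != 0.
Variables (A : algType C) (M : 'I_3 -> 'M[A]_2).
Hypothesis A_presented : is_sphere_algebra q M.
Variables (U : algType C) (ug : uq_gen -> U) (eps : {lrmorphism U -> C^o}).
Variable act : U -> A -> A.
Hypothesis U_presented : is_Uq_sl2 q ug.
Hypothesis eps_counit : is_counit ug eps.
Hypothesis act_module_algebra : module_algebra ug eps act.
Hypothesis act_generators : acts_on_generators q ug act M.
Local Notation pg := (letter_elt q M).
Local Notation pw := (wprod pg).
Local Notation wcoord := (wcoord A_presented).
Local Notation fil := (fil A_presented Nweight).
Local Notation e := (act (ug uE)).
Local Notation f := (act (ug uF)).
Local Notation k := (act (ug uK)).
Local Notation ki := (act (ug uKi)).

Lemma actP h c z z' : act h (c *: z + z') = c *: act h z + act h z'.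
Proof. exact: act_linearr act_module_algebra h c z z'. Qed.
Lemma act0 h : act h 0 = 0.
Proof. by have := actP h (-1) 0 0; rewrite scaler0 addr0 scaleN1r addNr. Qed.
Lemma actZ h c z : act h (c *: z) = c *: act h z.
Proof. by have := actP h c z 0; rewrite act0 !addr0. Qed.
Lemma actD h z z' : act h (z + z') = act h z + act h z'.
Proof. by have := actP h 1 z z'; rewrite !scale1r. Qed.
Lemma actN h z : act h (- z) = - act h z.
Proof. by rewrite -scaleN1r actZ scaleN1r. Qed.

Lemma uqK_invr : ug uKi * ug uK = 1.
Proof.
pose fg := @freevar C uq_gen.
have : freeeval ug (fg uKi * fg uK - 1) = 0.
  apply/U_presented.2/in_ideal_rel; rewrite /uq_rels in_cons; apply/orP; right.
  by rewrite in_cons eqxx.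
rewrite linearB /= freeevalM !freeeval_var freeeval1; exact: subr0_eq.
Qed.

Lemma kiK z : ki (k z) = z.
Proof. by rewrite -(act_comp act_module_algebra) uqK_invr (act_one act_module_algebra). Qed.

Lemma eM z z' : e (z * z') = e z * z' + ki z * e z'.
Proof.
have := act_mul act_module_algebra [:: uE] z z'.
by rewrite /= !big_cons !big_nil /= !mulr1 !(act_one act_module_algebra) addr0.
Qed.
Lemma fM z z' : f (z * z') = f z * k z' + z * f z'.
Proof.
have := act_mul act_module_algebra [:: uF] z z'.
by rewrite /= !big_cons !big_nil /= !mulr1 !(act_one act_module_algebra) addr0.
Qed.
Lemma kM z z' : k (z * z') = k z * k z'.
Proof.
have := act_mul act_module_algebra [:: uK] z z'.
by rewrite /= !big_cons !big_nil /= !mulr1 addr0.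
Qed.
Lemma kiM z z' : ki (z * z') = ki z * ki z'.
Proof.
have := act_mul act_module_algebra [:: uKi] z z'.
by rewrite /= !big_cons !big_nil /= !mulr1 addr0.
Qed.

Lemma e1 : e 1 = 0.
Proof. by case: eps_counit => E _ _ _; rewrite (act_unit act_module_algebra) E scale0r. Qed.
Lemma f1 : f 1 = 0.
Proof. by case: eps_counit => _ E _ _; rewrite (act_unit act_module_algebra) E scale0r. Qed.
Lemma k1 : k 1 = 1.
Proof. by case: eps_counit => _ _ E _; rewrite (act_unit act_module_algebra) E scale1r. Qed.
Lemma ki1 : ki 1 = 1.
Proof. by case: eps_counit => _ _ _ E; rewrite (act_unit act_module_algebra) E scale1r. Qed.

Lemma eX0 z n : e z = 0 -> ki z = z -> e (z ^+ n) = 0.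
Proof.
move=> ez kz; elim: n => [|n IH]; first by rewrite expr0 e1.
by rewrite exprS eM ez IH mul0r mulr0 addr0.
Qed.

Lemma kX c z n : k z = c *: z -> k (z ^+ n) = c ^+ n *: z ^+ n.
Proof.
move=> kz; elim: n => [|n IH]; first by rewrite !expr0 k1 scale1r.
by rewrite !exprS kM kz IH -scalerAl -scalerAr scalerA.
Qed.

Lemma ki_eigen c z : c != 0 -> k z = c *: z -> ki z = c^-1 *: z.
Proof.
move=> c0 kz; rewrite -{2}(kiK z) kz actZ scalerA mulVf // scale1r.
by [].
Qed.

Hypothesis q2_neq1 : q ^+ 2 != 1.

Local Notation Q := (q ^+ 2).
Local Notation R := (q ^- 2).

(** A q-integer: -q (1 + R + ... + R^(j-1)), collected when e turns each d of d^j into p and the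
    result is sorted. The next three are the analogues for e on powers of m, f on powers of d and f
    on powers of p. *)
Definition e_coef_d (j : nat) : C := - q * (1 - R ^+ j) / (1 - R).
Definition e_coef_m (l : nat) : C := q ^- 3 * (Q ^+ l * Q ^+ l - 1) / (1 - R).
Definition f_coef_d (j : nat) : C := (Q ^+ j - 1) / (Q - 1).
Definition f_coef_p (l : nat) : C := - (Q ^+ l - R ^+ l) / (Q - 1).

(** Coefficients of e and f on the weight vector number a of V_{2 n}. In the branches with two
    summands, e acts on d^a m^(n-a) either on m or on a d; the latter creates p m, with top part -
    q^-4 d d. Likewise f creates m p, with top part - d d. *)
Definition e_coef (n a : nat) : C :=
  if (n <= a)%N then e_coef_d (2 * n - a)
  else e_coef_m (n - a) - q ^- 4 * e_coef_d a.
Definition f_coef (n a : nat) : C :=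
  if (a <= n)%N then f_coef_d a * R ^+ (n - a)
  else f_coef_p (a - n) - f_coef_d (2 * n - a) * Q ^+ (a - n).

Lemma Q1_neq0 : Q - 1 != 0.
Proof. by rewrite subr_eq0. Qed.

Lemma R1_neq0 : 1 - R != 0.
Proof.
rewrite subr_eq0; apply: contra q2_neq1 => /eqP E.
by rewrite -[Q]invrK -E invr1.
Qed.

Lemma QXRX n : Q ^+ n * R ^+ n = 1.
Proof. by rewrite -exprMn mulfV ?expf_neq0 // expr1n. Qed.

Lemma comm_pow (x y : A) (c : C) n : y * x = c *: (x * y) ->
  y * x ^+ n = c ^+ n *: (x ^+ n * y).
Proof.
move=> yx; elim: n => [|n IH]; first by rewrite !expr0 mulr1 mul1r scale1r.
by rewrite [x ^+ n.+1]exprS mulrA yx -scalerAl -[x * y * _]mulrA IH -scalerAr scalerA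
  -[c * c ^+ n]exprS !mulrA.
Qed.

(* In the graded algebra of [Nweight] the letters d, p, m of a block span V_2 and
   their products of degree n, modulo s, the module V_{2 n}. *)
Definition eqN (n : nat) (z z' : A) : Prop := fil n (z - z').

Lemma eqN_refl n z : eqN n z z.
Proof. by rewrite /eqN subrr; apply: (fil0 q_neq0). Qed.

Lemma eqN_eq n z z' : z = z' -> eqN n z z'.
Proof. by move=> ->; apply: eqN_refl. Qed.

Lemma eqN_trans n z z' z'' : eqN n z z' -> eqN n z' z'' -> eqN n z z''.
Proof. by move=> ? ?; rewrite /eqN -(subrK z' z) -addrA; apply: (filD q_neq0). Qed.

Lemma eqND n z z' y y' : eqN n z z' -> eqN n y y' -> eqN n (z + y) (z' + y').
Proof. by rewrite /eqN opprD addrACA; apply: (filD q_neq0). Qed.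

Lemma eqNZ n c z z' : eqN n z z' -> eqN n (c *: z) (c *: z').
Proof. by rewrite /eqN -scalerBr; apply: (filZ q_neq0). Qed.

Lemma eqN_low n z y : fil n y -> eqN n (z + y) z.
Proof. by rewrite /eqN addrAC subrr add0r. Qed.

Lemma filM d d' z z' : fil d.+1 z -> fil d'.+1 z' -> fil (d + d').+1 (z * z').
Proof.
by move=> fz fz'; have := filMgen q_neq0 Nweight_compatible fz fz'; rewrite addSn addnS.
Qed.

Lemma eqNMl d n y z z' : fil d.+1 y -> eqN n z z' -> eqN (d + n) (y * z) (y * z').
Proof.
move=> fy ezz; rewrite /eqN -mulrBr.
by have := filMgen q_neq0 Nweight_compatible fy ezz; rewrite addSn.
Qed.

Lemma eqNMr d n y z z' : fil d.+1 y -> eqN n z z' -> eqN (n + d) (z * y) (z' * y).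
Proof.
move=> fy ezz; rewrite /eqN -mulrBl.
by have := filMgen q_neq0 Nweight_compatible ezz fy; rewrite addnS.
Qed.

Section Letters.
Variable b : 'I_3.
Local Notation S := (pg (4 * b)).
Local Notation D := (pg (4 * b + 1)).
Local Notation P := (pg (4 * b + 2)).
Local Notation N := (pg (4 * b + 3)).

Lemma entry_letters : [/\ M b 0 0 = S - q ^- 2 *: D, M b 1 1 = D, M b 0 1 = P & M b 1 0 = N].
Proof.
have E i j := entry_polyE q M b i j.
have nd j : (0 < j < 4)%N -> (4 %| 4 * b + j)%N = false.
  by rewrite dvdn_addr ?dvdn_mulr //; case: j => [|[|[|[|]]]].
rewrite -!E /entry_poly /entry /of_sphere /= addn0 dvdn_mulr // !nd //.
rewrite /pvar !peval1 !wprod1; split=> //.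
rewrite !peval_cons peval_nil addr0 /= !wprod1 expr0z mul1r scale1r mulN1r scaleNr.
by rewrite addn1.
Qed.

Lemma act_letters : [/\ [/\ k S = S, k D = D, k P = q ^+ 2 *: P & k N = q ^- 2 *: N],
  [/\ e S = 0, e D = - (q *: P), e P = 0 & e N = (q + q^-1) *: D - q *: S]
  & [/\ f S = 0, f D = N, f P = S - (1 + q ^- 2) *: D & f N = 0]].
Proof.
have [E00 E11 E01 E10] := entry_letters.
have [] := act_generators b; rewrite !E00 !E11 !E01 !E10.
move=> [kS0 kP kN kD] [eS0 eP eN eD] [fS0 fP fN fD].
have kS : k S = S by move: kS0; rewrite actD actN actZ kD; apply: addIr.
have eS : e S = 0.
  move: eS0; rewrite actD actN actZ eD scalerN opprK scalerA.
  have -> : q ^- 2 * q = q^-1 by field.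
  by rewrite -[RHS]add0r; apply: addIr.
have fS : f S = 0.
  by move: fS0; rewrite actD actN actZ fD -[RHS]add0r; apply: addIr.
split; split=> //.
- rewrite eN opprD opprK scalerDr scalerDr scalerN scalerA addrA.
  rewrite addrAC -scalerDl; congr (_ *: _ - _).
  by field.
- by rewrite fP scalerDl scale1r opprD addrA addrAC.
Qed.

Lemma rel_letters : [/\ P * D = q ^- 2 *: (D * P), N * D = q ^+ 2 *: (D * N),
  P * N = q ^- 2 *: (S * D) - q ^- 4 *: (D * D) - (q ^- 2)%:A,
  N * P = S * D - D * D - (q ^- 2)%:A & [/\ D * S = S * D, P * S = S * P & N * S = S * N]].
Proof.
have sat := letter_elt_satisfies q_neq0 A_presented.
have rl i j r : (i < 4)%N -> (j < 4)%N ->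
    block_rule (4 * b) i j = Some r -> pbw_rule (4 * b + i) (4 * b + j) = Some r.
  move=> i4 j4 Er; rewrite /pbw_rule !ltn_letter //=.
  by rewrite ![(4 * b)%N]mulnC !edivn_eq // eqxx.
have e2 i j : wprod pg [:: i; j] = pg i * pg j by rewrite wprod_cons wprod1.
have bE := (addn0, addn1, addn2, addn3).
have simp := (e2, peval_cons, peval_nil, wprod_nil, expr0z, mul1r, mulN1r, scale1r, scaleN1r,
              scaleNr, addr0, addrA).
have m2 : q ^ (-2) = q ^- 2 by [].
have m4 : q ^ (-4) = q ^- 4 by [].
have p2 : q ^ 2 = q ^+ 2 by [].
do ![split].
- by have := sat _ _ _ (rl 2 1 _ isT isT erefl); rewrite !bE !simp m2.
- by have := sat _ _ _ (rl 3 1 _ isT isT erefl); rewrite !bE !simp p2.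
- by have := sat _ _ _ (rl 2 3 _ isT isT erefl); rewrite !bE !simp /= ?scaleNr m2 m4.
- by have := sat _ _ _ (rl 3 2 _ isT isT erefl); rewrite !bE !simp /= ?scaleNr m2.
- by have := sat _ _ _ (rl 1 0 _ isT isT erefl); rewrite !bE !simp.
- by have := sat _ _ _ (rl 2 0 _ isT isT erefl); rewrite !bE !simp.
- by have := sat _ _ _ (rl 3 0 _ isT isT erefl); rewrite !bE !simp.
Qed.

Lemma fil_S : fil 1 S.
Proof.
rewrite -wprod1; apply: (fil_word q_neq0 A_presented Nweight_compatible); last first.
  by rewrite /wsum /= /Nweight dvdn_mulr.
by move=> l; rewrite mem_seq1 => /eqP->; rewrite mem_letters -(addn0 (4 * b)%N) ltn_letter.
Qed.

Lemma fil_letter j : (j < 4)%N -> fil 2 (pg (4 * b + j)).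
Proof.
move=> j4; rewrite -wprod1; apply: (fil_word q_neq0 A_presented Nweight_compatible); last first.
  by rewrite /wsum /= addn0 /Nweight !ltnS leq_b1.
by move=> l; rewrite mem_seq1 => /eqP->; rewrite mem_letters ltn_letter.
Qed.

Let fil_D : fil 2 D. Proof. exact: fil_letter. Qed.
Let fil_P : fil 2 P. Proof. exact: fil_letter. Qed.
Let fil_N : fil 2 N. Proof. exact: fil_letter. Qed.

Lemma fil_powS n : fil 1 (S ^+ n).
Proof. by have := fil_pow q_neq0 n fil_S; rewrite muln0. Qed.

Lemma fil_pow2 z n : fil 2 z -> fil n.+1 (z ^+ n).
Proof. by move/(fil_pow q_neq0 n); rewrite muln1. Qed.

Lemma eD_pow j : e (D ^+ j) = e_coef_d j *: (D ^+ j.-1 * P).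
Proof.
have [[_ kD _ _] [_ eD _ _] _] := act_letters; have [PD _ _ _ _] := rel_letters.
have kiD : ki D = D by rewrite -{2}(kiK D) kD.
elim: j => [|j IH]; first by rewrite expr0 e1 /e_coef_d expr0 subrr mulr0 mul0r scale0r.
rewrite exprS eM kiD eD IH mulNr -scalerAl (comm_pow _ PD) scalerA -scaleNr.
have -> : D * (e_coef_d j *: (D ^+ j.-1 * P)) = e_coef_d j *: (D ^+ j * P).
  case: j {IH} => [|j]; last by rewrite -scalerAr mulrA -exprS.
  by rewrite /e_coef_d expr0 subrr mulr0 mul0r !scale0r mulr0.
rewrite -scalerDl; congr (_ *: _); rewrite /e_coef_d [R ^+ j.+1]exprS.
by move: R1_neq0; set r := q ^- 2; move: (r ^+ j) => rj r1; field.
Qed.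

Lemma eP_pow l : e (P ^+ l) = 0.
Proof.
have [_ [_ _ eP _] _] := act_letters.
elim: l => [|l IH]; first by rewrite expr0 e1.
by rewrite exprS eM eP IH mul0r mulr0 addr0.
Qed.

Let kiD : ki D = D.
Proof. by have [[_ kD _ _] _ _] := act_letters; rewrite -{2}(kiK D) kD. Qed.

Let kiX z n : ki z = z -> ki (z ^+ n) = z ^+ n.
Proof.
move=> kz; elim: n => [|n IH]; first by rewrite expr0 ki1.
by rewrite exprS kiM kz IH.
Qed.

Let kX1 z n : k z = z -> k (z ^+ n) = z ^+ n.
Proof. by move=> kz; rewrite (@kX 1) ?expr1n ?scale1r. Qed.

Let kiN : ki N = Q *: N.
Proof.
have [[_ _ _ kN] _ _] := act_letters.
by rewrite -[Q]invrK; apply: ki_eigen => //; rewrite invr_neq0 ?expf_neq0.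
Qed.

Lemma eDP j l : e (D ^+ j * P ^+ l) = e_coef_d j *: (D ^+ j.-1 * P ^+ l.+1).
Proof. by rewrite eM eD_pow eP_pow mulr0 addr0 -scalerAl -[D ^+ _ * P * _]mulrA -exprS. Qed.

Let fil1 : fil 1 1.
Proof. by rewrite -(expr0 D); exact: fil_pow2. Qed.

Let fil_SD : fil 2 (S * D).
Proof. exact: (filM fil_S fil_D). Qed.

Let fil_cst c : fil 2 c%:A.
Proof. by apply: (filZ q_neq0); apply: fil_le fil1. Qed.

Lemma PN_top : eqN 2 (P * N) (- q ^- 4 *: (D * D)).
Proof.
have [_ _ PN _ _] := rel_letters; rewrite /eqN PN scaleNr opprK addrAC subrK.
by apply: (filB q_neq0 _ (fil_cst _)); apply: (filZ q_neq0 _ fil_SD).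
Qed.

Lemma NP_top : eqN 2 (N * P) (- (D * D)).
Proof.
have [_ _ _ NP _] := rel_letters; rewrite /eqN NP opprK addrAC subrK.
exact: (filB q_neq0 fil_SD (fil_cst _)).
Qed.

Lemma eN_pow l : eqN l (e (N ^+ l)) (e_coef_m l *: (D * N ^+ l.-1)).
Proof.
have [_ [_ _ _ eN] _] := act_letters; have [_ ND _ _ _] := rel_letters.
elim: l => [|l IH].
  by rewrite expr0 e1 /e_coef_m !expr0 mulr1 subrr mulr0 mul0r scale0r; apply: eqN_refl.
rewrite exprS eM eN kiN mulrBl -!scalerAl.
apply: (@eqN_trans _ _ ((q + q^-1) *: (D * N ^+ l) + (Q * Q * e_coef_m l) *: (D * N ^+ l))).
  apply: eqND.
    rewrite -scaleNr; apply: eqN_low; apply: (filZ q_neq0).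
    by have := filM fil_S (fil_pow2 l fil_N).
  rewrite -[Q * Q * _]mulrA -(scalerA Q); apply: eqNZ.
  apply: eqN_trans (eqNMl (d := 1) fil_N IH) _.
  apply: eqN_eq; rewrite -scalerAr mulrA ND -scalerAl !scalerA.
  case: l {IH} => [|l]; last by rewrite /= -[D * N * _]mulrA -exprS [e_coef_m _ * _]mulrC.
  by rewrite /e_coef_m !expr0 mulr1 subrr mulr0 mul0r !(mulr0, mul0r) !scale0r.
apply: eqN_eq; rewrite -scalerDl /=; congr (_ *: _); rewrite /e_coef_m ![Q ^+ l.+1]exprS.
have r1 := R1_neq0; have Q1 := Q1_neq0; move: (Q ^+ l) => Ql.
field; rewrite q_neq0 /=.
have -> : (q ^+ 2 - 1) = q ^+ 2 * (1 - R) by field.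
by rewrite mulf_neq0 ?expf_neq0.
Qed.

Lemma eDN j l : eqN (j + l.+1) (e (D ^+ j * N ^+ l.+1))
  ((e_coef_m l.+1 - q ^- 4 * e_coef_d j) *: (D ^+ j.+1 * N ^+ l)).
Proof.
rewrite eM kiX // eD_pow addrC scalerBl; apply: eqND.
  apply: eqN_trans (eqNMl (fil_pow2 j fil_D) (eN_pow l.+1)) _.
  by apply: eqN_eq; rewrite -scalerAr mulrA -exprSr.
rewrite -scaleNr -scalerAl; case: j => [|j].
  by rewrite /e_coef_d expr0 subrr mulr0 mul0r mulr0 oppr0 !scale0r; apply: eqN_refl.
rewrite -mulNr [_ * e_coef_d _]mulrC -(scalerA (e_coef_d _)); apply: eqNZ.
have -> : (j.+1 + l.+1 = j + (2 + l))%N by lia.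
have H : eqN (2 + l) (P * N ^+ l.+1) (- q ^- 4 *: (D * D) * N ^+ l).
  by rewrite [N ^+ l.+1]exprS mulrA; apply: eqNMr PN_top; apply: fil_pow2.
rewrite -[D ^+ _ * P * _]mulrA; apply: eqN_trans (eqNMl (fil_pow2 j fil_D) H) _.
by apply: eqN_eq; rewrite -scalerAl -scalerAr !mulrA -!exprSr.
Qed.

Lemma fD_pow j : f (D ^+ j) = f_coef_d j *: (D ^+ j.-1 * N).
Proof.
have [[_ kD _ _] _ [_ fD _ _]] := act_letters; have [_ ND _ _ _] := rel_letters.
elim: j => [|j IH]; first by rewrite expr0 f1 /f_coef_d expr0 subrr mul0r scale0r.
rewrite exprS fM fD kX1 // IH (comm_pow _ ND) -scalerAr.
have -> : f_coef_d j *: (D * (D ^+ j.-1 * N)) = f_coef_d j *: (D ^+ j * N).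
  case: j {IH} => [|j]; last by rewrite mulrA -exprS.
  by rewrite /f_coef_d expr0 subrr mul0r !scale0r.
rewrite -scalerDl; congr (_ *: _); rewrite /f_coef_d [Q ^+ j.+1]exprS.
by move: Q1_neq0 (Q ^+ j); set r := q ^+ 2 => r1 rj; field.
Qed.

Lemma fN_pow l : f (N ^+ l) = 0.
Proof.
have [_ _ [_ _ _ fN]] := act_letters.
elim: l => [|l IH]; first by rewrite expr0 f1.
by rewrite exprS fM fN IH mul0r mulr0 addr0.
Qed.

Lemma fDN j l : f (D ^+ j * N ^+ l) = (f_coef_d j * R ^+ l) *: (D ^+ j.-1 * N ^+ l.+1).
Proof.
have [[_ _ _ kN] _ _] := act_letters.
rewrite fM fD_pow fN_pow mulr0 addr0 (kX _ kN) -scalerAl -scalerAr scalerA.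
by rewrite -[D ^+ _ * N * _]mulrA -exprS.
Qed.

Lemma fP_pow l : eqN l (f (P ^+ l)) (f_coef_p l *: (D * P ^+ l.-1)).
Proof.
have [[_ _ kP _] _ [_ _ fP _]] := act_letters; have [PD _ _ _ _] := rel_letters.
elim: l => [|l IH].
  by rewrite expr0 f1 /f_coef_p !expr0 subrr oppr0 mul0r scale0r; apply: eqN_refl.
rewrite exprS fM fP (kX _ kP) mulrBl -!scalerAl -!scalerAr.
apply: (@eqN_trans _ _ ((- (1 + R) * Q ^+ l) *: (D * P ^+ l) + (R * f_coef_p l) *: (D * P ^+ l))).
  apply: eqND.
    rewrite addrC -scalerA scaleNr; apply: eqN_low; apply: (filZ q_neq0).
    by have := filM fil_S (fil_pow2 l fil_P).
  apply: eqN_trans (eqNMl (d := 1) fil_P IH) _.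
  apply: eqN_eq; rewrite -scalerAr mulrA PD -scalerAl !scalerA.
  case: l {IH} => [|l]; last by rewrite /= -[D * P * _]mulrA -exprS [f_coef_p _ * _]mulrC.
  by rewrite /f_coef_p !expr0 subrr oppr0 mul0r !(mulr0, mul0r) !scale0r.
apply: eqN_eq; rewrite -scalerDl /=; congr (_ *: _).
rewrite /f_coef_p [Q ^+ l.+1]exprS [R ^+ l.+1]exprS.
have Q1 := Q1_neq0; move: (Q ^+ l) (R ^+ l) => Ql Rl.
by field; rewrite Q1 q_neq0.
Qed.

Lemma fDP j l : eqN (j + l.+1) (f (D ^+ j * P ^+ l.+1))
  ((f_coef_p l.+1 - f_coef_d j * Q ^+ l.+1) *: (D ^+ j.+1 * P ^+ l)).
Proof.
have [[_ _ kP _] _ _] := act_letters.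
rewrite fM (kX _ kP) fD_pow addrC scalerBl; apply: eqND.
  apply: eqN_trans (eqNMl (fil_pow2 j fil_D) (fP_pow l.+1)) _.
  by apply: eqN_eq; rewrite -scalerAr mulrA -exprSr.
rewrite -scaleNr -scalerAl -scalerAr scalerA; case: j => [|j].
  by rewrite /f_coef_d expr0 subrr !mul0r oppr0 !scale0r; apply: eqN_refl.
rewrite -[- _]mulrN1 -(scalerA (_ * _) (-1)); apply: eqNZ; rewrite scaleN1r.
have -> : (j.+1 + l.+1 = j + (2 + l))%N by lia.
have H : eqN (2 + l) (N * P ^+ l.+1) (- (D * D) * P ^+ l).
  by rewrite [P ^+ l.+1]exprS mulrA; apply: eqNMr NP_top; apply: fil_pow2.
rewrite -[D ^+ _ * N * _]mulrA; apply: eqN_trans (eqNMl (fil_pow2 j fil_D) H) _.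
by apply: eqN_eq; rewrite mulNr mulrN !mulrA -!exprSr.
Qed.

End Letters.
Lemma wprod_nseq n l : pw (nseq n l) = pg l ^+ n.
Proof.
by elim: n => [|n IH]; rewrite ?wprod_nil ?expr0 //= wprod_cons IH exprS.
Qed.

Lemma wprod_block (b : 'I_3) i n a : pw (block_word b (i, n, a)) =
  pg (4 * b) ^+ i * (pg (4 * b + 1) ^+ minn a (2 * n - a) *
    (pg (4 * b + 2) ^+ (a - n) * pg (4 * b + 3) ^+ (n - a))).
Proof. by rewrite /block_word !wprod_cat !wprod_nseq. Qed.

Lemma fil_block (b : 'I_3) i n a : (a <= 2 * n)%N -> fil n.+1 (pw (block_word b (i, n, a))).
Proof.
move=> le_a; rewrite wprod_block.
have fp m j : (j < 4)%N -> fil m.+1 (pg (4 * b + j) ^+ m).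
  by move=> j4; apply: fil_pow2; apply: fil_letter.
apply: (@fil_le _ _ _ _ _ _ (0 + (minn a (2 * n - a) + ((a - n) + (n - a)))).+1); first lia.
by do 3 (apply: filM; [by [exact: fil_powS | exact: fp] | ]); exact: fp.
Qed.

Lemma e_block (b : 'I_3) i n a : (a <= 2 * n)%N ->
  eqN n (e (pw (block_word b (i, n, a)))) (e_coef n a *: pw (block_word b (i, n, a.+1))).
Proof.
move=> le_a; rewrite !wprod_block.
have [[kS _ _ _] [eS _ _ _] _] := act_letters b.
have kiS : ki (pg (4 * b)) = pg (4 * b) by rewrite -{2}(kiK (pg _)) kS.
have kiSi : ki (pg (4 * b) ^+ i) = pg (4 * b) ^+ i.
  by elim: (i) => [|m IH]; rewrite ?expr0 ?ki1 // exprS kiM kiS IH.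
rewrite eM eX0 // mul0r add0r kiSi scalerAr.
apply: (eqNMl (d := 0)); first exact: fil_powS.
rewrite /e_coef; case: leqP => na.
  have -> : (n - a = 0)%N by lia. have -> : (n - a.+1 = 0)%N by lia.
  rewrite !expr0 !mulr1; apply: eqN_eq; rewrite eDP.
  have -> : (minn a (2 * n - a) = 2 * n - a)%N by lia.
  have -> : (minn a.+1 (2 * n - a.+1) = (2 * n - a).-1)%N by lia.
  by have -> : (a.+1 - n = (a - n).+1)%N by lia.
have -> : (a - n = 0)%N by lia. have -> : (a.+1 - n = 0)%N by lia.
rewrite !expr0 !mul1r.
have -> : (minn a (2 * n - a) = a)%N by lia.
have -> : (minn a.+1 (2 * n - a.+1) = a.+1)%N by lia.
have := @eDN b a (n - a.+1); have -> : (n - a.+1).+1 = (n - a)%N by lia.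
by have -> : (a + (n - a) = n)%N by lia.
Qed.

Lemma f_block (b : 'I_3) i n a : (a <= 2 * n)%N ->
  eqN n (f (pw (block_word b (i, n, a)))) (f_coef n a *: pw (block_word b (i, n, a.-1))).
Proof.
move=> le_a; rewrite !wprod_block.
have [_ _ [fS _ _ _]] := act_letters b.
have fSi m : f (pg (4 * b) ^+ m) = 0.
  elim: m => [|m IH]; first by rewrite expr0 f1.
  by rewrite exprS fM fS IH mul0r mulr0 addr0.
rewrite fM fSi mul0r add0r scalerAr.
apply: (eqNMl (d := 0)); first exact: fil_powS.
rewrite /f_coef; case: leqP => na.
  have -> : (a - n = 0)%N by lia. have -> : (a.-1 - n = 0)%N by lia.
  rewrite !expr0 !mul1r; apply: eqN_eq; rewrite fDN.
  have -> : (minn a (2 * n - a) = a)%N by lia.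
  have -> : (minn a.-1 (2 * n - a.-1) = a.-1)%N by lia.
  case: a na le_a => [|a] na le_a.
    by rewrite /f_coef_d expr0 subrr !mul0r !scale0r.
  by have -> : (n - a.+1.-1 = (n - a.+1).+1)%N by lia.
have -> : (n - a = 0)%N by lia. have -> : (n - a.-1 = 0)%N by lia.
rewrite !expr0 !mulr1.
have -> : (minn a (2 * n - a) = 2 * n - a)%N by lia.
have -> : (minn a.-1 (2 * n - a.-1) = (2 * n - a).+1)%N by lia.
have := @fDP b (2 * n - a) (a.-1 - n); have -> : (a.-1 - n).+1 = (a - n)%N by lia.
by have -> : (2 * n - a + (a - n) = n)%N by lia.
Qed.

(** The weight q^(2 (a - n)), written with natural exponents. *)
Definition k_coef (n a : nat) : C := Q ^+ a * R ^+ n.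

Lemma k_coef_neq0 n a : k_coef n a != 0.
Proof. by rewrite mulf_neq0 ?expf_neq0 ?invr_neq0 ?expf_neq0. Qed.

Lemma k_block (b : 'I_3) i n a : (a <= 2 * n)%N ->
  k (pw (block_word b (i, n, a))) = k_coef n a *: pw (block_word b (i, n, a)).
Proof.
move=> le_a; rewrite !wprod_block.
have [[kS kD kP kN] _ _] := act_letters b.
have kX1 z m : k z = z -> k (z ^+ m) = z ^+ m.
  by move=> kz; rewrite (@kX 1) ?expr1n ?scale1r.
rewrite !kM (kX1 _ _ kS) (kX1 _ _ kD) (kX _ kP) (kX _ kN) -!scalerAl -!scalerAr scalerA.
congr (_ *: _); rewrite /k_coef.
case: (leqP n a) => na.
  have -> : (n - a = 0)%N by lia.
  by rewrite expr0 mulr1 -{2}(subnK na) exprD -mulrA QXRX mulr1.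
have -> : (a - n = 0)%N by lia.
by rewrite expr0 mul1r -{2}(subnK (ltnW na)) exprD mulrCA QXRX mulr1.
Qed.

Lemma ki_block (b : 'I_3) i n a : (a <= 2 * n)%N ->
  ki (pw (block_word b (i, n, a))) = (k_coef n a)^-1 *: pw (block_word b (i, n, a)).
Proof. by move=> le_a; apply: ki_eigen; [exact: k_coef_neq0 | exact: k_block]. Qed.

(** * The action on products of three blocks *)

Section Nwords.
Variables (i1 i2 i3 n1 n2 n3 a1 a2 a3 : nat).
Hypotheses (v1 : (a1 <= 2 * n1)%N) (v2 : (a2 <= 2 * n2)%N) (v3 : (a3 <= 2 * n3)%N).
Local Notation B1 := (pw (block_word (0%R : 'I_3) (i1, n1, a1))).
Local Notation B2 := (pw (block_word (1%R : 'I_3) (i2, n2, a2))).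
Local Notation B3 := (pw (block_word (2%R : 'I_3) (i3, n3, a3))).

Lemma wprod_nword (j1 j2 j3 m1 m2 m3 c1 c2 c3 : nat) :
  pw (nword ((j1, m1, c1), (j2, m2, c2), (j3, m3, c3))) =
  pw (block_word (0%R : 'I_3) (j1, m1, c1)) *
    (pw (block_word (1%R : 'I_3) (j2, m2, c2)) * pw (block_word (2%R : 'I_3) (j3, m3, c3))).
Proof. by rewrite /nword !wprod_cat. Qed.

Let fB1 : fil n1.+1 B1. Proof. exact: fil_block. Qed.
Let fB2 : fil n2.+1 B2. Proof. exact: fil_block. Qed.
Let fB3 : fil n3.+1 B3. Proof. exact: fil_block. Qed.

(** The iterated coproduct of e: k^-1 acts on the blocks to the left of the one that is raised. For
    f below, k acts on the blocks to the right. *)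
Lemma e_nword : eqN (n1 + n2 + n3) (e (pw (nword ((i1, n1, a1), (i2, n2, a2), (i3, n3, a3)))))
  (e_coef n1 a1 *: pw (nword ((i1, n1, a1.+1), (i2, n2, a2), (i3, n3, a3))) +
   ((k_coef n1 a1)^-1 * e_coef n2 a2) *: pw (nword ((i1, n1, a1), (i2, n2, a2.+1), (i3, n3, a3))) +
   ((k_coef n1 a1)^-1 * (k_coef n2 a2)^-1 * e_coef n3 a3) *:
     pw (nword ((i1, n1, a1), (i2, n2, a2), (i3, n3, a3.+1)))).
Proof.
rewrite !wprod_nword !eM !ki_block // -addrA -!scalerAl mulrDr scalerDr.
apply: eqND.
  rewrite scalerAl -addnA; apply: eqNMr; first exact: filM.
  exact: e_block.
rewrite -!mulrA -!(scalerA _ _ (_ * _)); apply: eqND; apply: eqNZ; rewrite -addnA.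
  rewrite scalerAr; apply: (eqNMl fB1); rewrite scalerAl; apply: (eqNMr fB3).
  exact: e_block.
rewrite -scalerAr; apply: eqNZ; rewrite !scalerAr; apply: (eqNMl fB1).
by apply: (eqNMl fB2); apply: e_block.
Qed.

Lemma f_nword : eqN (n1 + n2 + n3) (f (pw (nword ((i1, n1, a1), (i2, n2, a2), (i3, n3, a3)))))
  ((k_coef n2 a2 * k_coef n3 a3 * f_coef n1 a1) *:
     pw (nword ((i1, n1, a1.-1), (i2, n2, a2), (i3, n3, a3))) +
   (k_coef n3 a3 * f_coef n2 a2) *: pw (nword ((i1, n1, a1), (i2, n2, a2.-1), (i3, n3, a3))) +
   f_coef n3 a3 *: pw (nword ((i1, n1, a1), (i2, n2, a2), (i3, n3, a3.-1)))).
Proof.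
rewrite !wprod_nword !fM !kM !k_block // -addrA mulrDr -!scalerAr -!scalerAl.
apply: eqND.
  rewrite -scalerAr scalerA [k_coef n3 _ * _]mulrC -(scalerA (k_coef n2 _ * _)); apply: eqNZ.
  by rewrite scalerAl -addnA; apply: eqNMr; [exact: filM | exact: f_block].
apply: eqND.
  rewrite -(scalerA (k_coef n3 a3)) -addnA; apply: eqNZ.
  rewrite scalerAr; apply: (eqNMl fB1); rewrite scalerAl; apply: (eqNMr fB3).
  exact: f_block.
rewrite -addnA !scalerAr; apply: (eqNMl fB1).
by apply: (eqNMl fB2); apply: f_block.
Qed.

Lemma k_nword : k (pw (nword ((i1, n1, a1), (i2, n2, a2), (i3, n3, a3)))) =
  k_coef (n1 + n2 + n3) (a1 + a2 + a3) *: pw (nword ((i1, n1, a1), (i2, n2, a2), (i3, n3, a3))).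
Proof.
rewrite !wprod_nword !kM !k_block // -!scalerAr -!scalerAl -!scalerAr !scalerA.
congr (_ *: _); rewrite /k_coef !exprD.
move: (Q ^+ a1) (Q ^+ a2) (Q ^+ a3) (R ^+ n1) (R ^+ n2) (R ^+ n3) => ? ? ? ? ? ?.
ring.
Qed.

End Nwords.

Definition slot (j : nat) (p : params) : bparams :=
  match j with 0%N => p.1.1 | 1%N => p.1.2 | _ => p.2 end.
Definition shift (j : nat) (g : nat -> nat) (p : params) : params :=
  let: ((i1, n1, a1), (i2, n2, a2), (i3, n3, a3)) := p in
  match j with
  | 0%N => ((i1, n1, g a1), (i2, n2, a2), (i3, n3, a3))
  | 1%N => ((i1, n1, a1), (i2, n2, g a2), (i3, n3, a3))
  | _ => ((i1, n1, a1), (i2, n2, a2), (i3, n3, g a3))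
  end.
Notation up j := (shift j succn).
Notation dn j := (shift j predn).

Lemma slot_shift j g p : slot j (shift j g p) = ((slot j p).1, g (slot j p).2).
Proof. by case: p => [[[[i1 n1] a1] [[i2 n2] a2]] [[i3 n3] a3]]; case: j => [|[|j]]. Qed.

Lemma shiftK j g h p : g (h (slot j p).2) = (slot j p).2 -> shift j g (shift j h p) = p.
Proof. by case: p => [[[[i1 n1] a1] [[i2 n2] a2]] [[i3 n3] a3]]; case: j => [|[|j]] /= ->. Qed.

Lemma valid_slot j p : valid p -> ((slot j p).2 <= 2 * (slot j p).1.2)%N.
Proof. by case/and3P; case: j => [|[|j]]. Qed.

Lemma valid_shift j g p : valid p -> (g (slot j p).2 <= 2 * (slot j p).1.2)%N ->
  valid (shift j g p).
Proof.
case: p => [[[[i1 n1] a1] [[i2 n2] a2]] [[i3 n3] a3]].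
by case: j => [|[|j]] /and3P[/= v1 v2 v3] v; apply/and3P; split.
Qed.

Lemma wcoord_nword_coef p t : valid p -> valid t ->
  (wcoord (pw (nword p)))@_(nword t) = (p == t)%:R.
Proof.
move=> vp vt; rewrite wcoord_nword // mcoeffU.
have [->|npt] := eqVneq p t; first by rewrite eqxx.
case: eqP => // E; case/eqP: npt.
by rewrite -(params_of_nword vp) E params_of_nword.
Qed.

(** Transposition of the operator: [up j p] is [t] exactly if [p] is [dn j t]. The coefficient
    vanishes at the top weight, where [up j p] leaves the valid range, and the guard excludes weight
    0, where [predn] stalls. *)
Lemma raise_coef (c : params -> C) j p t : valid p -> valid t ->
  (((slot j p).2 = 2 * (slot j p).1.2)%N -> c p = 0) ->
  c p * (wcoord (pw (nword (up j p))))@_(nword t) =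
  if (0 < (slot j t).2)%N then c (dn j t) * (wcoord (pw (nword p)))@_(nword (dn j t)) else 0.
Proof.
move=> vp vt c0; have vdt : valid (dn j t).
  by apply: valid_shift => //; apply: leq_trans (leq_pred _) (valid_slot j vt).
have [Etop|ntop] := eqVneq (slot j p).2 (2 * (slot j p).1.2)%N.
  rewrite c0 // mul0r; case: ifP => // pos; rewrite wcoord_nword_coef //.
  case: eqP => [E|_]; last by rewrite mulr0.
  move: Etop (valid_slot j vt); rewrite E slot_shift /=; lia.
have vup : valid (up j p).
  by apply: valid_shift => //; rewrite ltn_neqAle ntop valid_slot.
rewrite !wcoord_nword_coef //; case: (eqVneq (up j p) t) => [<-|nt].
  by rewrite slot_shift /= shiftK // eqxx.
rewrite mulr0; case: ifP => // pos; case: eqP => [E|_]; last by rewrite mulr0.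
by case/eqP: nt; rewrite E shiftK // prednK.
Qed.

Lemma lower_coef (c : params -> C) j p t : valid p -> valid t ->
  ((slot j p).2 = 0%N -> c p = 0) ->
  c p * (wcoord (pw (nword (dn j p))))@_(nword t) =
  if ((slot j t).2 < 2 * (slot j t).1.2)%N
  then c (up j t) * (wcoord (pw (nword p)))@_(nword (up j t)) else 0.
Proof.
move=> vp vt c0; have vdp : valid (dn j p).
  by apply: valid_shift => //; apply: leq_trans (leq_pred _) (valid_slot j vp).
have [E0|pos] := posnP (slot j p).2.
  rewrite c0 // mul0r; case: ifP => // lt.
  rewrite wcoord_nword_coef //; last exact: valid_shift.
  by case: eqP => [E|_]; rewrite ?mulr0 //; move: E0; rewrite E slot_shift.
rewrite wcoord_nword_coef //; case: eqP => [<-|nt].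
  rewrite slot_shift /= prednK // (valid_slot j vp) shiftK ?prednK //.
  by rewrite wcoord_nword_coef // eqxx.
rewrite mulr0; case: ifP => // lt; rewrite wcoord_nword_coef //; last exact: valid_shift.
by case: eqP => [E|_]; rewrite ?mulr0 //; case: nt; rewrite E shiftK.
Qed.

Definition e_slot_coef (j : nat) (p : params) : C :=
  let: ((i1, n1, a1), (i2, n2, a2), (i3, n3, a3)) := p in
  match j with
  | 0%N => e_coef n1 a1
  | 1%N => (k_coef n1 a1)^-1 * e_coef n2 a2
  | _ => (k_coef n1 a1)^-1 * (k_coef n2 a2)^-1 * e_coef n3 a3
  end.
Definition f_slot_coef (j : nat) (p : params) : C :=
  let: ((i1, n1, a1), (i2, n2, a2), (i3, n3, a3)) := p in
  match j with
  | 0%N => k_coef n2 a2 * k_coef n3 a3 * f_coef n1 a1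
  | 1%N => k_coef n3 a3 * f_coef n2 a2
  | _ => f_coef n3 a3
  end.

Lemma e_coef_top n : e_coef n (2 * n) = 0.
Proof.
rewrite /e_coef leq_pmull // subnn /e_coef_d expr0.
by rewrite subrr mulr0 mul0r.
Qed.

Lemma f_coef_bot n : f_coef n 0 = 0.
Proof. by rewrite /f_coef /= /f_coef_d expr0 subrr !mul0r. Qed.

Lemma e_slot_coef_top j p : ((slot j p).2 = 2 * (slot j p).1.2)%N -> e_slot_coef j p = 0.
Proof.
case: p => [[[[i1 n1] a1] [[i2 n2] a2]] [[i3 n3] a3]].
by case: j => [|[|j]] /= ->; rewrite e_coef_top ?mulr0.
Qed.

Lemma f_slot_coef_bot j p : (slot j p).2 = 0%N -> f_slot_coef j p = 0.
Proof.
case: p => [[[[i1 n1] a1] [[i2 n2] a2]] [[i3 n3] a3]].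
by case: j => [|[|j]] /= ->; rewrite f_coef_bot ?mulr0.
Qed.

Lemma fil_ext d (L : A -> C) : (forall c z z', L (c *: z + z') = c * L z + L z') ->
  (forall p, valid p -> (pdeg p <= d)%N -> L (pw (nword p)) = 0) ->
  forall z, fil d.+1 z -> L z = 0.
Proof.
move=> Llin L0 z fz; rewrite (wcoord_sum q_neq0 A_presented z) /mlin big_seq.
have L00 : L 0 = 0 by have := Llin (-1) 0 0; rewrite scaler0 addr0 mulN1r addNr.
elim/big_rec: _ => [//|w z' wz IH].
rewrite -mcoeff_neq0 in wz; have [I wl] := wcoord_normal q_neq0 wz.
have [v E] := normal_params wl I.
rewrite Llin IH addr0 (irreducible_nword wl I) L0 ?mulr0 // E -ltnS.
exact: fil_lt fz wz.
Qed.

Lemma eqN_coef d z z' w : eqN d z z' -> (d <= wsum Nweight w)%N ->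
  (wcoord z)@_w = (wcoord z')@_w.
Proof.
move=> ez le; apply/eqP; rewrite -subr_eq0 -mcoeffB; apply/negPn/negP.
rewrite -scaleN1r -(wcoordZ q_neq0) -wcoordD // scaleN1r => /(fil_lt ez).
by rewrite ltnNge le.
Qed.

Lemma coef_lin (g : A -> A) w : (forall c z z', g (c *: z + z') = c *: g z + g z') ->
  forall c z z', (wcoord (g (c *: z + z')))@_w = c * (wcoord (g z))@_w + (wcoord (g z'))@_w.
Proof. by move=> gl c z z'; rewrite gl wcoord_is_linear // mcoeffD mcoeffZ. Qed.

Lemma if_lin (b : bool) (c s x y y' : C) : y = c * x + y' ->
  (if b then s * y else 0) = c * (if b then s * x else 0) + (if b then s * y' else 0).
Proof. by move->; case: b; rewrite ?mulrDr 1?mulrCA // mulr0 addr0. Qed.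

Lemma mcoeff_sum3 (x y z : {malg C[word]}) w a b c :
  (a *: x + b *: y + c *: z)@_w = a * x@_w + (b * y@_w + c * z@_w).
Proof. by rewrite !mcoeffD !mcoeffZ addrA. Qed.

(** Coordinates of top degree of e z depend only on those of z, since the errors in [e_nword] have
    too small a degree to reach [t]. This gives the linear equations satisfied by an invariant. *)
Lemma e_extract t z : valid t -> fil (pdeg t).+1 z -> (wcoord (e z))@_(nword t) =
  \sum_(j < 3) if (0 < (slot j t).2)%N
    then e_slot_coef j (dn j t) * (wcoord z)@_(nword (dn j t)) else 0.
Proof.
move=> vt fz; apply/eqP; rewrite -subr_eq0; apply/eqP; move: z fz.
apply: fil_ext => [c z z'|p vp le].
  rewrite (coef_lin _ (actP _)) mulrBr addrACA -opprD; congr (_ - _).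
  rewrite mulr_sumr -big_split; apply: eq_bigr => j _ /=.
  by apply: if_lin; rewrite (wcoord_is_linear q_neq0) mcoeffD mcoeffZ.
apply/eqP; rewrite subr_eq0; apply/eqP.
have le' : (pdeg p <= wsum Nweight (nword t))%N by rewrite Nweight_nword.
transitivity (\sum_(j < 3) e_slot_coef j p * (wcoord (pw (nword (up j p))))@_(nword t)).
  rewrite !big_ord_recl big_ord0 addr0.
  case: p vp le le' => [[[[i1 n1] a1] [[i2 n2] a2]] [[i3 n3] a3]] /and3P[v1 v2 v3] le le'.
  rewrite (eqN_coef (e_nword i1 i2 i3 v1 v2 v3) le') !(wcoordD q_neq0) !(wcoordZ q_neq0).
  exact: mcoeff_sum3.
apply: eq_bigr => j _; apply: raise_coef => //; exact: e_slot_coef_top.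
Qed.

Lemma f_extract t z : valid t -> fil (pdeg t).+1 z -> (wcoord (f z))@_(nword t) =
  \sum_(j < 3) if ((slot j t).2 < 2 * (slot j t).1.2)%N
    then f_slot_coef j (up j t) * (wcoord z)@_(nword (up j t)) else 0.
Proof.
move=> vt fz; apply/eqP; rewrite -subr_eq0; apply/eqP; move: z fz.
apply: fil_ext => [c z z'|p vp le].
  rewrite (coef_lin _ (actP _)) mulrBr addrACA -opprD; congr (_ - _).
  rewrite mulr_sumr -big_split; apply: eq_bigr => j _ /=.
  by apply: if_lin; rewrite (wcoord_is_linear q_neq0) mcoeffD mcoeffZ.
apply/eqP; rewrite subr_eq0; apply/eqP.
have le' : (pdeg p <= wsum Nweight (nword t))%N by rewrite Nweight_nword.
transitivity (\sum_(j < 3) f_slot_coef j p * (wcoord (pw (nword (dn j p))))@_(nword t)).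
  rewrite !big_ord_recl big_ord0 addr0.
  case: p vp le le' => [[[[i1 n1] a1] [[i2 n2] a2]] [[i3 n3] a3]] /and3P[v1 v2 v3] le le'.
  rewrite (eqN_coef (f_nword i1 i2 i3 v1 v2 v3) le') !(wcoordD q_neq0) !(wcoordZ q_neq0).
  exact: mcoeff_sum3.
apply: eq_bigr => j _; apply: lower_coef => //; exact: f_slot_coef_bot.
Qed.

Lemma k_extract t z : valid t -> fil (pdeg t).+1 z -> (wcoord (k z))@_(nword t) =
  k_coef (pdeg t) ((slot 0 t).2 + (slot 1 t).2 + (slot 2 t).2) * (wcoord z)@_(nword t).
Proof.
move=> vt fz; apply/eqP; rewrite -subr_eq0; apply/eqP; move: z fz.
apply: fil_ext => [c z z'|p vp le].
  rewrite (coef_lin _ (actP _)) mulrBr addrACA -opprD; congr (_ - _).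
  by rewrite (wcoord_is_linear q_neq0) mcoeffD mcoeffZ mulrDr mulrCA.
apply/eqP; rewrite subr_eq0; apply/eqP.
have [<-|npt] := eqVneq p t.
  case: p vp {le} => [[[[i1 n1] a1] [[i2 n2] a2]] [[i3 n3] a3]] /and3P[v1 v2 v3].
  by rewrite k_nword // (wcoordZ q_neq0) mcoeffZ.
rewrite wcoord_nword_coef // (negPf npt) mulr0.
move: vp npt {le}; case: p => [[[[i1 n1] a1] [[i2 n2] a2]] [[i3 n3] a3]] vp npt.
have /and3P[v1 v2 v3] := vp.
by rewrite k_nword // (wcoordZ q_neq0) mcoeffZ wcoord_nword_coef // (negPf npt) mulr0.
Qed.

End Action.

(** * Nonvanishing of the coefficients for generic q *)

Section Generic.
Variables (C : numClosedFieldType) (q : C).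
Hypothesis q_neq0 : q != 0.
Hypothesis q_generic : forall n : nat, (0 < n)%N -> q ^+ n != 1.

Local Notation Q := (q ^+ 2).
Local Notation R := (q ^- 2).

Lemma q2_neq1 : q ^+ 2 != 1. Proof. exact: q_generic. Qed.

Lemma Qpow_neq1 n : (0 < n)%N -> Q ^+ n != 1.
Proof. by move=> n0; rewrite -exprM; apply: q_generic; rewrite muln_gt0. Qed.

Lemma Rpow_neq1 n : (0 < n)%N -> R ^+ n != 1.
Proof. by move=> n0; rewrite exprVn invr_eq1 Qpow_neq1. Qed.

Let Qn0 n : Q ^+ n != 0. Proof. by rewrite !expf_neq0. Qed.

Lemma e_coef_neq0 n a : (a < 2 * n)%N -> e_coef q n a != 0.
Proof.
move=> lt; have R1 := R1_neq0 q2_neq1; rewrite /e_coef; case: leqP => na.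
  rewrite /e_coef_d mulf_neq0 ?invr_neq0 // mulf_neq0 ?oppr_eq0 //.
  by rewrite subr_eq0 eq_sym Rpow_neq1 // subn_gt0.
(* The two contributions merge into one difference of powers, which vanishes only if Q^(2 n - a) =
   1. *)
have -> : e_coef_m q (n - a) - q ^- 4 * e_coef_d q a =
    q ^- 3 * (Q ^+ (n - a) * Q ^+ (n - a) - R ^+ a) / (1 - R).
  rewrite /e_coef_m /e_coef_d; move: R1; set r := q ^- 2.
  move: (Q ^+ _) (r ^+ a) => x y r1; rewrite /r in r1 *; field; rewrite q_neq0 /=.
  have -> : q ^+ 2 - 1 = q ^+ 2 * (1 - q ^- 2) by field.
  by rewrite mulf_neq0 ?expf_neq0.
rewrite mulf_neq0 ?invr_neq0 // mulf_neq0 ?invr_neq0 ?expf_neq0 // subr_eq0.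
apply/eqP => E; have : Q ^+ (n - a + (n - a) + a) == 1.
  by rewrite exprD exprD E exprVn mulVf.
by apply/negP/Qpow_neq1; lia.
Qed.

Lemma f_coef_neq0 n a : (0 < a)%N -> (a <= 2 * n)%N -> f_coef q n a != 0.
Proof.
move=> a0 le; have Q1 := Q1_neq0 q2_neq1; rewrite /f_coef; case: leqP => na.
  rewrite mulf_neq0 ?expf_neq0 ?invr_neq0 ?expf_neq0 // mulf_neq0 ?invr_neq0 //.
  by rewrite subr_eq0 Qpow_neq1.
(* Again a single difference, which vanishes only if Q^a = 1. *)
have -> : f_coef_p q (a - n) - f_coef_d q (2 * n - a) * Q ^+ (a - n) =
    (R ^+ (a - n) - Q ^+ (2 * n - a) * Q ^+ (a - n)) / (Q - 1).
  rewrite /f_coef_p /f_coef_d; move: (Q ^+ (2 * n - a)) (Q ^+ (a - n)) (R ^+ _) => x y z.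
  by field.
rewrite mulf_neq0 ?invr_neq0 // subr_eq0.
apply/eqP => E; have : Q ^+ (2 * n - a + (a - n) + (a - n)) == 1.
  by rewrite exprD exprD -E exprVn mulVf.
by apply/negP/Qpow_neq1; lia.
Qed.

Lemma k_coef_eq1 n a : k_coef q n a = 1 -> a = n.
Proof.
rewrite /k_coef exprVn => E.
have {}E : Q ^+ a = Q ^+ n by apply: (mulIf (invr_neq0 (Qn0 n))); rewrite E mulfV.
case: (ltngtP a n) => // lt.
  have : Q ^+ (n - a) == 1 by rewrite expfB // E mulfV.
  by rewrite (negPf (Qpow_neq1 _)) // subn_gt0.
have : Q ^+ (a - n) == 1 by rewrite expfB // E mulfV.
by rewrite (negPf (Qpow_neq1 _)) // subn_gt0.
Qed.

End Generic.

(** The excesses n1 + n2 - n3, n1 + n3 - n2, n2 + n3 - n1 must be 2 m + d, 2 n + d, 2 l + d. They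
    have the same parity, so taking d to be the least of them makes the halves exact and one of m,
    n, l zero. *)
Lemma triangle_exponents n1 n2 n3 : (n1 <= n2 + n3)%N -> (n2 <= n1 + n3)%N -> (n3 <= n1 + n2)%N ->
  exists m n l d, [/\ n1 = m + n + d, n2 = m + l + d, n3 = n + l + d
    & [|| m == 0, n == 0 | l == 0]]%N.
Proof.
move=> h1 h2 h3; pose d := minn (n1 + n2 - n3) (minn (n1 + n3 - n2) (n2 + n3 - n1)).
exists ((n1 + n2 - n3 - d) %/ 2)%N, ((n1 + n3 - n2 - d) %/ 2)%N, ((n2 + n3 - n1 - d) %/ 2)%N, d.
by rewrite /d {d}; split; lia.
Qed.

(** * The leading coordinate of an invariant *)

Section Invariants.
Variables (C : numClosedFieldType) (q : C).
Hypothesis q_neq0 : q != 0.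
Hypothesis q_generic : forall n : nat, (0 < n)%N -> q ^+ n != 1.
Variables (A : algType C) (M : 'I_3 -> 'M[A]_2).
Hypothesis A_presented : is_sphere_algebra q M.
Variables (U : algType C) (ug : uq_gen -> U) (eps : {lrmorphism U -> C^o}).
Variable act : U -> A -> A.
Hypothesis U_presented : is_Uq_sl2 q ug.
Hypothesis eps_counit : is_counit ug eps.
Hypothesis act_module_algebra : module_algebra ug eps act.
Hypothesis act_generators : acts_on_generators q ug act M.
Local Notation pg := (letter_elt q M).
Local Notation pw := (wprod pg).
Local Notation wcoord := (wcoord A_presented).
Local Notation fil := (fil A_presented Nweight).
Local Notation e := (act (ug uE)).
Local Notation f := (act (ug uF)).
Local Notation k := (act (ug uK)).
Local Notation ki := (act (ug uKi)).
Local Notation Q1 := (q2_neq1 q_generic).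

(** The coordinates of z with the central exponents and block degrees of [p] form an array to which
    [invariant_array] applies; the coordinate that it shows to be nonzero is the leading word of a
    monomial. *)
Lemma invariant_top z p : e z = 0 -> f z = 0 -> k z = z ->
  valid p -> fil (pdeg p).+1 z -> (wcoord z)@_(nword p) != 0 ->
  exists i, [/\ inv_exp_ok i, pdeg (inv_params i) = pdeg p
    & (wcoord z)@_(nword (inv_params i)) != 0].
Proof.
move=> ez fz kz; case: p => [[[[i1 n1] b1] [[i2 n2] b2]] [[i3 n3] b3]] vp filz nzb.
pose P a1 a2 a3 : params := ((i1, n1, a1), (i2, n2, a2), (i3, n3, a3)).
(* The value 0 outside the valid range makes the weight condition hold for all indices, as
   [invariant_array] requires. *)
pose F a1 a2 a3 := if valid (P a1 a2 a3) then (wcoord z)@_(nword (P a1 a2 a3)) else 0.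
have vP a1 a2 a3 : (a1 <= 2 * n1)%N -> (a2 <= 2 * n2)%N -> (a3 <= 2 * n3)%N -> valid (P a1 a2 a3).
  by move=> *; apply/and3P.
have FP a1 a2 a3 : valid (P a1 a2 a3) -> F a1 a2 a3 = (wcoord z)@_(nword (P a1 a2 a3)).
  by rewrite /F => ->.
have le_pred a n : (a <= n)%N -> (a.-1 <= n)%N by apply: leq_trans (leq_pred a).
have Hw a1 a2 a3 : F a1 a2 a3 != 0 -> (a1 + a2 + a3 = n1 + n2 + n3)%N.
  rewrite /F; case: ifP => [v nz|_]; last by rewrite eqxx.
  have := k_extract q_neq0 eps_counit act_module_algebra act_generators Q1 v filz.
  rewrite kz -[LHS]mul1r => /(mulIf nz)/esym; exact: k_coef_eq1.
have He a1 a2 a3 : (a1 <= 2 * n1)%N -> (a2 <= 2 * n2)%N -> (a3 <= 2 * n3)%N ->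
    exists x y w, ((0 < a1)%N -> x != 0) /\
    (if (0 < a1)%N then x * F a1.-1 a2 a3 else 0) +
    (if (0 < a2)%N then y * F a1 a2.-1 a3 else 0) +
    (if (0 < a3)%N then w * F a1 a2 a3.-1 else 0) = 0.
  move=> l1 l2 l3.
  have := e_extract q_neq0 U_presented eps_counit act_module_algebra act_generators Q1
    (vP _ _ _ l1 l2 l3) filz.
  rewrite ez (wcoord0 q_neq0) mcoeff0 => /esym.
  rewrite big_ord_recl big_ord_recl big_ord_recl big_ord0 addr0 addrA => E.
  do 3 eexists; split; last first.
    by rewrite !FP; [exact: E | | | ]; apply: vP => //; apply: le_pred.
  by move=> a0; apply: e_coef_neq0 => //; rewrite prednK.
have Hf a1 a2 a3 : (a1 <= 2 * n1)%N -> (a2 <= 2 * n2)%N -> (a3 <= 2 * n3)%N ->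
    exists x y w, [/\ (a2 < 2 * n2)%N -> y != 0, (a3 < 2 * n3)%N -> w != 0 &
    (if (a1 < 2 * n1)%N then x * F a1.+1 a2 a3 else 0) +
    (if (a2 < 2 * n2)%N then y * F a1 a2.+1 a3 else 0) +
    (if (a3 < 2 * n3)%N then w * F a1 a2 a3.+1 else 0) = 0].
  move=> l1 l2 l3.
  have := f_extract q_neq0 eps_counit act_module_algebra act_generators Q1
    (vP _ _ _ l1 l2 l3) filz.
  rewrite fz (wcoord0 q_neq0) mcoeff0 => /esym.
  rewrite big_ord_recl big_ord_recl big_ord_recl big_ord0 addr0 addrA => E.
  do 3 eexists; split; last first.
  - move: E; rewrite /F.
    have [l1'|_] := boolP (a1 < 2 * n1)%N; have [l2'|_] := boolP (a2 < 2 * n2)%N;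
      have [l3'|_] := boolP (a3 < 2 * n3)%N; rewrite ?vP //; exact.
  - by move=> lt; apply: f_coef_neq0.
  - by move=> lt; rewrite mulf_neq0 ?k_coef_neq0 ?f_coef_neq0.
have /and3P[v1 v2 v3] := vp.
have nzF : F b1 b2 b3 != 0 by rewrite FP.
have [nz h1 h2 h3] := invariant_array Hw He Hf v1 v2 v3 nzF.
have [m [n [l [d [E1 E2 E3 ok]]]]] := triangle_exponents h1 h2 h3.
exists ((m, n, l), (i1, i2, i3, d)); split=> //.
  by rewrite /pdeg /= E1 E2 E3.
(* This is the middle weight index in [inv_params]. *)
move: nz; rewrite /F /P; have -> : (n2 + n3 - n1 = 2 * l + d)%N by lia.
by rewrite E1 E2 E3; case: ifP => //; rewrite eqxx.
Qed.

End Invariants.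

(** * Invariance of the q-traces *)

Section Covariance.
Variables (C : numClosedFieldType) (q : C).
Hypothesis q_neq0 : q != 0.
Variables (A : algType C) (M : 'I_3 -> 'M[A]_2).
Variables (U : algType C) (ug : uq_gen -> U) (eps : {lrmorphism U -> C^o}).
Variable act : U -> A -> A.
Hypothesis U_presented : is_Uq_sl2 q ug.
Hypothesis eps_counit : is_counit ug eps.
Hypothesis act_module_algebra : module_algebra ug eps act.
Hypothesis act_generators : acts_on_generators q ug act M.
Local Notation e := (act (ug uE)).
Local Notation f := (act (ug uF)).
Local Notation k := (act (ug uK)).
Local Notation ki := (act (ug uKi)).

Let eM := eM act_module_algebra.
Let fM := fM act_module_algebra.
Let kM := kM act_module_algebra.
Let aD := actD act_module_algebra.
Let aZ := actZ act_module_algebra.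

Definition covariant (X : 'M[A]_2) : Prop :=
  let x11 := X 0 0 in let x12 := X 0 1 in
  let x21 := X 1 0 in let x22 := X 1 1 in
  [/\ [/\ k x11 = x11, k x12 = q ^+ 2 *: x12,
          k x21 = q ^- 2 *: x21 & k x22 = x22],
      [/\ e x11 = q^-1 *: x12, e x12 = 0,
          e x21 = q *: (x22 - x11) & e x22 = - (q *: x12)]
    & [/\ f x11 = - (q ^- 2 *: x21), f x12 = x11 - x22,
          f x21 = 0 & f x22 = x21]].

(** The action on the entries of A, B and C depends only on their position, and these formulas
    persist under matrix products. So the invariance of all seven generators reduces to that of a
    q-trace. *)
Lemma covariantM X Y : covariant X -> covariant Y -> covariant (X *m Y).
Proof.
move=> [[kx11 kx12 kx21 kx22] [ex11 ex12 ex21 ex22] [fx11 fx12 fx21 fx22]].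
move=> [[ky11 ky12 ky21 ky22] [ey11 ey12 ey21 ey22] [fy11 fy12 fy21 fy22]].
have Q0 : q ^+ 2 != 0 by rewrite expf_neq0.
have kiE c z : c != 0 -> k z = c *: z -> ki z = c^-1 *: z.
  exact: (ki_eigen U_presented act_module_algebra).
have kiI z : k z = z -> ki z = z.
  by move=> kz; rewrite (kiE 1) ?oner_neq0 ?invr1 ?scale1r.
have kix11 := kiI _ kx11; have kix22 := kiI _ kx22.
have kix12 : ki (X 0 1) = q ^- 2 *: X 0 1.
  exact: kiE.
have kix21 : ki (X 1 0) = q ^+ 2 *: X 1 0.
  by rewrite -[q ^+ 2]invrK; apply: kiE; rewrite ?invr_eq0.
have XY i j : (X *m Y) i j = X i 0 * Y 0 j + X i 1 * Y 1 j.
  by rewrite mxE big_ord_recl big_ord1; congr (X i 0 * Y 0 j + X i _ * Y _ j); apply: val_inj.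
have q21 : q ^- 2 * q = q^-1 by field.
have q2i : q ^+ 2 * q^-1 = q by field.
rewrite /covariant !XY !aD !kM !eM !fM kx11 kx12 kx21 kx22 ky11 ky12 ky21 ky22.
rewrite ex11 ex12 ex21 ex22 ey11 ey12 ey21 ey22 fx11 fx12 fx21 fx22 fy11 fy12 fy21 fy22.
rewrite kix11 kix12 kix21 kix22 !mul0r !mulr0 !mulNr !mulrN.
rewrite -!scalerAl -!scalerAr !scalerA mulVf // mulfV // q21 q2i !scale1r ?addr0 ?add0r.
rewrite !mulrBl !mulrBr !scalerDr !scalerN ?opprD ?opprK.
move: (X 0 0 * Y 0 0) (X 0 1 * Y 1 0) (X 0 0 * Y 0 1) (X 0 1 * Y 1 1) => a b c d.
move: (X 1 0 * Y 0 0) (X 1 1 * Y 1 0) (X 1 0 * Y 0 1) (X 1 1 * Y 1 1) => a' b' c' d'.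
have cancel x y z : x + y + (z - x) = y + z :> A.
  by rewrite [x + y]addrC addrACA subrr addr0.
have cancel3 x y z t u : x - y + z + (- t + (u - x)) = z + u - (y + t) :> A.
  by rewrite -[x - y + z]addrA [- t + _]addrA cancel addrACA -opprD addrC.
have cancel4 x y z t u : - z + (t - x) + (x - y + u) = t + u + (- z - y) :> A.
  by rewrite [- z + _]addrA -[x - y + u]addrA subrKA addrACA addrC.
do !split.
- exact: cancel.
- exact: subrr.
- by rewrite scalerDr cancel3.
- exact: cancel.
- exact: subrKA.
- exact: cancel4.
- exact: addNr.
- exact: subrKA.
Qed.

Lemma covariant_gen s : covariant (M s).
Proof. exact: act_generators. Qed.

Definition gen_invariant (z : A) : Prop := [/\ e z = 0, f z = 0 & k z = z].

(** The weight q^-2 in the trace balances e X^1_1 = q^-1 X^1_2 against e X^2_2 = - q X^1_2, and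
    likewise for f. *)
Lemma qtrace_invariant X : covariant X -> gen_invariant (qtrace q X).
Proof.
move=> [[k11 _ _ k22] [e11 _ _ e22] [f11 _ _ f22]].
rewrite /gen_invariant /qtrace !aD !aZ k11 k22 e11 e22 f11 f22; split=> //.
  rewrite scalerN scalerA; have -> : q ^- 2 * q = q^-1 by field.
  exact: subrr.
exact: addNr.
Qed.

Lemma inv_elt_invariant g : gen_invariant (inv_elt q M g).
Proof.
by case: g; apply: qtrace_invariant; do ?apply: covariantM; apply: covariant_gen.
Qed.

Lemma gen_invariant1 : gen_invariant 1.
Proof.
split; [exact: (e1 eps_counit) | exact: (f1 eps_counit) | exact: (k1 eps_counit)].
Qed.

Lemma gen_invariantP c z z' : gen_invariant z -> gen_invariant z' -> gen_invariant (c *: z + z').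
Proof.
move=> [ez fz kz] [ez' fz' kz']; rewrite /gen_invariant !(actP act_module_algebra).
by rewrite ez fz kz ez' fz' kz' scaler0 addr0.
Qed.

Lemma gen_invariant_ki z : gen_invariant z -> ki z = z.
Proof. by case=> _ _ kz; rewrite -{1}kz (kiK U_presented act_module_algebra). Qed.

Lemma gen_invariantM z z' : gen_invariant z -> gen_invariant z' -> gen_invariant (z * z').
Proof.
move=> iz [ez' fz' kz']; case: (iz) => ez fz kz.
by rewrite /gen_invariant eM fM kM ez fz kz ez' fz' kz' !mul0r !mulr0 addr0.
Qed.

Lemma gen_invariant0 : gen_invariant 0.
Proof. by rewrite /gen_invariant !(act0 act_module_algebra). Qed.

Lemma gen_invariant_sum (I : Type) (s : seq I) (P : pred I) (c : I -> C) (g : I -> A) :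
  (forall i, P i -> gen_invariant (g i)) -> gen_invariant (\sum_(i <- s | P i) c i *: g i).
Proof.
move=> ig; elim/big_rec: _ => [|i z Pi iz]; first exact: gen_invariant0.
exact: gen_invariantP (ig i Pi) iz.
Qed.

Lemma gen_invariant_prod (g : inv_gen -> A) w : (forall x, gen_invariant (g x)) ->
  gen_invariant (\prod_(x <- w) g x).
Proof.
move=> ig; elim/big_rec: _ => [|i z _ iz]; first exact: gen_invariant1.
exact: gen_invariantM.
Qed.

Lemma gen_invariant_freeeval p : gen_invariant (freeeval (inv_elt q M) p).
Proof.
by apply: gen_invariant_sum => w _; apply: gen_invariant_prod; apply: inv_elt_invariant.
Qed.

(** Words in the generators span U, and invariance passes from letters to words; for k^-1 it follows
    from k because the two are inverse in U. *)
Lemma gen_invariantE z : gen_invariant z <-> Uq_invariant eps act z.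
Proof.
have [eE eF eK eKi] := eps_counit; split=> [iz h|iz]; last first.
  by split; rewrite iz ?eE ?eF ?eK ?scale0r ?scale1r.
have [p ->] : exists p, h = freeeval ug p by apply/U_presented.1.
have act_word w : act (\prod_(x <- w) ug x) z = eps (\prod_(x <- w) ug x) *: z.
  elim: w => [|x w IH].
    by rewrite big_nil (act_one act_module_algebra) rmorph1 scale1r.
  rewrite big_cons (act_comp act_module_algebra) IH aZ rmorphM mulrC -scalerA; congr (_ *: _).
  have [ez fz kz] := iz.
  by case: x => /=; [rewrite ez eE scale0r | rewrite fz eF scale0r | rewrite kz eK scale1r
    | rewrite (gen_invariant_ki iz) eKi scale1r].
have actl c h1 h2 : act (c *: h1 + h2) z = c *: act h1 z + act h2 z.
  exact: act_linearl act_module_algebra z c h1 h2.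
have act0z : act 0 z = 0 by have := actl (-1) 0 0; rewrite scaler0 addr0 scaleN1r addNr.
rewrite /freeeval; elim/big_rec: _ => [|w h' _ IH]; first by rewrite act0z linear0 scale0r.
by rewrite actl IH act_word linearP /= scalerDl scalerA.
Qed.

End Covariance.

(** * Basis and presentation of the invariants *)

(** The solution of [triangle_exponents] as a function; it recovers an admissible exponent from its
    leading word. *)
Definition inv_exp_of (p : params) : inv_exp :=
  let: ((a, n1, _), (b, n2, _), (c, n3, _)) := p in
  let d := minn (n1 + n2 - n3) (minn (n1 + n3 - n2) (n2 + n3 - n1)) in
  (((n1 + n2 - n3 - d) %/ 2, (n1 + n3 - n2 - d) %/ 2, (n2 + n3 - n1 - d) %/ 2)%N, (a, b, c, d)).

Lemma inv_paramsK i : inv_exp_ok i -> inv_exp_of (inv_params i) = i.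
Proof.
case: i => [[[m n] l] [[[a b] c] d]] ok.
have Ed : minn (m + n + d + (m + l + d) - (n + l + d)) (minn (m + n + d + (n + l + d) - (m + l + d))
    (m + l + d + (n + l + d) - (m + n + d))) = d.
  by case/or3P: ok => /eqP->; lia.
move: ok; rewrite /inv_exp_of /inv_params Ed => ok; congr pair; congr pair; [congr pair|]; lia.
Qed.

(** Collecting equal exponents brings a combination into the duplicate-free form in which
    independence is stated. *)
Lemma sum_pairs (R : pzRingType) (V : lmodType R) (I : eqType) (l : seq (R * I)) (b : I -> V) :
  \sum_(t <- l) t.1 *: b t.2 =
  \sum_(i <- undup (unzip2 l)) (\sum_(t <- l | t.2 == i) t.1) *: b i.
Proof.
under [RHS]eq_bigr do rewrite scaler_suml.
rewrite (exchange_big_dep xpredT) //= big_seq [RHS]big_seq; apply: eq_bigr => t tl.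
rewrite big_mkcond (bigD1_seq t.2) ?undup_uniq ?mem_undup ?map_f //= eqxx big1 ?addr0 // => i.
by rewrite eq_sym => /negPf->.
Qed.

Lemma inv_rels_morph (C : numClosedFieldType) (q : C) (B B' : lalgType C)
    (phi : {rmorphism B -> B'}) (g : inv_gen -> B) (g' : inv_gen -> B') r :
  scalable phi -> (forall y, phi (g y) = g' y) -> inv_rels q g r -> inv_rels q g' (phi r).
Proof.
move=> phiZ Eg; case=> [[y [y' [my ->]]]|].
  by left; exists y, y'; split=> //; rewrite rmorphB !rmorphM; rewrite !Eg.
rewrite /inv_rels !inE => H; right.
have morph := (rmorphB, rmorphD, rmorphM, rmorphN, phiZ, rmorphXn, rmorph1, Eg).
by case/or4P: H => /eqP->; rewrite !morph /= ?eqxx ?orbT.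
Qed.

Section FreeEval.
Variables (C : fieldType) (X : choiceType) (A : algType C) (g : X -> A).
Lemma freeeval_monoid_morphism : monoid_morphism (freeeval g).
Proof. by split; [exact: freeeval1 | exact: freeevalM]. Qed.
HB.instance Definition _ :=
  GRing.isMonoidMorphism.Build (freealg C X) A (freeeval g) freeeval_monoid_morphism.
Lemma freeevalZ : scalable (freeeval g).
Proof. by move=> c p; rewrite linearZ. Qed.
End FreeEval.

Section Presentation.
Variables (C : numClosedFieldType) (q : C).
Hypothesis q_neq0 : q != 0.
Hypothesis q_generic : forall n : nat, (0 < n)%N -> q ^+ n != 1.
Variables (A : algType C) (M : 'I_3 -> 'M[A]_2).
Hypothesis A_presented : is_sphere_algebra q M.
Local Notation x := (inv_elt q M).
Local Notation mono := (inv_monomial x).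
Local Notation wcoord := (wcoord A_presented).
Local Notation fil := (fil A_presented Nweight).
Local Notation deg i := (pdeg (inv_params i)).

Lemma wcoord_lsum (I : Type) (s : seq I) (c : I -> C) (g : I -> A) w :
  (wcoord (\sum_(i <- s) c i *: g i))@_w = \sum_(i <- s) c i * (wcoord (g i))@_w.
Proof.
elim: s => [|i s IH]; first by rewrite !big_nil (wcoord0 q_neq0) mcoeff0.
by rewrite !big_cons (wcoord_is_linear q_neq0) mcoeffD mcoeffZ IH.
Qed.

(** Descending induction on the degree: in the coordinate at the leading word of i, monomials of
    smaller or equal degree other than i are absent, and those of larger degree have coefficient 0
    by induction. *)
Lemma inv_monomial_free (s : seq inv_exp) (c : inv_exp -> C) :
  uniq s -> all inv_exp_ok s -> \sum_(i <- s) c i *: mono i = 0 ->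
  forall i, i \in s -> c i = 0.
Proof.
move=> us ok E; pose B := \max_(i <- s) deg i.
move=> i; have [n] := ubnP (B - deg i); elim: n i => // n IH i ltn si.
have oki := allP ok _ si.
have := congr1 (fun z => (wcoord z)@_(nword (inv_params i))) E.
rewrite /= wcoord_lsum (wcoord0 q_neq0) mcoeff0 (bigD1_seq i) //= big_seq_cond big1 ?addr0.
  move/eqP; rewrite mulf_eq0 => /orP[/eqP//|].
  by rewrite -[_ == 0]negbK (inv_monomial_coef q_neq0) ?eqxx.
move=> j /andP[sj nij]; case: (leqP (deg j) (deg i)) => [le|lt].
  have := inv_monomial_coef q_neq0 A_presented le (allP ok _ sj) oki.
  by rewrite (negPf nij) => /negPn/eqP->; rewrite mulr0.
have leB : (deg j <= B)%N by exact: leq_bigmax_seq.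
rewrite IH ?mul0r //; apply: leq_trans (ltn_sub2l _ lt) _; last by rewrite -ltnS.
exact: leq_trans lt leB.
Qed.

Variables (U : algType C) (ug : uq_gen -> U) (eps : {lrmorphism U -> C^o}).
Variable act : U -> A -> A.
Hypothesis U_presented : is_Uq_sl2 q ug.
Hypothesis eps_counit : is_counit ug eps.
Hypothesis act_module_algebra : module_algebra ug eps act.
Hypothesis act_generators : acts_on_generators q ug act M.
Local Notation gen_invariant := (gen_invariant ug act).

Lemma freeeval_word i : freeeval x (free_word C (inv_word i)) = mono i.
Proof.
case: i => [[[m n] l] [[[a b] c] d]]; rewrite /free_word freeeval_prod /inv_word !big_cat /=.
by rewrite !prod_nseq !mulrA.
Qed.

Lemma inv_monomial_invariant i : gen_invariant (mono i).
Proof.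
rewrite -freeeval_word.
exact: (gen_invariant_freeeval q_neq0 U_presented eps_counit act_module_algebra act_generators).
Qed.

Lemma fil_all z : exists N, fil N z.
Proof.
exists (\max_(w <- msupp (wcoord z)) wsum Nweight w).+1; apply: Fil => w nz.
by rewrite ltnS; apply: leq_bigmax_seq => //; rewrite -mcoeff_neq0.
Qed.

(** In the top degree, the coordinates of the monomials at each other's leading words form a
    diagonal matrix, so all leading coordinates of z can be cleared at once. The remainder is an
    invariant of lower degree. *)
Lemma invariant_span N z : gen_invariant z -> fil N z ->
  exists2 l : seq (C * inv_exp), all (fun t => inv_exp_ok t.2) l &
    z = \sum_(t <- l) t.1 *: mono t.2.
Proof.
elim: N z => [|N IH] z iz fz.
  exists [::] => //; rewrite big_nil (wcoord_sum q_neq0 A_presented z).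
  suff -> : wcoord z = 0 by rewrite linear0.
  apply/malgP => w; rewrite mcoeff0; apply/eqP/negPn/negP => /(fil_lt fz).
  by rewrite ltn0.
pose cf y i := (wcoord y)@_(nword (inv_params i)).
(* Finitely many candidates, read off from the words of z; at any other admissible leading word of
   this degree z already has coordinate 0. *)
pose I := undup [seq i <- map (inv_exp_of \o params_of) (msupp (wcoord z))
                   | inv_exp_ok i && (deg i == N)].
have memI i : i \in I -> inv_exp_ok i /\ deg i = N.
  by rewrite mem_undup mem_filter => /andP[/andP[-> /eqP->]].
pose c i := cf z i / cf (mono i) i.
pose z' := z - \sum_(i <- I) c i *: mono i.
have iz' : gen_invariant z'.
  rewrite /z' addrC -scaleN1r; apply: (gen_invariantP act_module_algebra) => //.
  by apply: (gen_invariant_sum act_module_algebra) => i _; apply: inv_monomial_invariant.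
have fz' : fil N.+1 z'.
  apply: (filB q_neq0) => //; apply: (fil_sum q_neq0) => i /memI[_ <-].
  exact: inv_monomial_fil.
have coef0 j : inv_exp_ok j -> deg j = N -> cf z' j = 0.
  move=> okj dj; rewrite /cf /z' -scaleN1r addrC (wcoord_is_linear q_neq0) mcoeffD mcoeffZ.
  rewrite wcoord_lsum mulN1r addrC; apply/eqP; rewrite subr_eq0; apply/eqP.
  have off i : i \in I -> i != j -> c i * cf (mono i) j = 0.
    case/memI => oki di nij; have := @inv_monomial_coef _ _ q_neq0 _ _ A_presented i j.
    by rewrite di dj (negPf nij) => /(_ (leqnn _) oki okj)/negPn/eqP E; rewrite /cf E mulr0.
  have [jI|jI] := boolP (j \in I).
    rewrite (bigD1_seq j) ?undup_uniq //= big_seq_cond big1 ?addr0.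
      rewrite /c divfK // /cf (inv_monomial_coef q_neq0) //.
    by move=> i /andP[iI nij]; apply: off.
  rewrite big_seq big1.
    apply/eqP/negPn/negP => nz; case/negP: jI; rewrite mem_undup mem_filter okj dj eqxx /=.
    apply/mapP; exists (nword (inv_params j)); first by rewrite -mcoeff_neq0.
    by rewrite -[LHS](inv_paramsK okj) -{1}(params_of_nword (inv_params_valid j)).
  move=> i iI; apply: off => //; apply: contraNneq jI => <-; exact: iI.
(* A word of degree N in z' would, by [invariant_top], entail a nonzero coordinate at an admissible
   leading word of degree N, and these have all been cleared. *)
have fz'N : fil N z'.
  apply: Fil => w nz; have := fil_lt fz' nz; rewrite ltnS leq_eqVlt => /orP[/eqP Ew|//].
  have [I_w w_l] := wcoord_normal q_neq0 nz.
  have [v d] := normal_params w_l I_w.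
  have ew := irreducible_nword w_l I_w.
  have [ez fz0 kz] := iz'.
  have [||j [okj dj]] := invariant_top q_neq0 q_generic U_presented eps_counit act_module_algebra
    act_generators ez fz0 kz v (A_presented := A_presented).
  - by rewrite d Ew.
  - by rewrite -ew.
  by rewrite -/(cf z' j) coef0 ?eqxx // dj d.
have [l okl El] := IH z' iz' fz'N.
exists ([seq (c i, i) | i <- I] ++ l).
  rewrite all_cat okl andbT all_map; apply/allP => i /memI[]; done.
by rewrite big_cat big_map /= -El /z' addrC subrK.
Qed.

(** Modulo the relations p is a combination of the monomials of the basis. If p evaluates to 0, so
    does this combination, and independence of the monomials makes its collected coefficients
    vanish. *)
Lemma inv_kernel p : freeeval x p = 0 <->
  in_ideal (inv_rels q (@freevar C inv_gen)) p.
Proof.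
split=> [p0|]; last first.
  apply: freeeval_ideal => r /(inv_rels_morph (phi := freeeval x) (freeevalZ x) (freeeval_var x)).
  exact: inv_elt_rels.
have [l okl idl] := ok_span_all q_neq0 p.
set L := \sum_(t <- l) _ in idl.
suff L0 : L = 0 by move: idl; rewrite L0 subr0.
have /eqP := freeeval_ideal (fun r rr => inv_elt_rels q_neq0 A_presented
  (inv_rels_morph (phi := freeeval x) (freeevalZ x) (freeeval_var x) rr)) idl.
rewrite linearB /= p0 sub0r oppr_eq0 /L linear_sum /=.
under eq_bigr do rewrite linearZ /= freeeval_word.
rewrite (sum_pairs l mono) => /eqP/inv_monomial_free c0.
rewrite (sum_pairs l (fun i => free_word C (inv_word i))) big_seq big1 // => i il.
rewrite c0 ?scale0r ?undup_uniq //.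
apply/allP => j; rewrite mem_undup => /mapP[t tl ->]; exact: (allP okl).
Qed.

Lemma invariants_presented : presented_by (Uq_invariant eps act) x (inv_rels q).
Proof.
split=> [z|]; last exact: inv_kernel.
rewrite -(gen_invariantE U_presented eps_counit act_module_algebra).
split=> [iz|[p ->]]; last first.
  exact: (gen_invariant_freeeval q_neq0 U_presented eps_counit act_module_algebra act_generators).
have [N fz] := fil_all z; have [l _ ->] := invariant_span iz fz.
exists (\sum_(t <- l) t.1 *: free_word C (inv_word t.2)); rewrite linear_sum /=.
by apply: eq_bigr => t _; rewrite linearZ /= freeeval_word.
Qed.

Lemma invariants_basis : is_basis (Uq_invariant eps act) inv_exp_ok mono.
Proof.
split=> [i _|s c us ok|z].
- rewrite -(gen_invariantE U_presented eps_counit act_module_algebra).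
  exact: inv_monomial_invariant.
- exact: inv_monomial_free.
rewrite -(gen_invariantE U_presented eps_counit act_module_algebra) => iz.
have [N fz] := fil_all z; have [l okl ->] := invariant_span iz fz.
exists (undup (unzip2 l)), (fun i => \sum_(t <- l | t.2 == i) t.1); split; last exact: sum_pairs.
by apply/allP => j; rewrite mem_undup => /mapP[t tl ->]; apply: (allP okl).
Qed.

End Presentation.

Local Open Scope complex_scope.

Theorem theorem0p1 (R : realType) (q : R[i])
    (q_neq0 : q != 0) (q_generic : forall n : nat, (0 < n)%N -> q ^+ n != 1)
    (U : algType R[i]) (ug : uq_gen -> U) (eps : {lrmorphism U -> R[i]^o})
    (A : algType R[i]) (M : 'I_3 -> 'M[A]_2) (act : U -> A -> A)
    (U_presented : is_Uq_sl2 q ug) (eps_counit : is_counit ug eps)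
    (A_presented : is_sphere_algebra q M)
    (act_module_algebra : module_algebra ug eps act)
    (act_generators : acts_on_generators q ug act M) :
  presented_by (Uq_invariant eps act) (inv_elt q M) (inv_rels q) /\
  is_basis (Uq_invariant eps act) inv_exp_ok (inv_monomial (inv_elt q M)).
Proof.
split.
  exact: (invariants_presented q_neq0 q_generic A_presented U_presented eps_counit
    act_module_algebra act_generators).
exact: (invariants_basis q_neq0 q_generic A_presented U_presented eps_counit
  act_module_algebra act_generators).
Qed.
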